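(* Let $\eta\in(0,1)$ and $t\in[1,2]$. There is a (small enough) constant $c_\nu>0$ depending only on $\eta$ and $t$ such that, with $\lambda,\nu,i_*$ and $a=\frac{4t}{4-t}$ defined in the context from this $c_\nu$, up to multiplicative constants depending only on $\eta$ and $t$ (uniformly over $d\ge1$, $\sigma_1\ge\dots\ge\sigma_d>0$ and $s\in\{1,\dots,d\}$), $$\epsilon^*(s,t,\Sigma)^t\ \asymp\ \lambda^t s+\nu^t\ \asymp\ \lambda^t s+\|\sigma_{\le i_*}\|_a^t,$$ where $\sigma_{\le i_*}=(\sigma_1,\dots,\sigma_{i_*})$.
   Context: Testing problem. Let $d\ge1$, $[d]=\{1,\dots,d\}$, $\sigma_1\ge\dots\ge\sigma_d>0$ known, $\Sigma=\operatorname{diag}(\sigma_1^2,\dots,\sigma_d^2)$. For $\theta\in\mathbb R^d$, $\mathbb P_\theta$ denotes the law of $X\sim\mathcal N(\theta,\Sigma)$. For $p>0$, $\|u\|_p=(\sum_j|u_j|^p)^{1/p}$ ($0$ for the empty vector); $\|u\|_0=\operatorname{Card}\{j:u_j\ne0\}$. For $\epsilon>0$, $s\in[d]$: $\Theta(\epsilon,s,t)=\{\theta\in\mathbb R^d:\|\theta\|_t\ge\epsilon,\ \|\theta\|_0\le s\}$. A test is a measurable $\psi:\mathbb R^d\to\{0,1\}$ of $X$; its risk is $R(\psi,\epsilon,s,t,\Sigma)=\mathbb P_0(\psi=1)+\sup_{\theta\in\Theta(\epsilon,s,t)}\mathbb P_\theta(\psi=0)$; $R^*=\inf_\psi R$ over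 all tests; $\epsilon^*(s,t,\Sigma)=\inf\{\epsilon>0:R^*(\epsilon,s,t,\Sigma)\le\eta\}$. Parameters. $a=\frac{4t}{4-t}$. Convention $1/0=+\infty$; $x\wedge y=\min(x,y)$; the maximum of an empty set of indices is $0$. For $x\ge0$ let $j_*(x)=\max\{j\in[d]:\sigma_j\ge x\}$, and let $\overline\nu(x)>0$ be the unique solution of $$\sum_{j\le j_*(x)}\frac{\sigma_j^a}{\overline\nu(x)^a}\wedge\frac{\sigma_j^4}{x^{4-2t}\,\overline\nu(x)^{2t}}+\sum_{j>j_*(x)}\frac{\sigma_j^{2t}}{\overline\nu(x)^{2t}}\exp\Big(-\frac{x^2}{\sigma_j^2}+1\Big)=c_\nu .$$ Let $$f(x)=\sum_{j\le j_*(x)}1\wedge\frac{\sigma_j^4}{x^{4-t}\,\overline\nu(x)^t}+\sum_{j>j_*(x)}\frac{\sigma_j^t}{\overline\nu(x)^t}\exp\Big(-\frac{x^2}{\sigma_j^2}+1\Big),$$ $\lambda=\inf\{x\ge0:f(x)=s/2\}$, $\nu=\overline\nu(\lambda)$, $j_*=j_*(\lambda)$, $i_*=\max\{j\le j_*:\sigma_j^4\ge\lambda^{4-t}\nu^t\}$. $f\asymp g$ means $c\,g\le f\le C\,g$ for constants $c,C>0$ depending only on $\eta$ and $t$. *)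

(* Defs.v *)
From HB Require Import structures.
From mathcomp Require Import all_boot all_order all_algebra.
From mathcomp Require Import all_classical all_reals all_analysis.

Set Implicit Arguments.
Unset Strict Implicit.
Unset Printing Implicit Defensive.

Import Order.TTheory GRing.Theory Num.Theory.
Import numFieldNormedType.Exports.

Local Open Scope classical_set_scope.
Local Open Scope ring_scope.

(* R^d as a measurable space; its sigma-algebra is generated by the
   coordinates, which gives the Borel sets of R^d. *)
Notation Rvec R d := (d.-tuple (measurableTypeR R)).

Section gaussian_law.
Context {R : realType}.

Definition cons_pair d (xy : measurableTypeR R * Rvec R d) : Rvec R d.+1 :=
  [tuple of xy.1 :: xy.2].

Lemma measurable_cons_pair d : measurable_fun setT (@cons_pair d).
Proof. exact: (measurable_cons measurable_fst measurable_snd). Qed.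

HB.instance Definition _ d :=
  isMeasurableFun.Build _ _ _ _ (@cons_pair d) (@measurable_cons_pair d).

(* The law N(theta, diag(sigma_1^2, .., sigma_d^2)), built as the product of
   the laws N(theta_j, sigma_j^2); the second parameter of normal_prob is the
   standard deviation. *)
Fixpoint gaussian d : d.-tuple R -> d.-tuple R -> probability (Rvec R d) R :=
  match d with
  | 0 => fun _ _ => dirac ([tuple] : Rvec R 0)
  | d'.+1 => fun theta sigma =>
      distribution
        (normal_prob (thead theta) (thead sigma) \x
         gaussian (behead_tuple theta) (behead_tuple sigma))%E
        (@cons_pair d')
  end.

Lemma tnth_behead_lift d (u : d.+1.-tuple R) (j : 'I_d) :
  tnth (behead_tuple u) j = tnth u (lift ord0 j).
Proof.
by case/tupleP: u => x u; rewrite tnthS (tnth_nth x) (tnth_nth x).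
Qed.

Lemma gaussian_rect d (theta sigma : d.-tuple R) (A : 'I_d -> set R) :
    (forall j, measurable (A j : set (measurableTypeR R))) ->
  gaussian theta sigma [set x | forall j, A j (tnth x j)] =
  (\prod_(j < d) normal_prob (tnth theta j) (tnth sigma j) (A j))%E.
Proof.
elim: d theta sigma A => [|d IH] theta sigma A mA.
  by rewrite big_ord0 /= /dirac/= indicE mem_set//= => -[].
have mB : measurable [set x : Rvec R d | forall j, A (lift ord0 j) (tnth x j)].
  rewrite [X in measurable X](_ : _ =
    \bigcap_j ((fun x : Rvec R d => tnth x j) @^-1` A (lift ord0 j))).
    apply: fin_bigcap_measurable => // j _.
    rewrite -[X in measurable X]setTI.
    by apply: measurable_tnth => //; exact: mA.
  by apply/seteqP; split => x /= h j //=; exact: h.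
rewrite big_ord_recl.
under eq_bigr do rewrite -!tnth_behead_lift.
rewrite -(IH (behead_tuple theta) (behead_tuple sigma)) //.
rewrite -product_measure1E//=.
congr (_ _); apply/seteqP; split => -[x y] /=.
  move=> h; split; first by have := h ord0.
  by move=> j; have := h (lift ord0 j); rewrite tnthS.
move=> [h0 h1] j; have [j' ->|->//] := unliftP ord0 j.
by rewrite tnthS.
Qed.
End gaussian_law.

Section testing.
Context {R : realType}.
Implicit Types (eps t p eta : R) (d s : nat).

Definition lpnorm p (u : seq R) : R := (\sum_(x <- u) `|x| `^ p) `^ p^-1.

Definition l0norm (u : seq R) : nat := count (fun x => x != 0) u.

Definition Theta d eps s t : set (d.-tuple R) :=
  [set theta : d.-tuple R | eps <= lpnorm t theta /\ (l0norm theta <= s)%N].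

Definition risk d (psi : {mfun Rvec R d >-> bool}) eps s t
    (sigma : d.-tuple R) : \bar R :=
  (gaussian (nseq_tuple d (0 : R)%R) sigma (psi @^-1` [set true]) +
   ereal_sup [set gaussian theta sigma (psi @^-1` [set false])
             | theta in @Theta d eps s t])%E.

Definition minimax_risk d eps s t (sigma : d.-tuple R) : \bar R :=
  ereal_inf [set risk psi eps s t sigma
            | psi in [set: {mfun Rvec R d >-> bool}]].

Definition eps_star eta d s t (sigma : d.-tuple R) : R :=
  inf [set eps | 0 < eps /\ (minimax_risk eps s t sigma <= eta%:E)%E].

End testing.

Definition exp_a {R : realType} (t : R) : R := 4 * t / (4 - t).

Section rate.
Context {R : realType} (t c_nu : R) (d : nat) (sigma : d.-tuple R).

Local Notation sg := (tnth sigma).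

(* u /\ (v / w) for v > 0, with the convention 1 / 0 = +oo. *)
Definition min_frac (u v w : R) : R :=
  if w == 0 then u else Num.min u (v / w).

(* Indices are 1, .., d, the j-th entry being j.+1-th in this numbering:
   "j <= j_*(x)" reads (j < j_star x)%N, and j_star x = 0 if no entry of sigma
   is at least x. *)
Definition j_star (x : R) : nat := (\max_(j < d | (x <= sg j)%R) j.+1)%N.

Definition nu_sum (x v : R) : R :=
  \sum_(j < d | (j < j_star x)%N)
     min_frac (sg j `^ exp_a t / v `^ exp_a t) (sg j ^+ 4)
              (x `^ (4 - 2 * t) * v `^ (2 * t)) +
  \sum_(j < d | (j_star x <= j)%N)
     sg j `^ (2 * t) / v `^ (2 * t) * expR (- (x ^+ 2 / sg j ^+ 2) + 1).

(* For c_nu > 0, x >= 0 and positive sigma the solution v > 0 exists (if d > 0)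
   and is unique; 0 is a junk value. *)
Definition nu_bar (x : R) : R := xget 0 [set v | 0 < v /\ nu_sum x v = c_nu].

Definition f_sum (x : R) : R :=
  \sum_(j < d | (j < j_star x)%N)
     min_frac 1 (sg j ^+ 4) (x `^ (4 - t) * nu_bar x `^ t) +
  \sum_(j < d | (j_star x <= j)%N)
     sg j `^ t / nu_bar x `^ t * expR (- (x ^+ 2 / sg j ^+ 2) + 1).

Definition lambda (s : nat) : R := inf [set x | 0 <= x /\ f_sum x = s%:R / 2].

Definition nu (s : nat) : R := nu_bar (lambda s).

Definition i_star (s : nat) : nat :=
  (\max_(j < d | (j < j_star (lambda s)) &&
      (lambda s `^ (4 - t) * nu s `^ t <= sg j ^+ 4)%R) j.+1)%N.

End rate.

Definition asymp {R : realType} (c C f g : R) := c * g <= f <= C * g.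

(* Main.v *)
(* To each coordinate attach a frequency [freq], an amplitude [amplitude] and a
   mass [mass]; by the definitions of nu and lambda the masses sum to c_nu and
   the frequencies to s / 2, and mass * nu^t <= freq * amplitude^t with
   lambda <= amplitude.  Hence sum_j freq_j * amplitude_j^t dominates
   lambda^t * s + nu^t up to constants.

   Lower bound: let theta_j be 0, or +/- amplitude_j with a random sign, with
   probability proportional to freq_j and independently over j.  The chi-square
   distance of the mixture to P_0 is controlled by
   sum_j freq_j^2 (cosh (amplitude_j^2 / sigma_j^2) - 1) <= e * c_nu.  According to
   which part of sum_j freq_j * amplitude_j^t dominates, the prior lives on the
   coordinates of frequency 1, or is a thinned version on the other ones, or has a
   single nonzero coordinate of size lambda.

   Upper bound: reject for large values of
   sum_(sigma_j >= lambda) w_j X_j^2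
     + sum_(sigma_j < lambda) (|X_j| / nu)^t 1{|X_j| >= 3 K lambda},
   where w_j = freq_j * amplitude_j^2 / sigma_j^4.  Both errors are bounded by
   Chebyshev's inequality, the masses bounding the null variances. *)

From HB Require Import structures.
Require Import Defs.
From mathcomp Require Import all_boot all_order all_algebra.
From mathcomp Require Import all_classical all_reals all_analysis.
From mathcomp Require Import measurable_realfun ring lra.

Set Implicit Arguments.
Unset Strict Implicit.
Unset Printing Implicit Defensive.

Import Order.TTheory GRing.Theory Num.Theory.
Import numFieldNormedType.Exports.

Local Open Scope classical_set_scope.
Local Open Scope ring_scope.

(** * Gaussian integrals *)

(** The three classes of coordinates reflect what each can reveal. If sigma_j < lambda, only rare
    large observations are informative, hence the exponential factors. If sigma_j >= lambda, a
    quadratic statistic works, and comparing sigma_j^4 with lambda^(4-t) nu^t separates a dense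
    signal of frequency 1 from a sparser one of size lambda. Two obstacles shape the proof. Under
    the alternative the truncated power |X_j|^t would need a variance bound for every theta; the
    second error only needs a lower bound of the statistic, so once theta is fixed the power is
    replaced by a bounded minorant with signal D_j and variance at most D_j^2 / K^2. These variances
    sum to the order of the squared total signal itself, so only a K of order 1/eta makes them
    harmless, and K enters the truncation level. Second, nu and lambda are implicit. The infimum
    defining lambda solves its equation only if f is continuous, while the summands change formula
    at each sigma_j. A jump occurs there only when sigma_j exceeds v, which makes a summand of the
    nu-equation at least 1; at a solution the summands total c_nu < 1. *)

Section normal_integrals.
Context {R : realType}.
Implicit Types (m sigma x : R).
Local Notation mu := (@lebesgue_measure R).
Local Open Scope ereal_scope.

Import HBNNSimple.

Let normal_indic m sigma E : measurable E ->
  \int[normal_prob m sigma]_x (\1_E x)%:E =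
  \int[mu]_x ((\1_E x)%:E * (normal_pdf m sigma x)%:E).
Proof.
move=> mE; rewrite integral_indic// setIT.
rewrite [LHS](_ : _ = \int[mu]_(x in E) (normal_pdf m sigma x)%:E)//.
rewrite integral_mkcond; apply: eq_integral => x _.
by rewrite /patch indicE; case: ifP => _; rewrite ?mul1e ?mul0e.
Qed.

Let mpdf m sigma : measurable_fun [set: measurableTypeR R] (EFin \o normal_pdf m sigma).
Proof. by apply/measurable_EFinP; exact: measurable_normal_pdf. Qed.

Let pdf0 m sigma x : 0 <= (normal_pdf m sigma x)%:E.
Proof. by rewrite lee_fin normal_pdf_ge0. Qed.

Let normal_nnsfun m sigma (h : {nnsfun (measurableTypeR R) >-> R}) :
  \int[normal_prob m sigma]_x (h x)%:E =
  \int[mu]_x ((h x)%:E * (normal_pdf m sigma x)%:E).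
Proof.
under [LHS]eq_integral do rewrite fimfunE -fsumEFin//.
rewrite [LHS]ge0_integral_fsum//; last 2 first.
  - by move=> r; exact/measurable_EFinP/measurableT_comp.
  - by move=> n x _; rewrite EFinM nnfun_muleindic_ge0.
under [RHS]eq_integral.
  move=> x xD; rewrite fimfunE -fsumEFin// ge0_mule_fsuml; last first.
    by move=> r; rewrite EFinM nnfun_muleindic_ge0.
  over.
rewrite [RHS]ge0_integral_fsum//; last 2 first.
  - move=> r; apply: emeasurable_funM; last exact: mpdf.
    by apply/measurable_EFinP; do 2 apply/measurableT_comp => //.
  - by move=> n x _; rewrite mule_ge0// EFinM nnfun_muleindic_ge0.
apply: eq_fsbigr => r _.
under [RHS]eq_integral do rewrite EFinM -muleA.
under [LHS]eq_integral do rewrite EFinM.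
have [r0|r0] := leP 0%R r; last first.
  rewrite preimage_nnfun0//.
  under eq_integral do rewrite indic0 mule0.
  under [RHS]eq_integral do rewrite indic0 mul0e mule0.
  by rewrite !integral0.
have mh : measurable (h @^-1` [set r]) by [].
have mI : measurable_fun [set: measurableTypeR R]
    (fun x => (\1_(h @^-1` [set r]) x)%:E : \bar R).
  by apply/measurable_EFinP; exact: measurable_indic.
rewrite [LHS]ge0_integralZl// [RHS]ge0_integralZl//; last 2 first.
- by apply: emeasurable_funM => //; exact: mpdf.
- by move=> x _; rewrite mule_ge0// lee_fin.
by rewrite normal_indic.
Qed.

(** Indicators, then simple functions, then monotone convergence on both sides. *)
Lemma ge0_integral_normal m sigma (f : measurableTypeR R -> \bar R) :
  measurable_fun setT f -> (forall x, 0 <= f x) ->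
  \int[normal_prob m sigma]_x f x =
  \int[mu]_x (f x * (normal_pdf m sigma x)%:E).
Proof.
move=> mf f0; pose f_ := nnsfun_approx measurableT mf.
transitivity (limn (fun n => \int[normal_prob m sigma]_x (f_ n x)%:E)).
  rewrite -monotone_convergence//=.
  - apply: eq_integral => x _; apply/esym/cvg_lim => //=.
    by apply: cvg_nnsfun_approx => // y _; exact: f0.
  - by move=> n; apply: measurableT_comp.
  - by move=> n x _; rewrite lee_fin.
  - by move=> x _ a b ab; rewrite lee_fin//; exact/lefP/nd_nnsfun_approx.
rewrite (_ : \int[mu]_x _ =
    limn (fun n => \int[mu]_x ((f_ n x)%:E * (normal_pdf m sigma x)%:E))).
  by congr (limn _); apply/funext => n; exact: normal_nnsfun.
rewrite -monotone_convergence//=.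
- apply: eq_integral => x _; apply/esym/cvg_lim => //=.
  apply: cvgeZr => //.
  by apply: cvg_nnsfun_approx => // y _; exact: f0.
- move=> n; apply: emeasurable_funM; last exact: mpdf.
  exact/measurable_EFinP.
- by move=> n x _; rewrite mule_ge0// lee_fin.
- move=> x _ a b ab; rewrite lee_wpmul2r// lee_fin.
  exact/lefP/nd_nnsfun_approx.
Qed.

End normal_integrals.

(** * Translation, reflection and tilting of normal laws *)

Section normal_transforms.
Context {R : realType}.
Implicit Types (m sigma x c : R).
Local Notation mu := (@lebesgue_measure R).
Local Open Scope ereal_scope.

Definition translation c : measurableTypeR R -> measurableTypeR R :=
  fun x => (x + c)%R.

Lemma measurable_translation c : measurable_fun setT (translation c).
Proof. exact: measurable_funD. Qed.

HB.instance Definition _ c :=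
  isMeasurableFun.Build _ _ _ _ (translation c) (measurable_translation c).

Definition reflection : measurableTypeR R -> measurableTypeR R := fun x => (- x)%R.

Lemma measurable_reflection : measurable_fun setT reflection.
Proof. exact: oppr_measurable. Qed.

HB.instance Definition _ :=
  isMeasurableFun.Build _ _ _ _ reflection measurable_reflection.

Lemma lebesgue_measure_translation c (A : set R) : measurable A ->
  pushforward mu (translation c) A = mu A.
Proof.
move=> mA; apply/esym/lebesgue_measure_unique => //= _ [[a b]] _ <-.
rewrite /pushforward.
rewrite (_ : _ @^-1` _ = `](a - c)%R, (b - c)%R]%classic); last first.
  by apply/seteqP; split=> x /=; rewrite !in_itv/= /translation ltrBlDr lerBrDr.
rewrite !lebesgue_measure_itv/=.
by rewrite !lte_fin ltrD2r -!EFinB opprB addrA subrK.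
Qed.

Lemma normal_pdf_shift m sigma x : sigma != 0%R ->
  normal_pdf m sigma (x + m) = normal_pdf 0 sigma x.
Proof. by move=> s0; rewrite !normal_pdfE// /normal_fun addrK subr0. Qed.

Lemma normal_pdf_opp sigma x : sigma != 0%R ->
  normal_pdf 0 sigma (- x) = normal_pdf 0 sigma x.
Proof. by move=> s0; rewrite !normal_pdfE// /normal_fun !subr0 sqrrN. Qed.

Let measurable_EFin_pdf m sigma :
  measurable_fun [set: measurableTypeR R] (EFin \o normal_pdf m sigma).
Proof. by apply/measurable_EFinP; exact: measurable_normal_pdf. Qed.

Let pdf_ge0 m sigma x : 0 <= (normal_pdf m sigma x)%:E.
Proof. by rewrite lee_fin normal_pdf_ge0. Qed.

Lemma ge0_integral_normal_shift m sigma (f : measurableTypeR R -> \bar R) :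
  sigma != 0%R -> measurable_fun setT f -> (forall x, 0 <= f x) ->
  \int[normal_prob m sigma]_x f x = \int[normal_prob 0 sigma]_x f (x + m)%R.
Proof.
move=> s0 mf f0; pose g y := f y * (normal_pdf m sigma y)%:E.
have mg : measurable_fun setT g by apply: emeasurable_funM => //; exact: measurable_EFin_pdf.
have g0 y : 0 <= g y by rewrite mule_ge0.
have mfm := measurableT_comp mf (measurable_translation m).
rewrite (ge0_integral_normal _ _ mf f0).
rewrite [RHS](ge0_integral_normal _ _ mfm (fun x => f0 _)).
transitivity (\int[mu]_x (g \o translation m) x); last first.
  by apply: eq_integral => x _; rewrite /g/= /translation (normal_pdf_shift m _ s0).
have -> : \int[mu]_x g x = \int[pushforward mu (translation m)]_x g x.
  by apply: eq_measure_integral => A mA _; exact/esym/lebesgue_measure_translation.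
by rewrite ge0_integral_pushforward.
Qed.

Lemma ge0_integral_normal_reflection sigma (f : measurableTypeR R -> \bar R) :
  sigma != 0%R -> measurable_fun setT f -> (forall x, 0 <= f x) ->
  \int[normal_prob 0 sigma]_x f (- x)%R = \int[normal_prob 0 sigma]_x f x.
Proof.
move=> s0 mf f0; pose g y := f y * (normal_pdf 0 sigma y)%:E.
have mg : measurable_fun setT g by apply: emeasurable_funM => //; exact: measurable_EFin_pdf.
have g0 y : 0 <= g y by rewrite mule_ge0.
have mfm := measurableT_comp mf measurable_reflection.
rewrite [RHS](ge0_integral_normal _ _ mf f0).
rewrite [LHS](ge0_integral_normal _ _ mfm (fun x => f0 _)).
transitivity (\int[mu]_x (g \o reflection) x).
  by apply: eq_integral => x _; rewrite /g/= /reflection (normal_pdf_opp _ s0).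
have -> : \int[mu]_x g x = \int[pushforward mu reflection]_x g x.
  by apply: eq_measure_integral => A mA _; exact/esym/lebesgue_measureN.
by rewrite ge0_integral_pushforward.
Qed.

(** The likelihood ratio of N(m, sigma^2) against N(0, sigma^2). *)
Definition tilt m sigma x := expR (x * m / sigma ^+ 2 - m ^+ 2 / (2 * sigma ^+ 2)).

Lemma measurable_tilt m sigma : measurable_fun [set: measurableTypeR R] (tilt m sigma).
Proof.
apply: measurableT_comp => //; apply: measurable_funB => //.
by apply: measurable_funM => //; apply: measurable_funM.
Qed.

Lemma tilt_ge0 m sigma x : (0 <= tilt m sigma x)%R.
Proof. exact: expR_ge0. Qed.

(** A product of two likelihood ratios is a multiple of a third one, which integrates to 1; the
    factor is thus the cross moment that enters the chi-square distance of a mixture. *)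
Lemma tiltM m m' sigma x : sigma != 0%R ->
  (tilt m sigma x * tilt m' sigma x =
   expR (m * m' / sigma ^+ 2) * tilt (m + m') sigma x)%R.
Proof. by move=> s0; rewrite /tilt -!expRD; congr expR; field. Qed.

Lemma normal_pdf_tilt m sigma x : sigma != 0%R ->
  normal_pdf m sigma x = (tilt m sigma x * normal_pdf 0 sigma x)%R.
Proof.
move=> s0; rewrite !normal_pdfE// mulrCA; congr *%R.
rewrite /normal_fun /tilt -expRD subr0; congr expR.
by field.
Qed.

Lemma ge0_integral_normal_tilt m sigma (f : measurableTypeR R -> \bar R) :
  sigma != 0%R -> measurable_fun setT f -> (forall x, 0 <= f x) ->
  \int[normal_prob m sigma]_x f x =
  \int[normal_prob 0 sigma]_x (f x * (tilt m sigma x)%:E).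
Proof.
move=> s0 mf f0; rewrite (ge0_integral_normal _ _ mf f0) ge0_integral_normal; last 2 first.
- by apply: emeasurable_funM => //; apply/measurable_EFinP; exact: measurable_tilt.
- by move=> x; rewrite mule_ge0// lee_fin tilt_ge0.
by apply: eq_integral => x _; rewrite (normal_pdf_tilt m)// EFinM muleA.
Qed.

(** The exponential halves the exponent of the density, which becomes sqrt 2 times the density of
    N(0, 2 sigma^2). *)
Lemma normal_exp_sqr sigma : sigma != 0%R ->
  \int[normal_prob 0 sigma]_x (expR (x ^+ 2 / (4 * sigma ^+ 2)))%:E
  = (Num.sqrt 2)%:E.
Proof.
move=> s0; have s20 : (Num.sqrt 2 : R) != 0%R by rewrite sqrtr_eq0 -ltNge.
have peakE : normal_peak sigma = (Num.sqrt 2 * normal_peak (Num.sqrt 2 * sigma))%R.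
  rewrite /normal_peak exprMn sqr_sqrtr//.
  have -> : (2 * sigma ^+ 2 * pi *+ 2 = 2 * (sigma ^+ 2 * pi *+ 2) :> R)%R by ring.
  by rewrite [in RHS]sqrtrM// invfM mulrA divff// mul1r.
rewrite ge0_integral_normal//; last first.
  apply/measurable_EFinP; apply: measurableT_comp => //.
  by apply: measurable_funM => //; exact: measurable_funX.
rewrite (_ : (fun x => _) = fun x =>
    (Num.sqrt 2)%:E * (normal_pdf 0 (Num.sqrt 2 * sigma) x)%:E).
  rewrite ge0_integralZl//; last exact: measurable_EFin_pdf.
  by rewrite integral_normal_pdf mule1.
apply/funext => x; rewrite -!EFinM; congr EFin.
rewrite !normal_pdfE ?mulf_neq0//= [RHS]mulrA -peakE mulrCA; congr (_ * _)%R.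
rewrite /normal_fun -expRD !subr0 exprMn sqr_sqrtr//; congr expR.
by field.
Qed.

End normal_transforms.

Section second_moment.
Context d (T : measurableType d) {R : realType} (P : probability T R).
Local Open Scope ereal_scope.

Lemma integral_cst_probability (r : R) : \int[P]__ r%:E = r%:E.
Proof. by rewrite integral_cst// [X in _ * X]probability_setT mule1. Qed.

Lemma integrable_sqr (Y : T -> R) : measurable_fun setT Y ->
  \int[P]_x ((Y x) ^+ 2)%:E < +oo -> P.-integrable setT (EFin \o Y).
Proof.
move=> mY Y2; apply/integrableP; split; first exact/measurable_EFinP.
have mY2 : measurable_fun setT (fun x => ((Y x) ^+ 2)%:E).
  by apply/measurable_EFinP; exact: measurable_funX.
apply: (@le_lt_trans _ _ (\int[P]_x (1 + ((Y x) ^+ 2)%:E))).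
  apply: ge0_le_integral => //.
  - by apply: measurableT_comp => //; exact/measurable_EFinP.
  - by apply: emeasurable_funD.
  - move=> x _; rewrite /= -EFinD lee_fin.
    by rewrite -[(Y x ^+ 2)%R]real_normK ?num_real//; nra.
rewrite ge0_integralD//; last by move=> x _; rewrite lee_fin sqr_ge0.
by rewrite integral_cst_probability lte_add_pinfty// ltry.
Qed.

(** The second moment of Y bounds its variance; the shift by an arbitrary c is the form that the
    induction over coordinates in [gaussian_sum_sqr] consumes. *)
Lemma integral_centered_sqr (Y : T -> R) (m v c : R) : measurable_fun setT Y ->
  \int[P]_x ((Y x) ^+ 2)%:E <= v%:E -> \int[P]_x (Y x)%:E = m%:E ->
  \int[P]_x ((c + (Y x - m)) ^+ 2)%:E <= (c ^+ 2 + v)%:E.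
Proof.
move=> mY Y2v Ym.
have Y2 : \int[P]_x ((Y x) ^+ 2)%:E < +oo by rewrite (le_lt_trans Y2v) ?ltry.
have iY := integrable_sqr mY Y2.
have iY2 : P.-integrable setT (EFin \o (fun x => Y x ^+ 2)%R).
  apply/integrableP; split.
    by apply/measurable_EFinP; exact: measurable_funX.
  by under eq_integral do rewrite /= ger0_norm ?sqr_ge0//.
rewrite (eq_integral (fun x => ((c - m) ^+ 2)%:E + (2 * (c - m))%:E * (Y x)%:E
    + (Y x ^+ 2)%:E)); last first.
  by move=> x _; rewrite -EFinM -!EFinD; congr EFin; ring.
rewrite integralD//=; last first.
  apply: integrableD => //; first exact: finite_measure_integrable_cst.
  exact: integrableZl.
rewrite integralD//=; last 2 first.
- exact: finite_measure_integrable_cst.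
- exact: integrableZl.
rewrite integral_cst_probability integralZl// Ym.
apply: (@le_trans _ _ (((c - m) ^+ 2)%:E + (2 * (c - m))%:E * m%:E + v%:E)).
  by rewrite leeD2l.
rewrite -EFinM -!EFinD lee_fin.
by have := sqr_ge0 m; nra.
Qed.

End second_moment.

(** * Moment and tail bounds for the centred normal law *)

Section normal_moments.
Context {R : realType}.
Implicit Types (m sigma x c : R).
Local Open Scope ereal_scope.

Let sqrt2_le2 : (Num.sqrt 2 <= 2 :> R)%R.
Proof.
by have := sqr_sqrtr (ler0n R 2); have := sqrtr_ge0 (2 : R); nra.
Qed.

Lemma expR_ge_sqr x : (0 <= x -> x ^+ 2 <= 4 * expR x)%R.
Proof.
move=> x0; have := expR_ge1Dx (x / 2)%R; have -> : expR x = (expR (x / 2) ^+ 2)%R.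
  by rewrite expr2 -expRD -splitr.
by move=> h; nra.
Qed.

(** Moment bounds reduce to pointwise domination by one exponential, at the price of constants
    larger than the exact moments. The factor 2 bounds sqrt 2. *)
Lemma normal_exp_bound sigma (f : measurableTypeR R -> R) (C : R) :
  sigma != 0%R -> (0 <= C)%R -> measurable_fun setT f ->
  (forall x, 0 <= f x)%R ->
  (forall x, f x <= C * expR (x ^+ 2 / (4 * sigma ^+ 2)))%R ->
  \int[normal_prob 0 sigma]_x (f x)%:E <= (2 * C)%:E.
Proof.
move=> s0 C0 mf f0 fC.
have me : measurable_fun setT (fun x : measurableTypeR R =>
    (expR (x ^+ 2 / (4 * sigma ^+ 2)))%:E).
  apply/measurable_EFinP; apply: measurableT_comp => //.
  by apply: measurable_funM => //; exact: measurable_funX.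
apply: (@le_trans _ _ (\int[normal_prob 0 sigma]_x
    (C%:E * (expR (x ^+ 2 / (4 * sigma ^+ 2)))%:E))).
  apply: ge0_le_integral => //.
  - by move=> x _; rewrite lee_fin.
  - exact/measurable_EFinP.
  - exact: measurable_funeM.
  - by move=> x _; rewrite -EFinM lee_fin.
rewrite ge0_integralZl// normal_exp_sqr// -EFinM lee_fin.
by rewrite mulrC ler_wpM2r.
Qed.

Lemma normal_sqr_le sigma : sigma != 0%R ->
  \int[normal_prob 0 sigma]_x (x ^+ 2)%:E <= (8 * sigma ^+ 2)%:E.
Proof.
move=> s0; have s20 : (0 < sigma ^+ 2)%R by rewrite exprn_even_gt0.
rewrite (_ : 8 * sigma ^+ 2 = 2 * (4 * sigma ^+ 2))%R; last by ring.
apply: normal_exp_bound => //.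
- by rewrite mulr_ge0// ltW.
- by move=> x; rewrite sqr_ge0.
- have c0 : (0 < 4 * sigma ^+ 2)%R by rewrite mulr_gt0.
  move=> x; rewrite mulrC -(ler_pdivrMr _ _ c0).
  by apply: le_trans (expR_ge1Dx _); rewrite lerDr.
Qed.

Lemma normal_pow4_le sigma : sigma != 0%R ->
  \int[normal_prob 0 sigma]_x (x ^+ 4)%:E <= (128 * sigma ^+ 4)%:E.
Proof.
move=> s0; have s20 : (0 < sigma ^+ 2)%R by rewrite exprn_even_gt0.
rewrite (_ : 128 * sigma ^+ 4 = 2 * (64 * sigma ^+ 4))%R; last by ring.
apply: normal_exp_bound => //.
- by rewrite mulr_ge0// exprn_even_ge0.
- by move=> x; rewrite exprn_even_ge0.
- move=> x; set y := (x ^+ 2 / (4 * sigma ^+ 2))%R.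
  have y0 : (0 <= y)%R by rewrite divr_ge0 ?sqr_ge0// mulr_ge0// ltW.
  have -> : (x ^+ 4 = 16 * sigma ^+ 4 * y ^+ 2)%R by rewrite /y; field.
  have -> : (64 * sigma ^+ 4 * expR y = 16 * sigma ^+ 4 * (4 * expR y))%R by ring.
  by apply: ler_wpM2l (expR_ge_sqr y0); rewrite mulr_ge0// exprn_even_ge0.
Qed.

Lemma normal_integrable_id sigma : sigma != 0%R ->
  (normal_prob 0 sigma).-integrable setT (EFin \o (@id (measurableTypeR R))).
Proof.
move=> s0; apply: integrable_sqr => //.
exact: le_lt_trans (normal_sqr_le s0) (ltry _).
Qed.

(** By symmetry the positive and negative parts of the identity have the same integral, which is
    finite. *)
Lemma normal_mean sigma : sigma != 0%R -> \int[normal_prob 0 sigma]_x x%:E = 0.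
Proof.
move=> s0; pose f := EFin \o (@id (measurableTypeR R)).
have mf : measurable_fun setT f by exact/measurable_EFinP.
have mpos : measurable_fun setT f^\+ by exact: measurable_funepos.
rewrite [LHS](_ : _ = \int[normal_prob 0 sigma]_x f x)// integralE.
have -> : \int[normal_prob 0 sigma]_x f^\- x = \int[normal_prob 0 sigma]_x f^\+ x.
  rewrite -[RHS](ge0_integral_normal_reflection s0 mpos)//.
  by apply: eq_integral => x _; rewrite funenegE funeposE.
rewrite subee//.
have := integrable_funepos measurableT (normal_integrable_id s0).
by move=> /(integrable_fin_num measurableT).
Qed.

Lemma normal_tail sigma (r : R) : sigma != 0%R -> (0 < r)%R ->
  normal_prob 0 sigma [set x | (r <= `|x|)%R] <= (8 * sigma ^+ 2 / r ^+ 2)%:E.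
Proof.
move=> s0 r0; pose A : set (measurableTypeR R) := [set x | (r <= `|x|)%R].
have mA : measurable A.
  rewrite (_ : A = (fun x : measurableTypeR R => `|x|%R) @^-1` `[r, +oo[%classic); last first.
    by apply/seteqP; split => x; rewrite /A/= in_itv/= andbT.
  rewrite -[X in measurable X]setTI; exact: normr_measurable.
have mX2 : measurable_fun setT (fun x : measurableTypeR R => (x ^+ 2)%:E).
  by apply/measurable_EFinP; exact: measurable_funX.
rewrite [leLHS](_ : _ = \int[normal_prob 0 sigma]_x (\1_A x)%:E); last first.
  by rewrite integral_indic// setIT.
apply: (@le_trans _ _ (\int[normal_prob 0 sigma]_x ((r ^- 2)%:E * (x ^+ 2)%:E))).
  apply: ge0_le_integral => //.
  - by apply/measurable_EFinP; exact: measurable_indic.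
  - exact: measurable_funeM.
  - move=> x _; rewrite -EFinM lee_fin indicE.
    have [|_] := boolP (x \in A); last by rewrite mulr_ge0 ?invr_ge0 ?sqr_ge0.
    rewrite inE /A/= => rx; rewrite mulrC ler_pdivlMr ?exprn_gt0// mul1r.
    by rewrite -[leRHS]real_normK ?num_real// ler_pXn2r ?nnegrE// ltW.
rewrite ge0_integralZl//; last 2 first.
- by move=> x _; rewrite lee_fin sqr_ge0.
- by rewrite lee_fin invr_ge0 sqr_ge0.
rewrite [in leRHS]mulrC EFinM; apply: lee_wpmul2l; last exact: normal_sqr_le.
by rewrite lee_fin invr_ge0 sqr_ge0.
Qed.

Lemma normal_trunc_moment (t sigma r : R) :
  sigma != 0%R -> (0 < t <= 2)%R -> (0 <= r)%R ->
  \int[normal_prob 0 sigma]_x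
    ((if (3 * r <= `|x|)%R then `|x| `^ t else 0) ^+ 2)%:E
  <= (520 * (`|sigma| `^ t) ^+ 2 * expR (- r ^+ 2 / sigma ^+ 2))%:E.
Proof.
move=> s0 /andP[t0 t2] r0.
have s20 : (0 < sigma ^+ 2)%R by rewrite exprn_even_gt0.
rewrite (_ : 520 * _ * _ = 2 * (260 * (`|sigma| `^ t) ^+ 2 * expR (- r ^+ 2 / sigma ^+ 2)))%R;
  last by ring.
have C0 : (0 <= 260 * (`|sigma| `^ t) ^+ 2 * expR (- r ^+ 2 / sigma ^+ 2))%R.
  apply: mulr_ge0 (expR_ge0 _); apply: mulr_ge0 (sqr_ge0 _); exact: ler0n.
apply: (normal_exp_bound s0).
- exact: C0.
- apply: measurable_funX; apply: measurable_fun_ifT => //.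
  + by apply: measurable_fun_ler => //; exact: normr_measurable.
  + by apply: (measurableT_comp (@measurable_powR R t)); exact: normr_measurable.
- by move=> x; rewrite sqr_ge0.
- move=> x; case: ifPn => [rx|_]; last first.
    by rewrite expr0n/=; exact: mulr_ge0 C0 (expR_ge0 _).
  pose y := (`|x| / `|sigma|)%R.
  have y0 : (0 <= y)%R by rewrite divr_ge0.
  have xE : (`|x| = `|sigma| * y)%R by rewrite /y [RHS]mulrC divfK ?normr_eq0.
  (* Half of the exponent pays for the power of y. The other half pays for the factor exp(- r^2 /
     sigma^2): on the truncation event y >= 3 r / |sigma|, and 9/8 >= 1. This is the role of the
     factor 3 in the truncation. *)
  have -> : (x ^+ 2 / (4 * sigma ^+ 2) = y ^+ 2 / 8 + y ^+ 2 / 8)%R.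
    by rewrite /y expr_div_n !real_normK ?num_real//; field.
  (* As t <= 2, the left side is at most 1 + y^4, and y^4 = 64 (y^2/8)^2 <= 256 exp(y^2/8). *)
  have y4 : ((y `^ t) ^+ 2 <= 260 * expR (y ^+ 2 / 8))%R.
    have h1 : ((y `^ t) ^+ 2 <= 1 + y ^+ 4)%R.
      have [y1|/ltW y1] := leP y 1%R.
        have : (y `^ t <= 1 `^ t)%R by rewrite ge0_ler_powR ?nnegrE// ltW.
        rewrite powR1 => h; apply: (@le_trans _ _ 1%R).
          by rewrite expr_le1// powR_ge0.
        by rewrite lerDl exprn_ge0.
      have h : (y `^ t <= y ^+ 2)%R.
        by rewrite -powR_mulrn// ler_powR.
      apply: (@le_trans _ _ ((y ^+ 2) ^+ 2)%R).
        by rewrite ler_pXn2r ?nnegrE ?powR_ge0 ?exprn_ge0.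
      by rewrite -exprM lerDr.
    have y28 : (0 <= y ^+ 2 / 8)%R by rewrite divr_ge0 ?sqr_ge0.
    have h2 := expR_ge_sqr y28.
    have h3 := expR_ge1Dx (y ^+ 2 / 8)%R.
    by apply: (le_trans h1); nra.
  have y5 : (1 <= expR (- r ^+ 2 / sigma ^+ 2) * expR (y ^+ 2 / 8))%R.
    rewrite -expRD -[leLHS]expR0 ler_expR mulNr addrC subr_ge0 ler_pdivrMr//.
    have : ((3 * r) ^+ 2 <= `|x| ^+ 2)%R.
      by rewrite ler_pXn2r ?nnegrE ?mulr_ge0.
    rewrite xE [((_ * y) ^+ 2)%R]exprMn (real_normK (num_real sigma)) => h.
    by have := sqr_ge0 r; nra.
  rewrite {1}xE powRM// exprMn expRD.
  have y6 : (0 <= (`|sigma| `^ t) ^+ 2)%R by rewrite sqr_ge0.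
  have y7 := expR_ge0 (y ^+ 2 / 8).
  rewrite [leRHS](_ : _ = (`|sigma| `^ t) ^+ 2 * (260 * expR (y ^+ 2 / 8) *
    (expR (- r ^+ 2 / sigma ^+ 2) * expR (y ^+ 2 / 8))))%R; last by ring.
  apply: (ler_wpM2l y6); apply: (le_trans y4); apply: ler_peMr y5.
  by apply: mulr_ge0 y7; exact: ler0n.
Qed.

End normal_moments.

Ltac nneg := repeat first
  [done | exact: sqr_ge0 | exact: expR_ge0 | exact: powR_ge0
  | by rewrite exprn_even_ge0 | apply: mulr_ge0 | apply: addr_ge0
  | apply: divr_ge0 | rewrite invr_ge0 | apply: exprn_ge0].

(** * Quadratic statistics *)

Section quadratic.
Context {R : realType}.
Implicit Types (sigma : R).
Local Open Scope ereal_scope.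

(** This is sigma^2, kept abstract: it cancels when the means under the null and the alternative are
    subtracted, and a bound up to a constant suffices for variances. *)
Definition normal_m2 sigma : R := fine (\int[normal_prob 0 sigma]_x (x ^+ 2)%:E).

Lemma normal_m2E sigma : sigma != 0%R ->
  \int[normal_prob 0 sigma]_x (x ^+ 2)%:E = (normal_m2 sigma)%:E.
Proof.
move=> s0; rewrite /normal_m2 fineK// ge0_fin_numE; last first.
  by apply: integral_ge0 => x _; rewrite lee_fin sqr_ge0.
exact: le_lt_trans (normal_sqr_le s0) (ltry _).
Qed.

Lemma normal_m2_ge0 sigma : (0 <= normal_m2 sigma)%R.
Proof.
by apply: fine_ge0; apply: integral_ge0 => x _; rewrite lee_fin sqr_ge0.
Qed.

Lemma normal_m2_le sigma : sigma != 0%R -> (normal_m2 sigma <= 8 * sigma ^+ 2)%R.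
Proof. by move=> s0; have := normal_sqr_le s0; rewrite normal_m2E// lee_fin. Qed.

(** After translation by theta the centred statistic is 2 w theta x + w (x^2 - m2). Its square is at
    most 8 w^2 theta^2 x^2 + 2 w^2 x^4 + 2 w^2 m2^2, whence 64 = 8 * 8 and 384 = 2 * 128 + 2 *
    64. *)
Lemma normal_quadratic_centered (theta sigma w c : R) : sigma != 0%R ->
  \int[normal_prob theta sigma]_x
     ((c + (w * x ^+ 2 - w * (theta ^+ 2 + normal_m2 sigma))) ^+ 2)%:E
  <= (c ^+ 2 + (64 * (w ^+ 2 * theta ^+ 2 * sigma ^+ 2)
                + 384 * (w ^+ 2 * sigma ^+ 4)))%:E.
Proof.
move=> s0; set m2 := normal_m2 sigma.
have mx2 : measurable_fun setT (fun x : measurableTypeR R => x ^+ 2)%R.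
  exact: measurable_funX.
have mx4 : measurable_fun setT (fun x : measurableTypeR R => x ^+ 4)%R.
  exact: measurable_funX.
rewrite ge0_integral_normal_shift//; last 2 first.
- apply/measurable_EFinP; apply: measurable_funX.
  by apply: measurable_funD => //; apply: measurable_funB => //; apply: measurable_funM.
- by move=> x; rewrite lee_fin sqr_ge0.
pose Y (x : measurableTypeR R) : R := (2 * w * theta * x + w * (x ^+ 2 - m2))%R.
have mY : measurable_fun setT Y.
  apply: measurable_funD; apply: measurable_funM => //.
  exact: measurable_funB.
rewrite (eq_integral (fun x => ((c + (Y x - 0)) ^+ 2)%:E)); last first.
  by move=> x _; congr (_%:E); rewrite /Y; ring.
apply: integral_centered_sqr => //.
- apply: (@le_trans _ _ (\int[normal_prob 0 sigma]_x
     ((8 * w ^+ 2 * theta ^+ 2)%:E * (x ^+ 2)%:E +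
      (2 * w ^+ 2)%:E * (x ^+ 4)%:E + (2 * w ^+ 2 * m2 ^+ 2)%:E))).
    apply: ge0_le_integral => //.
    + by move=> x _; rewrite lee_fin sqr_ge0.
    + by apply/measurable_EFinP; exact: measurable_funX.
    + apply: emeasurable_funD => //; apply: emeasurable_funD;
        by apply: measurable_funeM; apply/measurable_EFinP.
    + move=> x _; rewrite -!EFinM -!EFinD lee_fin /Y.
      have := sqr_ge0 (2 * w * theta * x - w * (x ^+ 2 - m2)).
      have := mulr_ge0 (sqr_ge0 w) (mulr_ge0 (sqr_ge0 x) (normal_m2_ge0 sigma)).
      by rewrite -/m2; nra.
  pose q2 (x : measurableTypeR R) := (8 * w ^+ 2 * theta ^+ 2)%:E * (x ^+ 2)%:E.
  pose q4 (x : measurableTypeR R) := (2 * w ^+ 2)%:E * (x ^+ 4)%:E.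
  have q20 x : setT x -> 0 <= q2 x.
    by move=> _; apply: mule_ge0; rewrite lee_fin; nneg.
  have q40 x : setT x -> 0 <= q4 x.
    by move=> _; apply: mule_ge0; rewrite lee_fin; nneg.
  have mq2 : measurable_fun setT q2 by apply: measurable_funeM; apply/measurable_EFinP.
  have mq4 : measurable_fun setT q4 by apply: measurable_funeM; apply/measurable_EFinP.
  rewrite (@ge0_integralD _ _ _ _ setT measurableT (q2 \+ q4)
    (fun=> (2 * w ^+ 2 * m2 ^+ 2)%:E)); last 4 first.
  + by move=> x _; rewrite adde_ge0 ?q20 ?q40.
  + exact: emeasurable_funD.
  + by move=> x _; rewrite lee_fin; nneg.
  + by [].
  rewrite integral_cst_probability ge0_integralD//.
  rewrite ge0_integralZl; last 4 first.
  + by [].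
  + exact/measurable_EFinP.
  + by move=> x _; rewrite lee_fin sqr_ge0.
  + by rewrite lee_fin; nneg.
  rewrite ge0_integralZl; last 4 first.
  + by [].
  + exact/measurable_EFinP.
  + by move=> x _; rewrite lee_fin exprn_even_ge0.
  + by rewrite lee_fin; nneg.
  apply: (@le_trans _ _ ((8 * w ^+ 2 * theta ^+ 2)%:E * (8 * sigma ^+ 2)%:E +
     (2 * w ^+ 2)%:E * (128 * sigma ^+ 4)%:E + (2 * w ^+ 2 * m2 ^+ 2)%:E)).
    apply: leeD => //; apply: leeD; apply: lee_wpmul2l.
    + by rewrite lee_fin; nneg.
    + exact: normal_sqr_le.
    + by rewrite lee_fin; nneg.
    + exact: normal_pow4_le.
  rewrite -!EFinM -!EFinD lee_fin.
  have h := normal_m2_le s0; have h0 := normal_m2_ge0 sigma.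
  have : (m2 ^+ 2 <= 64 * sigma ^+ 4)%R.
    rewrite (_ : 64 * sigma ^+ 4 = (8 * sigma ^+ 2) ^+ 2)%R; last by ring.
    by rewrite ler_pXn2r// nnegrE (le_trans h0).
  move=> /(ler_wpM2l (sqr_ge0 w)); lra.
- have i1 : (normal_prob 0 sigma).-integrable setT
      (EFin \o (fun x : measurableTypeR R => x ^+ 2)%R).
    apply/integrableP; split; first exact/measurable_EFinP.
    under eq_integral do rewrite /= ger0_norm ?sqr_ge0//.
    by rewrite normal_m2E// ltry.
  have i0 := normal_integrable_id s0.
  rewrite (eq_integral (fun x : measurableTypeR R => (2 * w * theta)%:E * x%:E +
     (w%:E * (x ^+ 2)%:E + (- (w * m2))%:E))); last first.
    by move=> x _; rewrite -!EFinM -!EFinD /Y; congr (_%:E); ring.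
  rewrite integralD//=; last 2 first.
  + exact: integrableZl.
  + apply: integrableD => //; first exact: integrableZl.
    exact: finite_measure_integrable_cst.
  rewrite integralD//=; last 2 first.
  + exact: integrableZl.
  + exact: finite_measure_integrable_cst.
  rewrite integral_cst_probability integralZl// integralZl// normal_mean//.
  by rewrite normal_m2E// mule0 add0e -EFinM -EFinD subrr.
Qed.

End quadratic.

(** * Integration against the product law, and its likelihood ratios *)

Section gaussian_integrals.
Context {R : realType}.
Local Open Scope ereal_scope.

Lemma ge0_integral_gaussianS d (theta sigma : d.+1.-tuple R)
    (h : Rvec R d.+1 -> \bar R) :
  measurable_fun setT h -> (forall x, 0 <= h x) ->
  \int[gaussian theta sigma]_x h x =
  \int[normal_prob (thead theta) (thead sigma)]_x
    \int[gaussian (behead_tuple theta) (behead_tuple sigma)]_y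
      h (cons_pair (x, y)).
Proof.
move=> mh h0.
rewrite [LHS]ge0_integral_distribution// fubini_tonelli1//; last first.
  by move=> x; exact: h0.
by apply: measurableT_comp => //; exact: measurable_cons_pair.
Qed.

Lemma tnth_cons_pair0 d (x : R) (y : Rvec R d) :
  tnth (cons_pair (x, y)) ord0 = x.
Proof. by []. Qed.

Lemma tnth_cons_pairS d (x : R) (y : Rvec R d) (j : 'I_d) :
  tnth (cons_pair (x, y)) (lift ord0 j) = tnth y j.
Proof. exact: tnthS. Qed.

Lemma measurable_tnthR d (j : 'I_d) (g : R -> R) :
  measurable_fun (setT : set (measurableTypeR R)) g ->
  measurable_fun setT (fun x : Rvec R d => g (tnth x j)).
Proof. by move=> mg; apply: (measurableT_comp mg); exact: measurable_tnth. Qed.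

(** Additivity of variances under independence, with no covariance to compute. Required for all c,
    the hypothesis says that [g j] has mean zero and second moment at most [v j]; in the induction,
    Fubini fixes the first coordinate, whose value is absorbed into c. *)
Lemma gaussian_sum_sqr d (theta sigma : d.-tuple R) (g : 'I_d -> R -> R)
    (v : 'I_d -> R) :
  (forall j, measurable_fun (setT : set (measurableTypeR R)) (g j)) ->
  (forall j c, \int[normal_prob (tnth theta j) (tnth sigma j)]_x
      ((c + g j x) ^+ 2)%:E <= (c ^+ 2 + v j)%:E) ->
  forall c, \int[gaussian theta sigma]_x ((c + \sum_j g j (tnth x j)) ^+ 2)%:E
     <= (c ^+ 2 + \sum_j v j)%:E.
Proof.
elim: d theta sigma g v => [|d IH] theta sigma g v mg gv c.
  under eq_integral do rewrite big_ord0.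
  by rewrite integral_cst_probability big_ord0 !addr0.
have mG : measurable_fun setT
    (fun x : Rvec R d.+1 => ((c + \sum_j g j (tnth x j)) ^+ 2)%:E).
  apply/measurable_EFinP; apply: measurable_funX; apply: measurable_funD => //.
  by apply: measurable_sum => j; exact: measurable_tnthR.
rewrite ge0_integral_gaussianS//; last by move=> x; rewrite lee_fin sqr_ge0.
pose V := (\sum_(j < d) v (lift ord0 j))%R.
apply: (@le_trans _ _ (\int[normal_prob (thead theta) (thead sigma)]_x
    (((c + g ord0 x) ^+ 2)%:E + V%:E))).
  apply: ge0_le_integral => //.
  - by move=> x _; apply: integral_ge0 => y _; rewrite lee_fin sqr_ge0.
  - apply: (measurable_fun_fubini_tonelli_F (fun z =>
      ((c + \sum_j g j (tnth (cons_pair z) j)) ^+ 2)%:E)).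
      by apply: (measurableT_comp mG); exact: measurable_cons_pair.
    by move=> z; rewrite lee_fin sqr_ge0.
  - apply: emeasurable_funD => //; apply/measurable_EFinP.
    by apply: measurable_funX; exact: measurable_funD.
  - move=> x _.
    rewrite (eq_integral (fun y : Rvec R d => ((c + g ord0 x +
        \sum_j g (lift ord0 j) (tnth y j)) ^+ 2)%:E)); last first.
      move=> y _; rewrite big_ord_recl tnth_cons_pair0 addrA.
      by under [in RHS]eq_bigr do rewrite -(tnth_cons_pairS x).
    rewrite -EFinD; apply: (IH _ _ (fun j => g (lift ord0 j))).
      by move=> j; exact: mg.
    by move=> j c'; rewrite !tnth_behead_lift; exact: gv.
have v0 j : (0 <= v j)%R.
  have := le_trans _ (gv j 0%R); rewrite expr0n/= add0r -lee_fin; apply.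
  by apply: integral_ge0 => x _; rewrite lee_fin sqr_ge0.
have V0 : (0 <= V)%R by apply: sumr_ge0.
rewrite ge0_integralD//; last 2 first.
- by move=> x _; rewrite lee_fin sqr_ge0.
- by apply/measurable_EFinP; apply: measurable_funX; exact: measurable_funD.
rewrite integral_cst_probability big_ord_recl addrA EFinD leeD2r//.
exact: (gv ord0).
Qed.

(** The likelihood ratio of N(theta, Sigma) against N(0, Sigma). *)
Definition gaussian_lr d (theta sigma x : d.-tuple R) : R :=
  (\prod_j tilt (tnth theta j) (tnth sigma j) (tnth x j))%R.

Lemma gaussian_lr_ge0 d (theta sigma x : d.-tuple R) :
  (0 <= gaussian_lr theta sigma x)%R.
Proof. by apply: prodr_ge0 => j _; exact: tilt_ge0. Qed.

Lemma measurable_gaussian_lr d (theta sigma : d.-tuple R) :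
  measurable_fun setT (gaussian_lr theta sigma : Rvec R d -> R).
Proof.
by apply: measurable_prod => j _; apply: measurable_tnthR; exact: measurable_tilt.
Qed.

Lemma ge0_integral_gaussian_lr d (theta sigma : d.-tuple R)
    (h : Rvec R d -> \bar R) :
  (forall j, tnth sigma j != 0%R) ->
  measurable_fun setT h -> (forall x, 0 <= h x) ->
  \int[gaussian theta sigma]_x h x =
  \int[gaussian (nseq_tuple d 0%R) sigma]_x
     (h x * (gaussian_lr theta sigma x)%:E).
Proof.
elim: d theta sigma h => [|d IH] theta sigma h s0 mh h0.
  rewrite (_ : gaussian theta sigma = gaussian (nseq_tuple 0 0%R) sigma)//.
  by apply: eq_integral => x _; rewrite /gaussian_lr big_ord0 mule1.
have mlr := measurable_gaussian_lr theta sigma.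
have mcp (f : Rvec R d.+1 -> \bar R) : measurable_fun setT f ->
    measurable_fun setT (fun z => f (cons_pair z)).
  by move=> mf; apply: (measurableT_comp mf); exact: measurable_cons_pair.
have mcp1 (f : Rvec R d.+1 -> \bar R) x : measurable_fun setT f ->
    measurable_fun setT (fun y => f (cons_pair (x, y))).
  by move=> /mcp mf; exact: (measurableT_comp mf (measurable_pair1 x)).
have mR : measurable_fun setT (fun x => h x * (gaussian_lr theta sigma x)%:E).
  by apply: emeasurable_funM => //; exact/measurable_EFinP.
have R0 x : 0 <= h x * (gaussian_lr theta sigma x)%:E.
  by rewrite mule_ge0// lee_fin gaussian_lr_ge0.
apply: (eq_trans (ge0_integral_gaussianS theta sigma mh h0)); apply: esym.
apply: (eq_trans (ge0_integral_gaussianS (nseq_tuple d.+1 0%R) sigma mR R0)).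
apply: esym.
have -> : thead (nseq_tuple d.+1 0%R) = 0%R :> R by [].
have -> : behead_tuple (nseq_tuple d.+1 0%R) = nseq_tuple d 0%R :> d.-tuple R.
  exact: val_inj.
rewrite ge0_integral_normal_tilt; last 3 first.
- exact: (s0 ord0).
- by apply: (measurable_fun_fubini_tonelli_F (fun z => h (cons_pair z))) => [|z]; [exact: mcp|exact: h0].
- by move=> x; exact: integral_ge0.
apply: eq_integral => x _.
rewrite IH//; last 2 first.
- by move=> j; rewrite tnth_behead_lift.
- exact: mcp1.
rewrite -ge0_integralZr//; first last.
- by rewrite lee_fin tilt_ge0.
- by move=> y _; rewrite mule_ge0// lee_fin gaussian_lr_ge0.
- apply: emeasurable_funM; first exact: mcp1.
  apply/measurable_EFinP; exact: measurable_gaussian_lr.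
apply: eq_integral => y _; rewrite -muleA -EFinM; congr (_ * _%:E).
rewrite /gaussian_lr big_ord_recl mulrC; congr (_ * _)%R.
by apply: eq_bigr => j _; rewrite tnth_cons_pairS !tnth_behead_lift.
Qed.

Lemma gaussian_lrM d (theta theta' sigma x : d.-tuple R) :
  (forall j, tnth sigma j != 0%R) ->
  (gaussian_lr theta sigma x * gaussian_lr theta' sigma x =
  expR (\sum_j (tnth theta j * tnth theta' j / tnth sigma j ^+ 2)) *
  gaussian_lr [tuple tnth theta j + tnth theta' j | j < d] sigma x)%R.
Proof.
move=> s0; rewrite /gaussian_lr -big_split/= expR_sum -big_split/=.
by apply: eq_bigr => j _; rewrite tiltM// tnth_mktuple.
Qed.

Lemma integral_gaussian_lr d (theta sigma : d.-tuple R) :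
  (forall j, tnth sigma j != 0%R) ->
  \int[gaussian (nseq_tuple d 0%R) sigma]_x (gaussian_lr theta sigma x)%:E = 1.
Proof.
move=> s0.
rewrite -(integral_cst_probability (gaussian theta sigma) 1%R).
rewrite [RHS]ge0_integral_gaussian_lr//.
by apply: eq_integral => x _; rewrite mul1e.
Qed.

Lemma integral_gaussian_lrM d (theta theta' sigma : d.-tuple R) :
  (forall j, tnth sigma j != 0%R) ->
  \int[gaussian (nseq_tuple d 0%R) sigma]_x
     (gaussian_lr theta sigma x * gaussian_lr theta' sigma x)%:E =
  (expR (\sum_j (tnth theta j * tnth theta' j / tnth sigma j ^+ 2)))%:E.
Proof.
move=> s0; under eq_integral do rewrite gaussian_lrM// EFinM.
rewrite ge0_integralZl//.
- by rewrite integral_gaussian_lr// mule1.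
- by apply/measurable_EFinP; exact: measurable_gaussian_lr.
- by move=> x _; rewrite lee_fin gaussian_lr_ge0.
Qed.

End gaussian_integrals.

(** * Minimax lower bounds by mixtures *)

Section mixture.
Context {R : realType} (d : nat) (sigma : d.-tuple R).
Context (Om : finType) (W : Om -> R) (th : Om -> d.-tuple R).
Context (sigma0 : forall j, tnth sigma j != 0).
Context (W0 : forall om, 0 <= W om).
Context (W1 : \sum_om W om = 1).
Local Open Scope ereal_scope.

Local Notation P0 := (gaussian (nseq_tuple d (0 : R)%R) sigma).

(** The likelihood ratio of the mixture against [P0]. *)
Let L (x : Rvec R d) : R := (\sum_om W om * gaussian_lr (th om) sigma x)%R.

Let L0 x : (0 <= L x)%R.
Proof. by apply: sumr_ge0 => om _; rewrite mulr_ge0// gaussian_lr_ge0. Qed.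

Let mlr om : measurable_fun setT
  (fun x : Rvec R d => (gaussian_lr (th om) sigma x)%:E).
Proof. by apply/measurable_EFinP; exact: measurable_gaussian_lr. Qed.

Let mL : measurable_fun setT L.
Proof.
apply: measurable_sum => om; apply: measurable_funM => //.
exact: measurable_gaussian_lr.
Qed.

Let integral_L (f : Rvec R d -> R) : measurable_fun setT f ->
  (forall x, 0 <= f x)%R ->
  \int[P0]_x (f x * L x)%:E =
  \sum_om (W om)%:E * \int[P0]_x (f x * gaussian_lr (th om) sigma x)%:E.
Proof.
move=> mf f0.
have mfl om : measurable_fun setT
    (fun x : Rvec R d => (f x * gaussian_lr (th om) sigma x)%:E).
  apply/measurable_EFinP; apply: measurable_funM => //.
  exact: measurable_gaussian_lr.
have fl0 om x : 0 <= (f x * gaussian_lr (th om) sigma x)%:E.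
  by rewrite lee_fin mulr_ge0// gaussian_lr_ge0.
under eq_integral.
  move=> x _; rewrite /L mulr_sumr -sumEFin.
  under eq_bigr do rewrite mulrCA EFinM.
  over.
rewrite ge0_integral_sum//; last 2 first.
- by move=> om; exact: measurable_funeM.
- by move=> om x _; rewrite mule_ge0// lee_fin.
apply: eq_bigr => om _; rewrite ge0_integralZl//.
by rewrite lee_fin.
Qed.

Let integral_L1 : \int[P0]_x (L x)%:E = 1.
Proof.
under eq_integral do rewrite -[L _]mul1r.
rewrite integral_L//.
under eq_bigr => om _.
  under eq_integral do rewrite mul1r.
  rewrite integral_gaussian_lr// mule1.
  over.
by rewrite sumEFin W1.
Qed.

Let integral_L2 : \int[P0]_x (L x ^+ 2)%:E =
  (\sum_om \sum_om' W om * W om' *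
    expR (\sum_j (tnth (th om) j * tnth (th om') j / tnth sigma j ^+ 2)))%:E.
Proof.
under eq_integral do rewrite expr2.
rewrite integral_L// -sumEFin; apply: eq_bigr => om _.
under eq_integral do rewrite mulrC.
rewrite integral_L//; last 2 first.
- exact: measurable_gaussian_lr.
- by move=> x; exact: gaussian_lr_ge0.
under eq_bigr do rewrite integral_gaussian_lrM// -EFinM.
rewrite sumEFin -EFinM mulr_sumr; congr EFin.
by apply: eq_bigr => om' _; rewrite mulrA.
Qed.

(** Cauchy-Schwarz for the integral of (1 - L) over A, in linearised form: a pointwise quadratic
    inequality is integrated, so that only nonnegative integrands occur. The hypothesis says that
    the chi-square distance is at most kappa^2. *)
Lemma mixture_lower_bound (kappa : R) (A : set (Rvec R d)) :
  measurable A -> (0 < kappa)%R ->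
  (\sum_om \sum_om' W om * W om' *
    expR (\sum_j (tnth (th om) j * tnth (th om') j / tnth sigma j ^+ 2))
    <= 1 + kappa ^+ 2)%R ->
  P0 A <= \sum_om (W om)%:E * gaussian (th om) sigma A + kappa%:E.
Proof.
move=> mA k0 chi2.
have QA : \int[P0]_x (\1_A x * L x)%:E =
    \sum_om (W om)%:E * gaussian (th om) sigma A.
  rewrite integral_L//; apply: eq_bigr => om _; congr (_ * _).
  rewrite -[in RHS](setIT A) -integral_indic// [RHS]ge0_integral_gaussian_lr//.
  by apply/measurable_EFinP; exact: measurable_indic.
rewrite -QA.
have fA : P0 A \is a fin_num by exact: fin_num_measure.
have fQ : \int[P0]_x (\1_A x * L x)%:E \is a fin_num.
  rewrite ge0_fin_numE; last first.
    by apply: integral_ge0 => x _; rewrite lee_fin mulr_ge0.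
  apply: (@le_lt_trans _ _ (\int[P0]_x (L x)%:E)); last by rewrite integral_L1 ltry.
  apply: ge0_le_integral => //.
  - by move=> x _; rewrite lee_fin mulr_ge0.
  - by apply/measurable_EFinP; apply: measurable_funM.
  - exact/measurable_EFinP.
  - by move=> x _; rewrite lee_fin ler_piMl// indicE; case: (_ \in _).
have mI : measurable_fun setT (fun x => (\1_A x)%:E : \bar R).
  by apply/measurable_EFinP; exact: measurable_indic.
have mIL : measurable_fun setT (fun x => (\1_A x * L x)%:E).
  by apply/measurable_EFinP; apply: measurable_funM.
have mLE : measurable_fun setT (fun x => (L x)%:E) by exact/measurable_EFinP.
have mL2 : measurable_fun setT (fun x => (L x ^+ 2)%:E).
  by apply/measurable_EFinP; exact: measurable_funX.
(* On A the difference of the integrands is (L - 1 + kappa)^2, off A it is (L - 1)^2 + kappa^2. *)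
have key : \int[P0]_x ((2 * kappa)%:E * (\1_A x)%:E + 2%:E * (L x)%:E) <=
   \int[P0]_x ((2 * kappa)%:E * (\1_A x * L x)%:E +
               ((kappa ^+ 2 + 1)%:E + (L x ^+ 2)%:E)).
  apply: ge0_le_integral => //.
  - by move=> x _; rewrite adde_ge0// -EFinM lee_fin !mulr_ge0// ltW.
  - by apply: emeasurable_funD; exact: measurable_funeM.
  - by apply: emeasurable_funD; [exact: measurable_funeM|exact: emeasurable_funD].
  - move=> x _; rewrite -!EFinM -!EFinD lee_fin indicE.
    have := sqr_ge0 (L x - 1 + kappa)%R; have := sqr_ge0 (L x - 1)%R.
    have := sqr_ge0 kappa.
    by case: (_ \in _); rewrite ?mul1r ?mulr1 ?mul0r ?mulr0; nra.
have k2 : (0 <= 2 * kappa)%R by rewrite mulr_ge0// ltW.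
have k21 : (0 <= kappa ^+ 2 + 1)%R by rewrite addr_ge0// sqr_ge0.
move: key; rewrite ge0_integralD//; first last.
- exact: measurable_funeM.
- by move=> x _; rewrite -EFinM lee_fin mulr_ge0.
- exact: measurable_funeM.
- by move=> x _; rewrite -EFinM lee_fin mulr_ge0.
rewrite [X in _ <= X]ge0_integralD//; first last.
- exact: emeasurable_funD.
- by move=> x _; rewrite -EFinD lee_fin addr_ge0// sqr_ge0.
- exact: measurable_funeM.
- by move=> x _; rewrite -EFinM lee_fin mulr_ge0// mulr_ge0.
rewrite [X in _ <= _ + X]ge0_integralD//; last by move=> x _; rewrite lee_fin sqr_ge0.
rewrite integral_cst_probability integral_L2.
rewrite ge0_integralZl//.
rewrite ge0_integralZl//; last by move=> x _; rewrite lee_fin.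
rewrite ge0_integralZl//; last by move=> x _; rewrite lee_fin mulr_ge0.
have -> : \int[P0]_x (\1_A x)%:E = (fine (P0 A))%:E.
  by rewrite integral_indic// setIT fineK.
rewrite integral_L1 -[in X in _ -> X <= _](fineK fA) -(fineK fQ).
rewrite -!EFinM -!EFinD !lee_fin mulr1.
move: (fine _) (fine _) (\sum_om _)%R chi2 => q p S chi2 h.
have : (2 * kappa * p <= 2 * kappa * (q + kappa))%R by nra.
by rewrite ler_pM2l// mulr_gt0.
Qed.

Lemma minimax_risk_gt (kappa eta eps t : R) (s : nat) : (0 <= eta)%R ->
  (0 < kappa)%R ->
  (\sum_om \sum_om' W om * W om' *
    expR (\sum_j (tnth (th om) j * tnth (th om') j / tnth sigma j ^+ 2))
    <= 1 + kappa ^+ 2)%R ->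
  (kappa + \sum_(om | ~~ `[< Theta eps s t (th om) >]) W om < 1 - eta)%R ->
  eta%:E < minimax_risk eps s t sigma.
Proof.
move=> eta0 k0 chi2; set beta := (\sum_(om | _) _)%R => kb.
pose good om := `[< Theta eps s t (th om) >].
(* A parameter in [Theta] is needed because the supremum over an empty set is -oo. If there were
   none, the bad weight would be 1, against the last hypothesis. *)
have [om0 om0P] : exists om, good om.
  apply/existsP; apply: contraT; rewrite negb_exists => /forallP nex.
  suff : beta = 1%R by move=> b1; move: kb; rewrite b1; lra.
  by rewrite /beta -W1; apply: eq_bigl => om; exact: nex.
apply: (@lt_le_trans _ _ (1 - kappa - beta)%:E); first by rewrite lte_fin; lra.
apply: le_ereal_inf_tmp => _ [psi _ <-]; rewrite /risk.
set S := ereal_sup _; pose A := psi @^-1` [set false].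
have mA : measurable A by rewrite -[A]setTI; exact: measurable_funP.
have PS om : good om -> gaussian (th om) sigma A <= S.
  by move=> /asboolP omP; apply: ereal_sup_ubound; exists (th om).
have S0 : 0 <= S by apply: le_trans (PS _ om0P).
have -> : gaussian (nseq_tuple d 0%R) sigma (psi @^-1` [set true]) = 1 - P0 A.
  rewrite -probability_setC//; congr (gaussian _ _ _).
  by apply/seteqP; split => x; rewrite /A/=; case: (psi x).
have := mixture_lower_bound mA k0 chi2.
have : \sum_om (W om)%:E * gaussian (th om) sigma A <= S + beta%:E.
  rewrite (bigID good)/=; apply: leeD.
    apply: (@le_trans _ _ (\sum_(om | good om) (W om)%:E * S)).
      by apply: lee_sum => om omP; apply: lee_wpmul2l; [rewrite lee_fin|exact: PS].
    have -> : \sum_(om | good om) (W om)%:E * S = (\sum_(om | good om) W om)%:E * S.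
      by rewrite -sumEFin ge0_sume_distrl// => om _; rewrite lee_fin.
    rewrite -[leRHS]mul1e; apply: lee_wpmul2r => //; rewrite lee_fin -W1.
    by rewrite [leRHS](bigID good)/= lerDl sumr_ge0.
  rewrite /beta -sumEFin; apply: lee_sum => om _.
  rewrite -[leRHS]mule1; apply: lee_wpmul2l; first by rewrite lee_fin.
  exact: probability_le1.
move=> h1 h2; have := le_trans h2 (leeD2r kappa%:E h1).
have fA : P0 A \is a fin_num by exact: fin_num_measure.
rewrite -(fineK fA); case: (S) S0 => [r||]//= r0; rewrite -!EFinD ?lee_fin; last first.
  by rewrite addey// => _; rewrite leey.
by lra.
Qed.

End mixture.

Section vector_norms.
Context {R : realType}.

Lemma lpnorm_powR (t : R) d (u : d.-tuple R) : t != 0 ->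
  lpnorm t u `^ t = \sum_j `|tnth u j| `^ t.
Proof.
move=> t0; rewrite /lpnorm -powRrM mulVf// powRr1; last first.
  by apply: sumr_ge0 => x _; exact: powR_ge0.
exact: big_tuple.
Qed.

Lemma le_lpnorm (t eps : R) d (u : d.-tuple R) : 0 < t -> 0 <= eps ->
  (eps <= lpnorm t u) = (eps `^ t <= \sum_j `|tnth u j| `^ t).
Proof.
move=> t0 eps0; rewrite -lpnorm_powR ?gt_eqF//.
have l0 : 0 <= lpnorm t u by exact: powR_ge0.
apply/idP/idP => h; first by apply: ge0_ler_powR; rewrite ?nnegrE// ltW.
rewrite leNgt; apply/negP => h2; move: h; rewrite leNgt => /negP; apply.
by apply: gt0_ltr_powR; rewrite ?nnegrE.
Qed.

Lemma l0normE d (u : d.-tuple R) : l0norm u = #|[pred j | tnth u j != 0]|.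
Proof.
rewrite /l0norm -sum1_count big_tuple -sum1_card.
by [].
Qed.

End vector_norms.

(** * Bounds on cosh u - 1 *)

Section coshm1.
Context {R : realType}.
Implicit Types u : R.

(** One less than the average of exp(u e e') over two independent signs e, e'; random signs cancel
    the term linear in u of the chi-square distance. *)
Definition coshm1 u : R := (expR u + expR (- u)) / 2 - 1.

(** 2 (cosh u - 1) = exp(-u) (exp u - 1)^2, and exp u - 1 <= u exp u. *)
Lemma coshm1_le_sqr u : 0 <= u -> coshm1 u <= u ^+ 2 * expR u.
Proof.
move=> u0; rewrite /coshm1.
have h1 := expR_ge1Dx u; have h2 := expR_ge1Dx (- u).
have h3 : expR u * expR (- u) = 1 by exact: expRxMexpNx_1.
have h4 := expR_gt0 u; have h5 := expR_gt0 (- u).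
have h6 : expR u - 1 <= u * expR u by nra.
have h7 : expR u + expR (- u) - 2 = expR (- u) * (expR u - 1) ^+ 2.
  have -> : expR (- u) * (expR u - 1) ^+ 2 =
    expR u * (expR u * expR (- u)) - 2 * (expR u * expR (- u)) + expR (- u) by ring.
  rewrite h3; lra.
have h8 : (expR u - 1) ^+ 2 <= (u * expR u) ^+ 2.
  by rewrite ler_pXn2r// nnegrE; [lra|rewrite mulr_ge0// ltW].
have h9 : expR (- u) * (expR u - 1) ^+ 2 <= u ^+ 2 * expR u.
  apply: le_trans (ler_wpM2l (ltW h5) h8) _.
  rewrite exprMn mulrCA; apply: ler_wpM2l; first exact: sqr_ge0.
  by rewrite expr2 mulrA [expR (- u) * _]mulrC h3 mul1r.
have := mulr_ge0 (sqr_ge0 u) (ltW h4); lra.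
Qed.

Lemma coshm1_le_exp u : 0 <= u -> coshm1 u <= expR u.
Proof.
move=> u0; rewrite /coshm1; have := expR_gt0 u.
have : expR (- u) <= 1 by rewrite expR_le1 oppr_le0.
lra.
Qed.

Lemma coshm1_ge0 u : 0 <= coshm1 u.
Proof.
rewrite /coshm1; have h1 := expR_ge1Dx u; have h2 := expR_ge1Dx (- u); lra.
Qed.

Lemma coshm1_le u v : 0 <= u -> u <= v -> coshm1 u <= coshm1 v.
Proof.
move=> u0 uv; rewrite /coshm1 lerB// ler_pM2r//.
have := expR_gt0 u; have := expR_gt0 v; have := expR_gt0 (- v); have := expR_gt0 (- u).
have : expR u * expR (- u) = 1 by exact: expRxMexpNx_1.
have : expR v * expR (- v) = 1 by exact: expRxMexpNx_1.
have : expR u <= expR v by rewrite ler_expR.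
have := expR_ge1Dx u.
move: (expR u) (expR v) (expR (- u)) (expR (- v)) => a b a' b' h1 h2 h3 h4 h5 h6 h7 h8.
have h9 : 1 <= a by lra.
have h10 : a' - b' = (b - a) * (a' * b') by nra.
have h11 : a' <= 1 by nra.
have h12 : b' <= 1 by nra.
have h13 : a' * b' <= 1 by nra.
have : (b - a) * (a' * b') <= b - a by nra.
lra.
Qed.

End coshm1.

(** * Product priors with random signs *)

Section product_prior.
Context {R : realType} (d : nat) (sigma : d.-tuple R) (q gam : 'I_d -> R).
Context (sigma0 : forall j, tnth sigma j != 0).
Context (q01 : forall j, 0 <= q j <= 1).

(* Under the product prior, theta_j equals [gam j] or [- gam j] with probability
   [q j / 2] each ([Some _]), and 0 otherwise ([None]). *)
Local Notation pattern := {ffun 'I_d -> option bool}.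

Lemma sum_option_bool (F : option bool -> R) :
  \sum_o F o = F None + F (Some true) + F (Some false).
Proof.
rewrite (bigD1 None)//= (bigD1 (Some true))//= (bigD1 (Some false))//=.
by rewrite big_pred0 ?addr0 ?addrA//; case=> [[]|].
Qed.

Definition sign_val (o : option bool) : R := oapp (fun b : bool => (-1) ^+ b) 0 o.

Definition sign_weight j (o : option bool) : R := if o then q j / 2 else 1 - q j.

Definition prior_weight (f : pattern) : R := \prod_j sign_weight j (f j).

Definition prior_mean (f : pattern) : d.-tuple R :=
  [tuple gam j * sign_val (f j) | j < d].

Definition prior_count (f : pattern) : nat := #|[pred j | f j != None]|.

Let sign_weight_ge0 j o : 0 <= sign_weight j o.
Proof. by have /andP[? ?] := q01 j; case: o => [b|]; rewrite /sign_weight/=; lra. Qed.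

Let prior_weight_ge0 f : 0 <= prior_weight f.
Proof. by apply: prodr_ge0 => j _. Qed.

Lemma sum_prior_prod (F : 'I_d -> option bool -> R) :
  \sum_(f : pattern) \prod_j F j (f j) = \prod_j \sum_o F j o.
Proof. by rewrite bigA_distr_bigA. Qed.

Let prior_weight1 : \sum_f prior_weight f = 1.
Proof.
rewrite sum_prior_prod big1// => j _; rewrite sum_option_bool /sign_weight/=.
by field.
Qed.

(** The double sum factorises over coordinates; the j-th factor is 1 + q_j^2 (cosh u_j - 1), bounded
    by an exponential. *)
Lemma prior_chi2 :
  \sum_f \sum_g prior_weight f * prior_weight g *
    expR (\sum_j (tnth (prior_mean f) j * tnth (prior_mean g) j
                  / tnth sigma j ^+ 2))
  <= expR (\sum_j q j ^+ 2 * coshm1 (gam j ^+ 2 / tnth sigma j ^+ 2)).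
Proof.
pose u j := gam j ^+ 2 / tnth sigma j ^+ 2.
pose F j a b := sign_weight j a * sign_weight j b *
  expR (u j * (sign_val a * sign_val b)).
under eq_bigr => f _.
  under eq_bigr => g _.
    rewrite expR_sum -!big_split/=.
    rewrite (eq_bigr (fun j => F j (f j) (g j))); last first.
      by move=> j _; rewrite /F !tnth_mktuple; congr (_ * expR _); rewrite /u; ring.
    over.
  rewrite (sum_prior_prod (fun j => F j (f j))).
  over.
rewrite (sum_prior_prod (fun j a => \sum_b F j a b)) expR_sum.
apply: ler_prod => j _; apply/andP; split.
  apply: sumr_ge0 => a _; apply: sumr_ge0 => b _.
  by rewrite mulr_ge0 ?expR_ge0// mulr_ge0.
apply: le_trans (expR_ge1Dx _); rewrite le_eqVlt; apply/orP; left; apply/eqP.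
rewrite !sum_option_bool /F /sign_weight /sign_val /coshm1/= -/(u j).
rewrite !(mul0r, mulr0, expr0, expr1, mul1r, mulr1, mulrN, mulNr, opprK, expR0).
by field.
Qed.

(** The count is a sum of independent Bernoulli variables. A positive rho controls too many nonzero
    entries, and rho = -1 too few. *)
Lemma prior_count_mgf (rho : R) :
  \sum_f prior_weight f * expR (rho * (prior_count f)%:R)
  <= expR ((expR rho - 1) * \sum_j q j).
Proof.
pose F j o := sign_weight j o * expR (rho * (o != None)%:R).
rewrite (eq_bigr (fun f : pattern => \prod_j F j (f j))); last first.
  move=> f _; rewrite /F big_split/= -expR_sum -mulr_sumr; congr (_ * expR (_ * _)).
  rewrite /prior_count -sum1_card natr_sum big_mkcond/=.
  by apply: eq_bigr => j _; rewrite inE; case: (_ == _).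
rewrite sum_prior_prod mulr_sumr expR_sum; apply: ler_prod => j _.
apply/andP; split; first by apply: sumr_ge0 => o _; rewrite mulr_ge0 ?expR_ge0.
apply: le_trans (expR_ge1Dx _); rewrite sum_option_bool /F /sign_weight/=.
by rewrite mulr0 mulr1 expR0; lra.
Qed.

Lemma minimax_risk_gt_product (kappa eta eps t : R) (s : nat) : 0 <= eta ->
  0 < kappa ->
  expR (\sum_j q j ^+ 2 * coshm1 (gam j ^+ 2 / tnth sigma j ^+ 2))
    <= 1 + kappa ^+ 2 ->
  kappa + \sum_(f | ~~ `[< Theta eps s t (prior_mean f) >]) prior_weight f
    < 1 - eta ->
  (eta%:E < minimax_risk eps s t sigma)%E.
Proof.
move=> eta0 k0 chi2 bad.
exact: (minimax_risk_gt sigma0 prior_weight_ge0 prior_weight1 eta0 k0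
  (le_trans prior_chi2 chi2) bad).
Qed.

Lemma l0norm_prior_mean f : (l0norm (prior_mean f) <= prior_count f)%N.
Proof.
rewrite l0normE; apply: subset_leq_card; apply/fintype.subsetP => j.
rewrite !inE tnth_mktuple; apply: contraNN => /eqP ->.
by rewrite /= mulr0.
Qed.

Lemma normr_prior_mean f j :
  `|tnth (prior_mean f) j| = if f j is Some _ then `|gam j| else 0.
Proof.
rewrite tnth_mktuple normrM; case: (f j) => [b|] /=; last by rewrite normr0 mulr0.
by rewrite normrX normrN1 expr1n mulr1.
Qed.

End product_prior.

(** * Dense, sparse and single-spike priors *)

Section lower_bounds.
Context {R : realType} (d : nat) (sigma : d.-tuple R).
Context (sigma0 : forall j, tnth sigma j != 0).
Implicit Types (eta kappa eps t : R) (s : nat).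

Lemma minimax_risk_gt_dense kappa eta eps t s (I : pred 'I_d) (gam : 'I_d -> R) :
  0 <= eta -> 0 < kappa -> kappa < 1 - eta -> 0 < t -> 0 <= eps ->
  (forall j, 0 <= gam j) ->
  (#|I| <= s)%N -> eps `^ t <= \sum_(j | I j) gam j `^ t ->
  expR (\sum_(j | I j) coshm1 (gam j ^+ 2 / tnth sigma j ^+ 2))
    <= 1 + kappa ^+ 2 ->
  (eta%:E < minimax_risk eps s t sigma)%E.
Proof.
move=> eta0 k0 keta t0 eps0 gam0 Is epsg chi2.
pose q j : R := (I j)%:R.
apply: (@minimax_risk_gt_product _ _ sigma q gam sigma0 _ kappa) => //.
- by move=> j; rewrite /q; case: (I j); rewrite !lexx ler01.
- rewrite (eq_bigr (fun j => if I j then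
      coshm1 (gam j ^+ 2 / tnth sigma j ^+ 2) else 0)) -?big_mkcond//.
  by move=> j _; rewrite /q; case: (I j); rewrite ?expr1n ?mul1r// expr0n mul0r.
(* With every [q j] equal to 0 or 1, a pattern of nonzero weight has support exactly I and so lies
   in [Theta]: only the signs are random. *)
- rewrite big1 ?addr0// => f /asboolPn fbad; apply/eqP; apply/negPn/negP => Wf.
  apply: fbad.
  have fI j : (f j != None) = I j.
    apply/idP/idP => [fj|Ij].
      apply: contraT => nI; case/negP: Wf; rewrite /prior_weight prodf_seq_eq0.
      apply/hasP; exists j; first exact: mem_index_enum.
      by rewrite /= /sign_weight /q (negbTE nI); case: (f j) fj => // b _; rewrite mul0r.
    apply: contraT => fN; case/negP: Wf; rewrite /prior_weight prodf_seq_eq0.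
    apply/hasP; exists j; first exact: mem_index_enum.
    by rewrite /= /sign_weight /q Ij; move: fN; case: (f j) => //=; rewrite subrr.
  split; last first.
    apply: leq_trans (l0norm_prior_mean _ _) _; apply: leq_trans Is.
    by apply: subset_leq_card; apply/fintype.subsetP => j; rewrite inE fI.
  rewrite le_lpnorm//; apply: le_trans epsg _; rewrite big_mkcond/=.
  apply: ler_sum => j _; rewrite normr_prior_mean -fI.
  by case: (f j) => [b|]/=; [rewrite ger0_norm|exact: powR_ge0].
Qed.

(** A pattern fails only if it has more than s or fewer than z nonzero entries. With n the sum of
    the q_j, Chernoff bounds the first event by exp((exp rho - 1) n - rho s) <= exp(1/2 - rho),
    using s >= 1, and the second by exp(- n/2 + n/4) = exp(- z). *)
Lemma minimax_risk_gt_sparse kappa eta eps t s (q : 'I_d -> R) (lam z rho : R) :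
  0 <= eta -> 0 < kappa -> 0 < t -> 0 <= eps -> 0 < lam ->
  (forall j, 0 <= q j <= 1) ->
  expR (\sum_j q j ^+ 2 * coshm1 (lam ^+ 2 / tnth sigma j ^+ 2))
    <= 1 + kappa ^+ 2 ->
  1 / 2 <= rho -> expR rho * \sum_j q j <= s%:R / 2 -> (0 < s)%N ->
  z = (\sum_j q j) / 4 -> eps `^ t <= lam `^ t * z ->
  kappa + (expR (1 / 2 - rho) + expR (- z)) < 1 - eta ->
  (eta%:E < minimax_risk eps s t sigma)%E.
Proof.
move=> eta0 k0 t0 eps0 lam0 q01 chi2 rho0 hq s0 zE epsz hk.
apply: (@minimax_risk_gt_product _ _ sigma q (fun=> lam) sigma0 q01 kappa) => //.
apply: le_lt_trans hk; rewrite lerD2l.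
set n := \sum_j q j in hq zE.
have n0 : 0 <= n by apply: sumr_ge0 => j _; case/andP: (q01 j).
have W0 f : 0 <= prior_weight q f.
  by apply: prodr_ge0 => j _; have /andP[? ?] := q01 j; case: (f j) => [b|]; rewrite /sign_weight/=; lra.
apply: (@le_trans _ _ (\sum_f (prior_weight q f * expR (rho * (prior_count f)%:R - rho * s%:R)
    + prior_weight q f * expR (- 1 * (prior_count f)%:R + z)))).
  rewrite big_mkcond/=; apply: ler_sum => f _.
  case: ifPn => [|_]; last by rewrite addr_ge0// mulr_ge0// expR_ge0.
  move=> /asboolPn bad.
  have [sN|Ns] := ltnP s (prior_count f).
    apply: (@le_trans _ _ (prior_weight q f * expR (rho * (prior_count f)%:R - rho * s%:R))).
      rewrite -[leLHS]mulr1; apply: ler_wpM2l => //.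
      rewrite -[X in X <= _]expR0 ler_expR -mulrBr; apply: mulr_ge0; first lra.
      by rewrite subr_ge0 ler_nat ltnW.
    by rewrite lerDl mulr_ge0// expR_ge0.
  have [Nz|zN] := ltP (prior_count f)%:R z.
    apply: (@le_trans _ _ (prior_weight q f * expR (- 1 * (prior_count f)%:R + z))).
      rewrite -[leLHS]mulr1; apply: ler_wpM2l => //.
      by rewrite -[X in X <= _]expR0 ler_expR; lra.
    by rewrite lerDr mulr_ge0// expR_ge0.
  exfalso; apply: bad; split; last first.
    exact: leq_trans (l0norm_prior_mean _ _) Ns.
  rewrite le_lpnorm//; apply: le_trans epsz _.
  apply: (@le_trans _ _ (lam `^ t * (prior_count f)%:R)).
    by rewrite ler_wpM2l// powR_ge0.
  rewrite /prior_count -sum1_card natr_sum mulr_sumr big_mkcond/=.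
  apply: ler_sum => j _; rewrite inE normr_prior_mean.
  case: (f j) => [b|]/=; last exact: powR_ge0.
  by rewrite mulr1 ger0_norm// ltW.
rewrite big_split/=; apply: lerD.
  under eq_bigr do rewrite expRD mulrA.
  rewrite -mulr_suml.
  apply: (@le_trans _ _ (expR ((expR rho - 1) * n) * expR (- (rho * s%:R)))).
    by rewrite ler_wpM2r ?expR_ge0//; apply: prior_count_mgf.
  rewrite -expRD ler_expR.
  have s1 : 1 <= s%:R :> R by rewrite ler1n.
  have h1 : expR rho * n <= s%:R / 2 by [].
  nra.
under eq_bigr do rewrite expRD mulrA.
rewrite -mulr_suml.
apply: (@le_trans _ _ (expR ((expR (-1) - 1) * n) * expR z)).
  by rewrite ler_wpM2r ?expR_ge0//; apply: prior_count_mgf.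
rewrite -expRD ler_expR.
have e1 : expR (-1) <= 1 / 2 :> R.
  rewrite expRN div1r lef_pV2 ?posrE ?expR_gt0//.
  by have := expR_ge1Dx (1 : R); lra.
nra.
Qed.

(** Spikes at different coordinates are orthogonal, so only equal coordinates contribute to the
    chi-square distance, which is exactly the sum in the last hypothesis. Every pattern is
    admissible. *)
Lemma minimax_risk_gt_single kappa eta eps t s (w : 'I_d -> R) (lam : R) :
  0 <= eta -> 0 < kappa -> kappa < 1 - eta -> 0 < t -> 0 <= eps -> eps <= lam ->
  (forall j, 0 <= w j) -> \sum_j w j = 1 -> (0 < s)%N ->
  \sum_j w j ^+ 2 * coshm1 (lam ^+ 2 / tnth sigma j ^+ 2) <= kappa ^+ 2 ->
  (eta%:E < minimax_risk eps s t sigma)%E.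
Proof.
move=> eta0 k0 keta t0 eps0 epslam w0 w1 s0 chi2.
pose W (jb : 'I_d * bool) := w jb.1 / 2.
pose th (jb : 'I_d * bool) : d.-tuple R :=
  [tuple if k == jb.1 then lam * (-1) ^+ jb.2 else 0 | k < d].
pose u j := lam ^+ 2 / tnth sigma j ^+ 2.
have W0 jb : 0 <= W jb by rewrite divr_ge0.
have W1 : \sum_jb W jb = 1.
  rewrite -(pair_bigA _ (fun j (b : bool) => w j / 2))/= -[RHS]w1.
  by apply: eq_bigr => j _; rewrite big_bool/= -splitr.
have ip j b j' b' : \sum_k tnth (th (j, b)) k * tnth (th (j', b')) k
      / tnth sigma k ^+ 2 =
    if j == j' then u j * ((-1) ^+ b * (-1) ^+ b') else 0.
  rewrite (bigD1 j)//= [X in _ + X]big1 ?addr0; last first.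
    by move=> k kj; rewrite !tnth_mktuple/= (negbTE kj) !mul0r.
  rewrite !tnth_mktuple/= eqxx; case: eqP => _; last by rewrite mulr0 mul0r.
  by rewrite /u; ring.
apply: (@minimax_risk_gt _ _ sigma _ W th sigma0 W0 W1 kappa) => //.
- apply: (@le_trans _ _ (1 + \sum_j w j ^+ 2 * coshm1 (u j))); last by rewrite lerD2l.
  rewrite le_eqVlt; apply/orP; left; apply/eqP.
  rewrite -(pair_bigA _ (fun j b => \sum_jb W (j, b) * W jb *
    expR (\sum_k tnth (th (j, b)) k * tnth (th jb) k / tnth sigma k ^+ 2)))/=.
  rewrite -[X in X + _]w1 -big_split/=; apply: eq_bigr => j _.
  have inner b : \sum_jb W (j, b) * W jb *
      expR (\sum_k tnth (th (j, b)) k * tnth (th jb) k / tnth sigma k ^+ 2) =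
      w j / 2 * (1 + w j * coshm1 (u j)).
    rewrite -(pair_bigA _ (fun j' b' => W (j, b) * W (j', b') *
      expR (\sum_k tnth (th (j, b)) k * tnth (th (j', b')) k / tnth sigma k ^+ 2)))/=.
    rewrite -[X in _ * (X + _)]w1 (bigD1 j)//= [in RHS](bigD1 j)//=.
    rewrite (eq_bigr (fun j' => w j / 2 * w j')); last first.
      move=> j' j'j; rewrite big_bool/= !ip eq_sym (negbTE j'j) expR0 /W/=.
      by field.
    rewrite -mulr_sumr big_bool/= !ip eqxx /W/= /coshm1.
    by case: b; rewrite !(expr0, expr1, mulr1, mul1r, mulrN1, opprK); field.
  by rewrite big_bool/= !inner; field.
- rewrite big_pred0 ?addr0// => -[j b]; apply/negbTE; rewrite negbK; apply/asboolP.
  have lam0 : 0 <= lam by exact: le_trans epslam.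
  split.
    rewrite le_lpnorm// (bigD1 j)//= tnth_mktuple/= eqxx normrM normrX normrN1.
    rewrite expr1n mulr1 ger0_norm//.
    apply: (@le_trans _ _ (lam `^ t)).
      by apply: ge0_ler_powR; rewrite ?nnegrE// ltW.
    by rewrite lerDl sumr_ge0// => k _; exact: powR_ge0.
  rewrite l0normE; apply: leq_trans s0; rewrite -(card1 j).
  apply: subset_leq_card; apply/fintype.subsetP => k; rewrite !inE tnth_mktuple/=.
  by case: (k == j) => //; rewrite eqxx.
Qed.

End lower_bounds.

(** * Minimax upper bound by a Chebyshev test *)

Section chebyshev_test.
Context {R : realType} (d : nat).
Local Open Scope ereal_scope.

Lemma gaussian_chebyshev (theta sigma : d.-tuple R) (g : 'I_d -> R -> R)
    (v : 'I_d -> R) (r : R) (A : set (Rvec R d)) : measurable A -> (0 < r)%R ->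
  (forall j, measurable_fun (setT : set (measurableTypeR R)) (g j)) ->
  (forall j c, \int[normal_prob (tnth theta j) (tnth sigma j)]_x
      ((c + g j x) ^+ 2)%:E <= (c ^+ 2 + v j)%:E) ->
  (forall x, A x -> r <= `|\sum_j g j (tnth x j)|)%R ->
  gaussian theta sigma A <= ((\sum_j v j) / r ^+ 2)%:E.
Proof.
move=> mA r0 mg gv Ar.
have := gaussian_sum_sqr mg gv 0%R.
pose S (x : Rvec R d) := (\sum_j g j (tnth x j))%R.
have mS : measurable_fun setT S.
  by apply: measurable_sum => j; exact: measurable_tnthR.
have mS2 : measurable_fun setT (fun x => ((0 + S x) ^+ 2)%:E).
  by apply/measurable_EFinP; apply: measurable_funX; exact: measurable_funD.
rewrite expr0n/= add0r => hS.
rewrite -(setIT A) -integral_indic//.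
apply: (@le_trans _ _ (\int[gaussian theta sigma]_x
    ((r ^- 2)%:E * ((0 + S x) ^+ 2)%:E))).
  apply: ge0_le_integral => //.
  - by apply/measurable_EFinP; exact: measurable_indic.
  - exact: measurable_funeM.
  - move=> x _; rewrite -EFinM lee_fin indicE add0r.
    have [|_] := boolP (x \in A); last by rewrite mulr_ge0 ?invr_ge0 ?sqr_ge0.
    rewrite inE => /Ar rS; rewrite mulrC ler_pdivlMr ?exprn_gt0// mul1r.
    by rewrite -[leRHS]real_normK ?num_real// ler_pXn2r ?nnegrE// ltW.
rewrite ge0_integralZl//; last 2 first.
- by move=> x _; rewrite lee_fin sqr_ge0.
- by rewrite lee_fin invr_ge0 sqr_ge0.
rewrite [in leRHS]mulrC EFinM; apply: lee_wpmul2l => //.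
by rewrite lee_fin invr_ge0 sqr_ge0.
Qed.

(** Each error is at most beta. The alternative may replace the statistics by minorants Y depending
    on theta: lowering the statistic can only increase the probability of acceptance. *)
Lemma minimax_risk_le_test (sigma : d.-tuple R) (eps t : R) (s : nat)
    (phi : 'I_d -> R -> R) (m0 v0 : 'I_d -> R) (tau beta : R) :
  (0 < tau)%R -> (0 <= beta)%R ->
  (forall j, measurable_fun (setT : set (measurableTypeR R)) (phi j)) ->
  (forall j c, \int[normal_prob 0 (tnth sigma j)]_x
      ((c + (phi j x - m0 j)) ^+ 2)%:E <= (c ^+ 2 + v0 j)%:E) ->
  (\sum_j v0 j <= beta * tau ^+ 2)%R ->
  (forall theta, Theta eps s t theta -> exists (Y : 'I_d -> R -> R) (m v : 'I_d -> R),
    [/\ forall j, measurable_fun (setT : set (measurableTypeR R)) (Y j),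
        forall j x, (Y j x <= phi j x)%R,
        forall j c, \int[normal_prob (tnth theta j) (tnth sigma j)]_x
          ((c + (Y j x - m j)) ^+ 2)%:E <= (c ^+ 2 + v j)%:E,
        (tau < \sum_j m j - \sum_j m0 j)%R &
        (\sum_j v j <= beta * (\sum_j m j - \sum_j m0 j - tau) ^+ 2)%R]) ->
  minimax_risk eps s t sigma <= (2 * beta)%:E.
Proof.
move=> tau0 beta0 mphi null0 nullv alt.
pose T (x : Rvec R d) := (\sum_j phi j (tnth x j))%R.
pose psi0 (x : Rvec R d) : bool := (\sum_j m0 j + tau < T x)%R.
have mT : measurable_fun setT T.
  by apply: measurable_sum => j; exact: measurable_tnthR.
have mpsi : measurable_fun setT psi0 by exact: measurable_fun_ltr.
pose psi : {mfun Rvec R d >-> bool} :=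
  HB.pack psi0 (isMeasurableFun.Build _ _ _ _ psi0 mpsi).
have mpre b : measurable (psi @^-1` [set b]).
  by rewrite -[X in measurable X]setTI; exact: measurable_funP.
apply: (@le_trans _ _ (risk psi eps s t sigma)).
  by apply: ereal_inf_lbound; exists psi.
rewrite /risk mulr2n mulrDl mul1r EFinD; apply: leeD.
  apply: (@le_trans _ _ ((\sum_j v0 j) / tau ^+ 2)%:E); last first.
    by rewrite lee_fin ler_pdivrMr// exprn_gt0.
  apply: (@gaussian_chebyshev (nseq_tuple d 0%R) sigma
    (fun j x => (phi j x - m0 j)%R) v0 tau _ (mpre true) tau0).
  - by move=> j; exact: measurable_funB.
  - by move=> j c; rewrite tnth_nseq; exact: null0.
  - move=> x; rewrite /psi/= /psi0 sumrB -/(T x) => h.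
    by apply: le_trans (ler_norm _); rewrite lerBrDl ltW.
apply: ge_ereal_sup => _ [theta Htheta <-].
have [Y [m [v [mY Yphi altv gap altV]]]] := alt theta Htheta.
set D := (_ - _)%R in gap altV.
have D0 : (0 < D - tau)%R by rewrite subr_gt0.
apply: (@le_trans _ _ ((\sum_j v j) / (D - tau) ^+ 2)%:E); last first.
  by rewrite lee_fin ler_pdivrMr// exprn_gt0.
apply: (@gaussian_chebyshev theta sigma
  (fun j x => (Y j x - m j)%R) v (D - tau) _ (mpre false) D0).
- by move=> j; exact: measurable_funB.
- exact: altv.
- move=> x; rewrite /psi/= /psi0 sumrB => /negbT; rewrite -leNgt => h.
  rewrite -normrN; apply: le_trans (ler_norm _).
  have : (\sum_j Y j (tnth x j) <= T x)%R by apply: ler_sum => j _.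
  by rewrite /D; lra.
Qed.

End chebyshev_test.

(** * Means and variances of one-coordinate statistics *)

Section one_dim_statistics.
Context {R : realType}.
Local Open Scope ereal_scope.

Lemma integral_centered_nonneg (theta sigma : R) (Y : R -> R) (v : R) :
  measurable_fun (setT : set (measurableTypeR R)) Y -> (forall x, 0 <= Y x)%R ->
  \int[normal_prob theta sigma]_x (Y x ^+ 2)%:E <= v%:E ->
  exists m : R, [/\ (0 <= m)%R,
    \int[normal_prob theta sigma]_x (Y x)%:E = m%:E &
    forall c, \int[normal_prob theta sigma]_x ((c + (Y x - m)) ^+ 2)%:E
      <= (c ^+ 2 + v)%:E].
Proof.
move=> mY Y0 Yv.
have iY : (normal_prob theta sigma).-integrable setT
    (EFin \o (Y : measurableTypeR R -> R)).
  by apply: integrable_sqr => //; exact: le_lt_trans Yv (ltry _).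
have fY : \int[normal_prob theta sigma]_x (Y x)%:E \is a fin_num.
  exact: (integrable_fin_num measurableT iY).
exists (fine (\int[normal_prob theta sigma]_x (Y x)%:E)); split.
- by apply: fine_ge0; apply: integral_ge0 => x _; rewrite lee_fin.
- by rewrite fineK.
- by move=> c; apply: integral_centered_sqr => //; rewrite fineK.
Qed.

(** Integrate Y <= Y^2 / (2 A) + A / 2; this gives 260 A + A / 2. *)
Lemma mean_le_of_sqr (theta sigma : R) (Y : R -> R) (m v A : R) :
  measurable_fun (setT : set (measurableTypeR R)) Y -> (forall x, 0 <= Y x)%R ->
  \int[normal_prob theta sigma]_x (Y x ^+ 2)%:E <= v%:E ->
  \int[normal_prob theta sigma]_x (Y x)%:E = m%:E ->
  (0 < A)%R -> (v <= 520 * A ^+ 2)%R -> (m <= 261 * A)%R.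
Proof.
move=> mY Y0 Yv Ym A0 vA; rewrite -lee_fin -Ym.
have mY2 : measurable_fun setT (fun x : measurableTypeR R => (Y x ^+ 2)%:E).
  by apply/measurable_EFinP; exact: measurable_funX.
apply: (@le_trans _ _ (\int[normal_prob theta sigma]_x
   ((2 * A)^-1%:E * (Y x ^+ 2)%:E + (A / 2)%:E))).
  apply: ge0_le_integral => //.
  - by move=> x _; rewrite lee_fin.
  - exact/measurable_EFinP.
  - by apply: emeasurable_funD => //; exact: measurable_funeM.
  - move=> x _; rewrite -EFinM -EFinD lee_fin.
    have := sqr_ge0 (Y x - A)%R; rewrite -(ler_pM2l (_ : 0 < 2 * A)%R); last first.
      by rewrite mulr_gt0.
    rewrite mulrDr mulrA mulfV ?mul1r; last by rewrite mulf_neq0// gt_eqF.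
    rewrite [X in _ -> (_ <= _ + X)%R](_ : _ = A ^+ 2)%R; last by field.
    by nra.
have iA : (0 <= (2 * A)^-1)%R by rewrite invr_ge0 mulr_ge0// ltW.
rewrite ge0_integralD//; last 3 first.
- by move=> x _; rewrite -EFinM lee_fin mulr_ge0// sqr_ge0.
- exact: measurable_funeM.
- by move=> x _; rewrite lee_fin divr_ge0// ltW.
rewrite integral_cst_probability ge0_integralZl//; last first.
  by move=> x _; rewrite lee_fin sqr_ge0.
apply: (@le_trans _ _ ((2 * A)^-1%:E * v%:E + (A / 2)%:E)).
  by apply: leeD => //; apply: lee_wpmul2l; rewrite ?lee_fin.
rewrite -EFinM -EFinD lee_fin.
have : ((2 * A)^-1 * v <= (2 * A)^-1 * (520 * A ^+ 2))%R by apply: ler_wpM2l.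
have -> : ((2 * A)^-1 * (520 * A ^+ 2) = 260 * A)%R.
  by field; rewrite gt_eqF.
by lra.
Qed.

(** Y is b minus b times the indicator of a deviation, an event of probability at most K^-2.
    Bounding the variance through that indicator gives b^2 K^-2 instead of b^2. By Chebyshev the
    probability is at most 8 sigma^2 / (|theta|/2)^2 <= 32 / (36 K^2). *)
Lemma normal_near (theta sigma : R) (b K : R) : (0 < sigma)%R -> (1 <= K)%R ->
  (6 * K * sigma <= `|theta|)%R -> (0 <= b)%R ->
  let Y x := (b * (`|x - theta| <= `|theta| / 2)%R%:R)%R in
  exists m : R, (b * (1 - K ^- 2) <= m)%R /\
   forall c, \int[normal_prob theta sigma]_x ((c + (Y x - m)) ^+ 2)%:E
      <= (c ^+ 2 + b ^+ 2 * K ^- 2)%:E.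
Proof.
move=> s0 K1 Kth b0 Y.
have sn0 : sigma != 0%R by rewrite gt_eqF.
have th0 : (0 < `|theta|)%R by apply: lt_le_trans Kth; rewrite !mulr_gt0//; lra.
pose Z (x : measurableTypeR R) : R := (- (b * (`|theta| / 2 < `|x - theta|)%R%:R))%R.
have YZ x : Y x = (b + Z x)%R.
  by rewrite /Y /Z leNgt; case: ltP => _ /=; ring.
have mB : measurable_fun setT (fun x : measurableTypeR R =>
    (`|theta| / 2 < `|x - theta|)%R).
  apply: measurable_fun_ltr => //.
  apply: (measurableT_comp (@normr_measurable _ setT)); exact: measurable_funB.
have mZ : measurable_fun setT Z.
  apply: measurableT_comp => //; apply: measurable_funM => //.
  rewrite (_ : (fun x => _) = fun x : measurableTypeR R =>
     if (`|theta| / 2 < `|x - theta|)%R then 1%R else 0%R :> R); last first.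
    by apply/funext => x; case: ifP.
  exact: measurable_fun_ifT.
have mI : measurable_fun setT (fun x : measurableTypeR R =>
    ((`|theta| / 2 < `|x - theta|)%R%:R)%:E : \bar R).
  apply/measurable_EFinP.
  rewrite (_ : (fun x => _) = fun x : measurableTypeR R =>
     if (`|theta| / 2 < `|x - theta|)%R then 1%R else 0%R :> R); last first.
    by apply/funext => x; case: ifP.
  exact: measurable_fun_ifT.
pose p : \bar R := \int[normal_prob theta sigma]_x
    ((`|theta| / 2 < `|x - theta|)%R%:R)%:E.
have pK : p <= (K ^- 2)%:E.
  rewrite /p ge0_integral_normal_shift//.
  pose B : set (measurableTypeR R) := [set x | (`|theta| / 2 <= `|x|)%R].
  have mBs : measurable B.
    rewrite (_ : B = (fun x : measurableTypeR R => `|x|%R) @^-1`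
        `[(`|theta| / 2)%R, +oo[%classic); last first.
      by apply/seteqP; split => x; rewrite /B/= in_itv/= andbT.
    rewrite -[X in measurable X]setTI; exact: normr_measurable.
  apply: (@le_trans _ _ (\int[normal_prob 0 sigma]_x (\1_B x)%:E)).
    apply: ge0_le_integral => //.
    - by apply: (measurableT_comp mI); exact: measurable_translation.
    - by apply/measurable_EFinP; exact: measurable_indic.
    - move=> x _; rewrite addrK lee_fin indicE.
      case: ltP => //= h; rewrite mem_set//; exact: ltW.
  rewrite integral_indic// setIT.
  apply: (le_trans (normal_tail sn0 (divr_gt0 th0 _))) => //.
  rewrite lee_fin ler_pdivrMr; last by rewrite exprn_gt0// divr_gt0.
  have K0 : (0 < K)%R by lra.
  have h : ((6 * sigma) ^+ 2 <= (`|theta| / K) ^+ 2)%R.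
    have : (6 * sigma <= `|theta| / K)%R by rewrite ler_pdivlMr// mulrAC.
    by move: (_ / K)%R => y hy; nra.
  have -> : (K ^- 2 * (`|theta| / 2) ^+ 2 = (`|theta| / K) ^+ 2 / 4)%R.
    by field; rewrite gt_eqF.
  by move: (sqr_ge0 sigma) h; lra.
have p0 : 0 <= p by apply: integral_ge0 => x _; rewrite lee_fin.
have fp : p \is a fin_num by rewrite ge0_fin_numE// (le_lt_trans pK) ?ltry.
have Z2 : \int[normal_prob theta sigma]_x (Z x ^+ 2)%:E <= (b ^+ 2 * K ^- 2)%:E.
  rewrite (eq_integral (fun x : measurableTypeR R => (b ^+ 2)%:E * ((`|theta| / 2 < `|x - theta|)%R%:R)%:E)).
    rewrite ge0_integralZl//; last by rewrite lee_fin sqr_ge0.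
    by rewrite [leRHS]EFinM; apply: lee_wpmul2l; rewrite ?lee_fin ?sqr_ge0.
  move=> x _; rewrite -EFinM /Z; congr (_%:E).
  by rewrite sqrrN exprMn; case: (_ < _)%R; rewrite ?expr1n ?expr0n.
have Zm : \int[normal_prob theta sigma]_x (Z x)%:E = (- (b * fine p))%:E.
  rewrite (eq_integral (fun x : measurableTypeR R => - (b%:E * ((`|theta| / 2 < `|x - theta|)%R%:R)%:E))).
    rewrite integral_ge0N//; last by move=> x _; rewrite -EFinM lee_fin mulr_ge0.
    by rewrite ge0_integralZl// EFinN EFinM fineK.
  by move=> x _; rewrite -EFinM -EFinN.
exists (b - b * fine p)%R; split.
  have : (fine p <= K ^- 2)%R by rewrite -lee_fin fineK.
  by move=> /(ler_wpM2l b0); lra.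
move=> c; have := integral_centered_sqr c mZ Z2 Zm.
rewrite (eq_integral (fun x : measurableTypeR R => ((c + (Y x - (b - b * fine p))) ^+ 2)%:E))//.
by move=> x _; rewrite YZ; congr (_%:E); ring.
Qed.

End one_dim_statistics.

(** * The risk of the test, for abstract weights w and masses m *)

Section upper_bound.
Context {R : realType} (t lam nu K : R) (d : nat) (sigma : d.-tuple R).
Context (w m : 'I_d -> R).
Local Notation sg := (tnth sigma).
Context (t12 : 1 <= t <= 2) (lam0 : 0 < lam) (nu0 : 0 < nu) (K2 : 2 <= K).
Context (sg0 : forall j, 0 < sg j).
Context (w0 : forall j, 0 <= w j).
Context (wm : forall j, lam <= sg j -> w j ^+ 2 * sg j ^+ 4 <= m j).
Context (m1 : forall j, m j <= 1) (m0 : forall j, 0 <= m j).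
Context (wpow : forall j x, lam <= sg j ->
  `|x| `^ t / nu `^ t <= w j * x ^+ 2 + m j + lam `^ t / nu `^ t * (x != 0)%:R).
Context (tailm : forall j, sg j < lam ->
  (sg j `^ t / nu `^ t) ^+ 2 * expR (- lam ^+ 2 / sg j ^+ 2) <= m j).

Local Notation A := (lam `^ t / nu `^ t).

(** The factor 3 yields the exponential of [tailm] through [normal_trunc_moment]. A mean beyond 6 K
    lam is still at least 3 K lam after being halved, which is what [alt_spec_far] needs. *)
Definition statistic (j : 'I_d) (x : R) : R :=
  if lam <= sg j then w j * x ^+ 2
  else (if 3 * (K * lam) <= `|x| then `|x| `^ t else 0) / nu `^ t.

Let t0 : 0 < t. Proof. by case/andP: t12; lra. Qed.
Let nut0 : 0 < nu `^ t. Proof. exact: powR_gt0. Qed.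
Let A0 : 0 < A. Proof. by rewrite divr_gt0// powR_gt0. Qed.
Let sgn0 j : sg j != 0. Proof. by rewrite gt_eqF. Qed.

Lemma measurable_statistic j :
  measurable_fun (setT : set (measurableTypeR R)) (statistic j).
Proof.
rewrite /statistic; have [big|/negbTE small] := boolP (lam <= sg j).
  by apply: measurable_funM => //; exact: measurable_funX.
apply: measurable_funM => //; apply: measurable_fun_ifT => //.
  by apply: measurable_fun_ler => //; exact: normr_measurable.
by apply: (measurableT_comp (@measurable_powR R t)); exact: normr_measurable.
Qed.

Lemma statistic_ge0 j x : 0 <= statistic j x.
Proof.
rewrite /statistic; case: ifP => _; first by rewrite mulr_ge0// sqr_ge0.
by rewrite divr_ge0 ?powR_ge0//; case: ifP => _ //; exact: powR_ge0.
Qed.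

(** The constant 520 of the truncated power also covers the 384 of the quadratic statistic. *)
Lemma statistic_null j : exists mu : R, [/\ 0 <= mu,
  lam <= sg j -> mu = w j * normal_m2 (sg j),
  sg j < lam -> mu <= 261 * A &
  forall c, (\int[normal_prob 0 (sg j)]_x ((c + (statistic j x - mu)) ^+ 2)%:E
    <= (c ^+ 2 + 520 * m j)%:E)%E].
Proof.
have K2' := K2; have lam0' := lam0.
have [big|small] := leP lam (sg j).
  exists (w j * normal_m2 (sg j)); split => //.
  - by rewrite mulr_ge0// normal_m2_ge0.
  - move=> c.
    rewrite (eq_integral (fun x : measurableTypeR R =>
      ((c + (w j * x ^+ 2 - w j * (0 ^+ 2 + normal_m2 (sg j)))) ^+ 2)%:E)); last first.
      by move=> x _; rewrite /statistic big expr0n/= add0r.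
    apply: le_trans (normal_quadratic_centered _ _ _ (sgn0 j)) _.
    rewrite lee_fin expr0n/= !(mulr0, mul0r, add0r) lerD2l.
    by have := wm big; have := m0 j; lra.
have v1 : (\int[normal_prob 0 (sg j)]_x (statistic j x ^+ 2)%:E <=
    (520 * ((sg j `^ t / nu `^ t) ^+ 2 * expR (- lam ^+ 2 / sg j ^+ 2)))%:E)%E.
  pose T (x : measurableTypeR R) : R :=
    if 3 * (K * lam) <= `|x| then `|x| `^ t else 0.
  have mT : measurable_fun setT (fun x => (T x ^+ 2)%:E).
    apply/measurable_EFinP; apply: measurable_funX; apply: measurable_fun_ifT => //.
      by apply: measurable_fun_ler => //; exact: normr_measurable.
    by apply: (measurableT_comp (@measurable_powR R t)); exact: normr_measurable.
  rewrite (eq_integral (fun x : measurableTypeR R =>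
      ((nu `^ t) ^- 2)%:E * (T x ^+ 2)%:E)%E); last first.
    move=> x _; rewrite /statistic leNgt small/= -EFinM; congr (_%:E).
    by rewrite -/(T x) exprMn exprVn mulrC.
  rewrite ge0_integralZl//; last 2 first.
  - by move=> x _; rewrite lee_fin sqr_ge0.
  - by rewrite lee_fin invr_ge0 sqr_ge0.
  have Kl0 : 0 <= K * lam by rewrite mulr_ge0//; lra.
  have t02 : 0 < t <= 2 by rewrite t0; case/andP: t12.
  have := normal_trunc_moment (sgn0 j) t02 Kl0.
  move=> /(@lee_wpmul2l _ ((nu `^ t) ^- 2)%:E) h.
  apply: le_trans (h _) _; first by rewrite lee_fin invr_ge0 sqr_ge0.
  rewrite -EFinM lee_fin gtr0_norm//.
  rewrite [leLHS](_ : _ = 520 * ((sg j `^ t / nu `^ t) ^+ 2 *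
    expR (- (K * lam) ^+ 2 / sg j ^+ 2))); last first.
    by rewrite expr_div_n; ring.
  apply: ler_wpM2l; first by rewrite ler0n.
  apply: ler_wpM2l; first exact: sqr_ge0.
  rewrite ler_expR ler_pM2r ?invr_gt0 ?exprn_gt0// lerN2 exprMn ler_peMl//.
    exact: sqr_ge0.
  by rewrite expr_ge1//; lra.
have v520 : (\int[normal_prob 0 (sg j)]_x (statistic j x ^+ 2)%:E <=
    (520 * m j)%:E)%E.
  apply: le_trans v1 _; rewrite lee_fin; apply: ler_wpM2l; first by rewrite ler0n.
  exact: tailm.
have [mu [mu0 muE mu_c]] := integral_centered_nonneg
  (measurable_statistic j) (statistic_ge0 j) v520.
exists mu; split => // _; apply: (mean_le_of_sqr (measurable_statistic j) (statistic_ge0 j) v1 muE A0).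
apply: ler_wpM2l; first by rewrite ler0n.
rewrite -[leRHS]mulr1; apply: ler_pM.
- exact: sqr_ge0.
- exact: expR_ge0.
- rewrite ler_pXn2r// ?nnegrE ?divr_ge0 ?powR_ge0// ler_pM2r ?invr_gt0//.
  by apply: ge0_ler_powR; rewrite ?nnegrE ?ltW// ltW.
- by rewrite expR_le1 mulNr oppr_le0 divr_ge0// sqr_ge0.
Qed.

(* A minorant [Y] of the j-th statistic whose mean [mu] and variance bound [v]
   under N(theta, sg j ^+ 2) are controlled by the signal [D] carried by this
   coordinate; [mu0] is the mean of the statistic under the null. *)
Definition alt_spec j (theta mu0 : R) (Y : R -> R) (mu v D : R) : Prop :=
  [/\ measurable_fun (setT : set (measurableTypeR R)) Y,
      forall x, Y x <= statistic j x,
      forall c, (\int[normal_prob theta (sg j)]_x ((c + (Y x - mu)) ^+ 2)%:E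
        <= (c ^+ 2 + v)%:E)%E &
     [/\ 0 <= D,
      D / 2 - (261 + 9 * K ^+ 2) * (A * (theta != 0)%:R) <= mu - mu0,
      `|theta| `^ t / nu `^ t <= 4 * (D + m j + A * (theta != 0)%:R) &
      v <= 64 * D + 520 * m j + D ^+ 2 / K ^+ 2]].

(** The signal w theta^2 is exactly the shift of the mean. The cross term of the variance is at most
    64 times the signal, since (w sigma^2)^2 <= m <= 1. *)
Lemma alt_spec_big j theta mu0 : lam <= sg j ->
  mu0 = w j * normal_m2 (sg j) ->
  exists (Y : R -> R) (mu v D : R), alt_spec j theta mu0 Y mu v D.
Proof.
move=> big muB.
have K2' := K2; have lam0' := lam0; have t12' := t12.
have K0 : 0 < K by lra.
have DK0 D : 0 <= D ^+ 2 / K ^+ 2 by rewrite divr_ge0// sqr_ge0.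
exists (statistic j), (w j * (theta ^+ 2 + normal_m2 (sg j))),
  (64 * (w j ^+ 2 * theta ^+ 2 * sg j ^+ 2) + 384 * (w j ^+ 2 * sg j ^+ 4)),
  (w j * theta ^+ 2); split.
- exact: measurable_statistic.
- by [].
- move=> c.
  rewrite (eq_integral (fun x : measurableTypeR R =>
    ((c + (w j * x ^+ 2 - w j * (theta ^+ 2 + normal_m2 (sg j)))) ^+ 2)%:E)).
    exact: normal_quadratic_centered.
  by move=> x _; rewrite /statistic big.
have D0 : 0 <= w j * theta ^+ 2 by rewrite mulr_ge0// sqr_ge0.
have wsg : w j * sg j ^+ 2 <= 1.
  have : (w j * sg j ^+ 2) ^+ 2 <= 1.
    by rewrite exprMn -exprM; apply: le_trans (m1 j); exact: wm.
  by rewrite expr_le1// mulr_ge0// sqr_ge0.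
have A10 : 0 <= A * (theta != 0)%:R by rewrite mulr_ge0// ltW.
split.
- exact: D0.
- rewrite muB.
  have : 0 <= (261 + 9 * K ^+ 2) * (A * (theta != 0)%:R).
    apply: mulr_ge0 => //; apply: addr_ge0 (mulr_ge0 (ler0n _ 9) (sqr_ge0 K)).
    exact: ler0n.
  lra.
- by have := wpow theta big; have := m0 j; lra.
- have := wm big; have := DK0 (w j * theta ^+ 2); have := m0 j.
  have : w j ^+ 2 * theta ^+ 2 * sg j ^+ 2 <= w j * theta ^+ 2.
    rewrite (_ : _ * _ = (w j * theta ^+ 2) * (w j * sg j ^+ 2)); last by ring.
    by rewrite ler_piMr.
  lra.
Qed.

Lemma alt_spec_zero j mu0 :
  (forall c, (\int[normal_prob 0 (sg j)]_x ((c + (statistic j x - mu0)) ^+ 2)%:E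
    <= (c ^+ 2 + 520 * m j)%:E)%E) ->
  exists (Y : R -> R) (mu v D : R), alt_spec j 0 mu0 Y mu v D.
Proof.
move=> null.
have K2' := K2; have t0' := t0.
exists (statistic j), mu0, (520 * m j), 0; split => //.
- exact: measurable_statistic.
- have tn0 : t != 0 by rewrite gt_eqF.
  rewrite eqxx normr0 powR0//= !mulr0 subrr; split=> //.
  + by rewrite mul0r add0r addr0 mulr_ge0 ?ler0n.
  + by rewrite expr2 !mul0r add0r addr0.
Qed.

Section small_sigma.
Context (j : 'I_d) (theta mu0 : R) (mu00 : 0 <= mu0) (small : sg j < lam).
Context (muS : mu0 <= 261 * A) (thn0 : theta != 0).

Let b := (`|theta| / 2) `^ t / nu `^ t.

Let b0 : 0 <= b.
Proof. by rewrite divr_ge0// powR_ge0. Qed.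

Let thb : `|theta| `^ t / nu `^ t <= 4 * b.
Proof.
have t0' := t0.
rewrite /b mulrA ler_pM2r ?invr_gt0//.
rewrite [X in X `^ t <= _](_ : _ = 2 * (`|theta| / 2)); last by field.
rewrite powRM ?divr_ge0//; apply: ler_wpM2r; first exact: powR_ge0.
rewrite (_ : 4 = 2 `^ 2%:R); last by rewrite powR_mulrn//; lra.
by apply: ler_powR; [lra|case/andP: t12].
Qed.

Let Ct : 0 <= 9 * K ^+ 2 * A.
Proof. by rewrite mulr_ge0 ?(ltW A0)// mulr_ge0 ?sqr_ge0 ?ler0n. Qed.

Let KK1 : K ^- 2 <= 1 / 2.
Proof.
have K2' := K2; have K0 : 0 < K by lra.
by rewrite div1r lef_pV2 ?posrE ?exprn_gt0//; nra.
Qed.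

(** When x is within |theta|/2 of theta, |x| >= |theta|/2 >= 3 K lam, so the statistic is not
    truncated and is at least b. The minorant is b times the indicator of this event; its mean is at
    least b/2 because K >= 2. *)
Lemma alt_spec_far : 6 * K * lam <= `|theta| ->
  exists (Y : R -> R) (mu v D : R), alt_spec j theta mu0 Y mu v D.
Proof.
move=> far; rewrite /alt_spec thn0 /= mulr1.
have K2' := K2; have lam0' := lam0; have t12' := t12; have muS' := muS.
have Ct' := Ct; have thb' := thb; have b0' := b0.
have K0 : 0 < K by lra.
have far' : 6 * K * sg j <= `|theta|.
  by apply: le_trans far; rewrite ler_pM2l ?(ltW small)//; lra.
have K1 : 1 <= K by lra.
have [mu [bmu muc]] := normal_near (sg0 j) K1 far' b0.
exists (fun x => b * (`|x - theta| <= `|theta| / 2)%R%:R), mu, (b ^+ 2 * K ^- 2), b.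
split.
- apply: measurable_funM => //.
  rewrite (_ : (fun x => _) = fun x : measurableTypeR R =>
     if (`|x - theta| <= `|theta| / 2)%R then 1%R else 0%R :> R); last first.
    by apply/funext => x; case: ifP.
  apply: measurable_fun_ifT => //; apply: measurable_fun_ler => //.
  by apply: (measurableT_comp (@normr_measurable _ setT)); exact: measurable_funB.
- move=> x; have [h|_] := leP `|x - theta| (`|theta| / 2); last first.
    by rewrite mulr0 statistic_ge0.
  have sm : (lam <= sg j) = false by rewrite leNgt small.
  rewrite mulr1 /statistic sm.
  have hx : `|theta| / 2 <= `|x|.
    have := ler_distD x theta 0; rewrite !subr0 distrC; lra.
  have -> : 3 * (K * lam) <= `|x| by apply: le_trans hx; lra.
  rewrite /b ler_pM2r ?invr_gt0//; apply: ge0_ler_powR; rewrite ?nnegrE ?divr_ge0//.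
  exact: ltW.
- exact: muc.
- split.
  + exact: b0.
  + have : b * K ^- 2 <= b * (1 / 2) by apply: ler_wpM2l.
    by lra.
  + by have := m0 j; have := ltW A0; lra.
  + by have := m0 j; lra.
Qed.

(** Such a coordinate need not be detected: the minorant is 0, and the signal, at most (3K)^t A <= 9
    K^2 A, is charged to the term A per nonzero coordinate, of which there are at most s. *)
Lemma alt_spec_near : `|theta| < 6 * K * lam ->
  exists (Y : R -> R) (mu v D : R), alt_spec j theta mu0 Y mu v D.
Proof.
move=> near; rewrite /alt_spec thn0 /= mulr1.
have K2' := K2; have lam0' := lam0; have t12' := t12; have muS' := muS.
have Ct' := Ct; have thb' := thb; have b0' := b0; have mu00' := mu00.
have K0 : 0 < K by lra.
exists (fun=> 0), 0, 0, b; split.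
- by [].
- exact: statistic_ge0.
- by move=> c; rewrite subrr addr0 integral_cst_probability lee_fin addr0.
have bA : b <= 9 * K ^+ 2 * A.
  rewrite /b mulrA ler_pM2r ?invr_gt0//.
  apply: (@le_trans _ _ ((3 * K * lam) `^ t)).
    apply: ge0_ler_powR; rewrite ?nnegrE ?divr_ge0//; first exact: ltW.
      by rewrite mulr_ge0 ?ltW//; lra.
    by lra.
  rewrite powRM; [|lra|exact: ltW]; apply: ler_wpM2r; first exact: powR_ge0.
  rewrite (_ : 9 * K ^+ 2 = (3 * K) `^ 2%:R); last first.
    by rewrite powR_mulrn; [ring|lra].
  by apply: ler_powR; [lra|case/andP: t12].
split.
- exact: b0.
- lra.
- by have := m0 j; have := ltW A0; lra.
- have DK0 : 0 <= b ^+ 2 / K ^+ 2 by rewrite divr_ge0// sqr_ge0.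
  by have := m0 j; lra.
Qed.

End small_sigma.

Lemma alt_spec_exists j (theta mu0 : R) : 0 <= mu0 ->
  (lam <= sg j -> mu0 = w j * normal_m2 (sg j)) ->
  (sg j < lam -> mu0 <= 261 * A) ->
  (forall c, (\int[normal_prob 0 (sg j)]_x ((c + (statistic j x - mu0)) ^+ 2)%:E
    <= (c ^+ 2 + 520 * m j)%:E)%E) ->
  exists (Y : R -> R) (mu v D : R), alt_spec j theta mu0 Y mu v D.
Proof.
move=> mu00 muB muS null.
have [big|small] := boolP (lam <= sg j); first exact: alt_spec_big (muB big).
rewrite -ltNge in small.
have [->|thn0] := eqVneq theta 0; first exact: alt_spec_zero.
have [far|near] := leP (6 * K * lam) `|theta|.
  exact: alt_spec_far small (muS small) thn0 far.
exact: alt_spec_near mu00 (muS small) thn0 near.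
Qed.

Lemma sum_sqr_le (F : 'I_d -> R) : (forall j, 0 <= F j) ->
  \sum_j F j ^+ 2 <= (\sum_j F j) ^+ 2.
Proof.
move=> F0; rewrite [leRHS]expr2 mulr_suml; apply: ler_sum => j _.
rewrite expr2; apply: ler_wpM2l => //.
by rewrite (bigD1 j)//= lerDl sumr_ge0.
Qed.

(** With DD the total signal, the rate condition forces DD >= M X. The losses proportional to A s
    together with tau then cost at most DD/4, so the gap beyond tau is at least DD/4, and the
    variance is compared with its square. *)
Lemma minimax_risk_le_rate (eps tau beta M : R) (s : nat) :
  \sum_j m j <= 1 -> 0 < tau -> 0 < eps -> 1 <= M ->
  520 <= beta * tau ^+ 2 -> 4 * (261 + 9 * K ^+ 2 + tau) <= M ->
  16 * (64 / M + 520 / M + K ^- 2) <= beta ->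
  4 * (M + 1) * (lam `^ t * s%:R + nu `^ t) <= eps `^ t ->
  (minimax_risk eps s t sigma <= (2 * beta)%:E)%E.
Proof.
move=> summ tau0 eps0 M1 betatau HM Hbeta rate.
have K2' := K2; have A0' := A0; have nut0' := nut0.
have K0 : 0 < K by lra.
have M0 : 0 < M by lra.
have beta0 : 0 <= beta.
  have hM : 0 <= M^-1 by rewrite invr_ge0 ltW.
  have hK : 0 <= K ^- 2 by rewrite invr_ge0 sqr_ge0.
  lra.
have [mu0 mu0P] := choice statistic_null.
apply: (@minimax_risk_le_test _ _ sigma eps t s statistic mu0
  (fun j => 520 * m j) tau beta tau0 beta0 measurable_statistic).
- by move=> j c; case: (mu0P j) => _ _ _; exact.
- by rewrite -mulr_sumr; lra.
move=> theta [thnorm ths].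
have /choice[q qP] : forall j, exists q : (R -> R) * R * R * R,
    alt_spec j (tnth theta j) (mu0 j) q.1.1.1 q.1.1.2 q.1.2 q.2.
  move=> j; have [h1 h2 h3 h4] := mu0P j.
  by have [Y [mu [v [D H]]]] := alt_spec_exists (tnth theta j) h1 h2 h3 h4; exists (Y, mu, v, D).
pose D j := (q j).2.
have D0 j : 0 <= D j by case: (qP j) => _ _ _ [].
have sumz : \sum_j (tnth theta j != 0)%:R <= s%:R :> R.
  rewrite -natr_sum ler_nat; apply: leq_trans ths.
  rewrite l0normE -sum1_card [X in (_ <= X)%N]big_mkcond/= leq_eqVlt; apply/orP; left; apply/eqP.
  by apply: eq_bigr => j _; rewrite inE; case: (_ == _).
have s0 : 0 <= s%:R :> R by rewrite ler0n.
(* X is the rate divided by nu^t. *)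
set X := A * s%:R + 1.
have X1 : 1 <= X by rewrite /X lerDr mulr_ge0// ltW.
have DX : M * X <= \sum_j D j.
  have h1 : eps `^ t <= \sum_j `|tnth theta j| `^ t by rewrite -le_lpnorm// ltW.
  have h2 : (\sum_j `|tnth theta j| `^ t) / nu `^ t
      <= \sum_j 4 * (D j + m j + A * (tnth theta j != 0)%:R).
    by rewrite mulr_suml; apply: ler_sum => j _; case: (qP j) => _ _ _ [].
  have h3 : 4 * (M + 1) * X <= (\sum_j `|tnth theta j| `^ t) / nu `^ t.
    rewrite ler_pdivlMr//; apply: le_trans h1; apply: le_trans rate.
    rewrite [leLHS](_ : _ = 4 * (M + 1) * (lam `^ t * s%:R + nu `^ t))//.
    by rewrite /X; field; rewrite gt_eqF.
  have := le_trans h3 h2; rewrite -mulr_sumr !big_split/= -mulr_sumr => h4.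
  have h5 : A * \sum_j (tnth theta j != 0)%:R <= A * s%:R by rewrite ler_pM2l.
  rewrite /X in h4 *; lra.
have gap : \sum_j D j / 2 - (261 + 9 * K ^+ 2) * (A * s%:R)
    <= \sum_j (q j).1.1.2 - \sum_j mu0 j.
  apply: (@le_trans _ _ (\sum_j (D j / 2 - (261 + 9 * K ^+ 2) *
     (A * (tnth theta j != 0)%:R)))).
    rewrite sumrB lerB// -mulr_sumr ler_wpM2l//.
      by rewrite addr_ge0 ?ler0n// mulr_ge0 ?sqr_ge0 ?ler0n.
    by rewrite -mulr_sumr ler_pM2l.
  by rewrite -sumrB; apply: ler_sum => j _; case: (qP j) => _ _ _ [].
have var : \sum_j (q j).1.2 <= 64 * (\sum_j D j) + 520 + (\sum_j D j) ^+ 2 / K ^+ 2.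
  apply: (@le_trans _ _ (\sum_j (64 * D j + 520 * m j + D j ^+ 2 / K ^+ 2))).
    by apply: ler_sum => j _; case: (qP j) => _ _ _ [].
  rewrite !big_split/= -!mulr_sumr -mulr_suml; apply: lerD.
    by rewrite lerD2l; lra.
  by rewrite ler_pM2r ?invr_gt0 ?exprn_gt0//; exact: sum_sqr_le.
exists (fun j => (q j).1.1.1), (fun j => (q j).1.1.2), (fun j => (q j).1.2).
rewrite -mulr_suml in gap.
move: (\sum_j D j) (\sum_j (q j).1.1.2 - \sum_j mu0 j) (\sum_j (q j).1.2)
  DX gap var => DD De V DX gap var.
have C0 : 0 <= 261 + 9 * K ^+ 2 by rewrite addr_ge0 ?ler0n// mulr_ge0 ?sqr_ge0 ?ler0n.
have hX : (261 + 9 * K ^+ 2) * (A * s%:R) + tau <= (261 + 9 * K ^+ 2 + tau) * X.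
  by rewrite /X; have : 0 <= A * s%:R by [rewrite mulr_ge0// ltW]; nra.
have hMX : (261 + 9 * K ^+ 2 + tau) * X <= M * X / 4.
  have : 4 * (261 + 9 * K ^+ 2 + tau) * X <= M * X by rewrite ler_wpM2r//; lra.
  lra.
have hD : DD / 4 <= De - tau by lra.
have DM : M <= DD by apply: le_trans DX; rewrite ler_peMr// ltW.
split.
- by move=> j; case: (qP j).
- by move=> j x; case: (qP j).
- by move=> j c; case: (qP j).
- by lra.
apply: (le_trans var); apply: (@le_trans _ _ (beta * (DD / 4) ^+ 2)); last first.
  by apply: ler_wpM2l => //; rewrite ler_pXn2r// nnegrE; lra.
apply: (@le_trans _ _ (16 * (64 / M + 520 / M + K ^- 2) * (DD / 4) ^+ 2)); last first.
  by apply: ler_wpM2r => //; exact: sqr_ge0.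
(* DD >= M >= 1 absorbs the linear and constant parts of the variance. The quadratic part has the
   same order as the square of the gap and is controlled by K alone. *)
rewrite [leRHS](_ : _ = 64 * (DD / M * DD) + 520 * (DD / M * DD) + DD ^+ 2 / K ^+ 2).
  rewrite lerD2r.
  have h1 : 1 <= DD / M by rewrite ler_pdivlMr// mul1r.
  have h2 : DD <= DD / M * DD by rewrite ler_peMl//; lra.
  lra.
by field; rewrite !gt_eqF.
Qed.

End upper_bound.

(** * The quantities lambda and nu *)

Section real_powers.
Context {R : realType}.
Implicit Types x y r a b : R.

Lemma powR_inv x r : 0 < x -> x^-1 `^ r = (x `^ r)^-1.
Proof. by move=> x0; rewrite -powR_inv1 ?ltW// -powRrM mulN1r powRN. Qed.

Lemma powR_div x y r : 0 <= x -> 0 < y -> (x / y) `^ r = x `^ r / y `^ r.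
Proof. by move=> x0 y0; rewrite powRM ?powR_inv// invr_ge0 ltW. Qed.

Lemma powRD_gt0 x a b : 0 < x -> x `^ (a + b) = x `^ a * x `^ b.
Proof. by move=> x0; rewrite powRD// (gt_eqF x0) implybT. Qed.

Lemma powRB_gt0 x a b : 0 < x -> x `^ (a - b) = x `^ a / x `^ b.
Proof. by move=> x0; rewrite powRB// (gt_eqF x0) implybT. Qed.

Lemma ler_powR2 r x y : 0 <= r -> 0 <= x -> x <= y -> x `^ r <= y `^ r.
Proof.
move=> r0 x0 xy; apply: ge0_ler_powR; rewrite ?nnegrE//.
exact: le_trans xy.
Qed.

Lemma powR_ge1 r x : 0 <= r -> 1 <= x -> 1 <= x `^ r.
Proof. by move=> r0 x1; rewrite -(powRr0 x); exact: ler_powR. Qed.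

Lemma powR_le1 r x : 0 <= r -> 0 <= x -> x <= 1 -> x `^ r <= 1.
Proof. by move=> r0 x0 x1; rewrite (le_trans (ler_powR2 r0 x0 x1))// powR1. Qed.

Lemma ltr_powR2 r x y : 0 < r -> 0 <= x -> x < y -> x `^ r < y `^ r.
Proof.
move=> r0 x0 xy; apply: gt0_ltr_powR; rewrite ?nnegrE//.
by apply: le_trans (ltW xy).
Qed.

Lemma powR_sqr x : 0 <= x -> x `^ 2 = x ^+ 2.
Proof. by move=> x0; rewrite -powR_mulrn. Qed.

Lemma powR_pow4 x : 0 <= x -> x `^ 4 = x ^+ 4.
Proof. by move=> x0; rewrite -powR_mulrn. Qed.

Lemma continuous_powR_gt0 r x : 0 < x -> {for x, continuous (fun y : R => y `^ r)}.
Proof.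
move=> x0; apply: differentiable_continuous; apply/derivable1_diffP.
by apply: derivable_powR; rewrite in_itv/= x0.
Qed.

Lemma continuous_sumr (I : Type) (r : seq I) (F : I -> R -> R) x :
  (forall i, {for x, continuous (F i)}) ->
  {for x, continuous (fun y => \sum_(i <- r) F i y)}.
Proof.
move=> Fc; elim: r => [|i r IH].
  rewrite (_ : (fun _ => _) = cst 0); first exact: cst_continuous.
  by apply/funext => y; rewrite big_nil.
rewrite (_ : (fun _ => _) = (fun y => F i y + \sum_(i <- r) F i y)).
  by apply: continuousD; [exact: Fc|exact: IH].
by apply/funext => y; rewrite big_cons.
Qed.

End real_powers.

(** * Thresholds of a nonincreasing sequence *)

Section threshold_index.
Context {R : realType} (d : nat) (sigma : d.-tuple R).
Context (mono : forall i j : 'I_d, (i <= j)%N -> tnth sigma j <= tnth sigma i).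

(** P holds on an initial segment, and the shift [k.+1] turns the maximum into its length, so the
    strict comparison decides membership; the empty maximum 0 selects no index. *)
Lemma ltn_bigmax_prefix (P : pred 'I_d) (j : 'I_d) :
  (forall i k : 'I_d, (i <= k)%N -> P k -> P i) ->
  (j < \max_(k < d | P k) k.+1)%N = P j.
Proof.
move=> Pmono; apply/idP/idP => [|Pj]; last exact: (@leq_bigmax_cond _ P (fun k : 'I_d => k.+1)).
apply: contraTT => nPj; rewrite -leqNgt; apply/bigmax_leqP => k Pk.
by rewrite ltnNge; apply: contra nPj => jk; exact: Pmono Pk.
Qed.

Lemma ltn_j_star (x : R) (j : 'I_d) : (j < j_star sigma x)%N = (x <= tnth sigma j).
Proof.
by apply: ltn_bigmax_prefix => i k ik /le_trans; apply; exact: mono.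
Qed.

Lemma j_star_leq (x : R) (j : 'I_d) : (j_star sigma x <= j)%N = ~~ (x <= tnth sigma j).
Proof. by rewrite -ltn_j_star leqNgt. Qed.

End threshold_index.

(** * Leading, intermediate and small coordinates *)

Section coordinate_classes.
Context {R : realType} (t lam v : R).
Context (t12 : 1 <= t <= 2) (lam0 : 0 < lam) (v0 : 0 < v).
Implicit Types x th : R.

Let t1 : 1 <= t. Proof. by case/andP: t12. Qed.
Let t2 : t <= 2. Proof. by case/andP: t12. Qed.
Let t0 : 0 <= t. Proof. exact: le_trans ler01 t1. Qed.
Let t4 : 0 < 4 - t. Proof. by have := t2; lra. Qed.

(* In the notation of the statement, the condition sigma_j^4 >= lambda^(4-t) nu^t
   defining i_* reads lam <= x * nratio x, for x = sigma_j, see [class_iff]. *)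
Definition nratio x : R := (x / v) `^ (t / (4 - t)).

(** On the leading class amplitude^2 / x^2 = nratio^2, and the square of this ratio is the mass:
    there the chi-square cost matches the mass up to a constant. *)
Definition amplitude x : R :=
  if (lam <= x) && (lam <= x * nratio x) then x * nratio x else lam.

(** [mass] and [freq] are the summands of the equations for nu and lambda with the minima resolved:
    comparing lam with x * nratio x decides both at once, see [mass_min] and [freq_min]. *)
Definition mass x : R :=
  if lam <= x then
    if lam <= x * nratio x then nratio x ^+ 4
    else (x * nratio x / lam) `^ (4 - 2 * t) * nratio x ^+ 4
  else (x / v) `^ (2 * t) * expR (1 - lam ^+ 2 / x ^+ 2).

Definition freq x : R :=
  if lam <= x then
    if lam <= x * nratio x then 1 else (x * nratio x / lam) `^ (4 - t)
  else (x / v) `^ t * expR (1 - lam ^+ 2 / x ^+ 2).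

Definition weight x : R := freq x * amplitude x ^+ 2 / x ^+ 4.

Lemma nratio_gt0 x : 0 < x -> 0 < nratio x.
Proof. by move=> x0; rewrite powR_gt0// divr_gt0. Qed.

Lemma nratio_powR x : (x / v) `^ t = nratio x `^ (4 - t).
Proof. by rewrite -powRrM divfK// gt_eqF. Qed.

Lemma nratio_exp_a x : (x / v) `^ exp_a t = nratio x ^+ 4.
Proof.
rewrite -powR_pow4 ?powR_ge0// -powRrM; congr (_ `^ _).
by rewrite /exp_a; field; rewrite gt_eqF.
Qed.

(** The reason for the exponent t / (4 - t): at frequency 1, mass times v^t equals amplitude^t. *)
Lemma nratio_pow4 x : 0 < x -> nratio x ^+ 4 * v `^ t = (x * nratio x) `^ t.
Proof.
move=> x0; have r0 := nratio_gt0 x0.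
rewrite -powR_pow4 ?ltW// -{1}[4](subrK t) powRD_gt0// mulrAC -nratio_powR.
by rewrite powR_div ?divfK ?ltW// ?powRM ?ltW// gt_eqF// powR_gt0.
Qed.

Lemma class_iff x : 0 < x -> (lam `^ (4 - t) * v `^ t <= x ^+ 4) = (lam <= x * nratio x).
Proof.
move=> x0; have r0 := nratio_gt0 x0.
have xr0 : 0 < x * nratio x by rewrite mulr_gt0.
have -> : x ^+ 4 = (x * nratio x) `^ (4 - t) * v `^ t.
  rewrite powRM ?ltW// -nratio_powR powR_div ?ltW// -mulrA divfK ?gt_eqF ?powR_gt0//.
  by rewrite -powRD_gt0// subrK powR_pow4// ltW.
rewrite ler_pM2r ?powR_gt0//; apply/idP/idP => h; last exact: ler_powR2 (ltW t4) (ltW lam0) h.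
by rewrite leNgt; apply: contraTN h => h; rewrite -ltNge ltr_powR2// ltW.
Qed.

Lemma freq_ge0 x : 0 <= freq x.
Proof.
rewrite /freq; case: ifP => _; last by rewrite mulr_ge0 ?powR_ge0 ?expR_ge0.
by case: ifP => _ //; exact: powR_ge0.
Qed.

Lemma mass_ge0 x : 0 <= mass x.
Proof.
rewrite /mass; case: ifP => _; last by rewrite mulr_ge0 ?powR_ge0 ?expR_ge0.
case: ifP => _; first by rewrite exprn_ge0 ?powR_ge0.
by rewrite mulr_ge0 ?powR_ge0// exprn_ge0 ?powR_ge0.
Qed.

Lemma weight_ge0 x : 0 <= weight x.
Proof.
apply: divr_ge0; last by rewrite exprn_even_ge0.
by apply: mulr_ge0; rewrite ?freq_ge0 ?sqr_ge0.
Qed.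

Lemma amplitude_ge x : lam <= amplitude x.
Proof. by rewrite /amplitude; case: ifP => // /andP[]. Qed.

Lemma amplitude_gt0 x : 0 < amplitude x.
Proof. exact: lt_le_trans (amplitude_ge x). Qed.

(* Equality unless [x < lam]. *)
Lemma mass_le_freq x : 0 < x -> mass x * v `^ t <= freq x * amplitude x `^ t.
Proof.
move=> x0; have r0 := nratio_gt0 x0.
have q0 : 0 < x * nratio x / lam by rewrite divr_gt0// mulr_gt0.
rewrite /mass /freq /amplitude; case: (leP lam x) => lx /=; last first.
  rewrite [2 * t]mulrDl mul1r powRD_gt0 ?divr_gt0//.
  rewrite -!mulrA ler_pM2l ?powR_gt0 ?divr_gt0//.
  rewrite mulrCA ler_pM2l ?expR_gt0// powR_div ?ltW// divfK ?gt_eqF ?powR_gt0//.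
  by apply: ltr_powR2 => //; [exact: lt_le_trans ltr01 t1|exact: ltW].
case: ifP => _; first by rewrite mul1r nratio_pow4.
rewrite -mulrA nratio_pow4// -{2}[x * nratio x](divfK (lt0r_neq0 lam0)).
rewrite [(_ * lam) `^ t]powRM ?(ltW q0) ?(ltW lam0)// mulrA -powRD_gt0//.
by rewrite (_ : 4 - 2 * t + t = 4 - t)//; ring.
Qed.

(** For x >= lam use cosh u - 1 <= u^2 exp u with u <= 1: on the leading class u = nratio^2, at most
    1 because the mass is; on the intermediate class u = lam^2 / x^2. For x < lam use cosh u - 1 <=
    exp u: one of the two factors exp(1 - u) of freq^2 cancels exp u and leaves exp 1. *)
Lemma sqr_freq_coshm1 x : 0 < x -> mass x <= 1 ->
  freq x ^+ 2 * coshm1 (amplitude x ^+ 2 / x ^+ 2) <= expR 1 * mass x.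
Proof.
move=> x0; have r0 := nratio_gt0 x0.
have q0 : 0 < x * nratio x / lam by rewrite divr_gt0// mulr_gt0.
have x20 : 0 < x ^+ 2 by rewrite exprn_gt0.
rewrite /mass /freq /amplitude; case: (leP lam x) => lx /=; last first.
  move=> _.
  apply: (@le_trans _ _ (((x / v) `^ t * expR (1 - lam ^+ 2 / x ^+ 2)) ^+ 2 *
     expR (lam ^+ 2 / x ^+ 2))).
    by apply: ler_wpM2l (coshm1_le_exp _); rewrite ?sqr_ge0// divr_ge0 ?sqr_ge0.
  rewrite [2 * t]mulrC powRrM powR_sqr ?powR_ge0//.
  rewrite exprMn -mulrA [expR 1 * _]mulrCA ler_pM2l ?exprn_gt0 ?powR_gt0 ?divr_gt0//.
  by rewrite -expRM_natl -!expRD ler_expR; lra.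
case: ifP => lr m1.
  rewrite expr1n mul1r exprMn mulrAC divff ?gt_eqF// mul1r.
  apply: (le_trans (coshm1_le_sqr (sqr_ge0 _))).
  rewrite -exprM mulrC ler_pM2r ?exprn_gt0// ler_expR.
  by move: m1; rewrite !expr_le1 ?(ltW r0).
set q := x * nratio x / lam in q0 *.
have lE : lam ^+ 2 / x ^+ 2 = nratio x ^+ 2 / q ^+ 2.
  by rewrite /q; field; rewrite !gt_eqF.
have l1 : lam ^+ 2 / x ^+ 2 <= 1.
  by rewrite ler_pdivrMr// mul1r ler_pXn2r ?nnegrE ?(ltW x0) ?(ltW lam0).
have l2 : 0 <= lam ^+ 2 / x ^+ 2 by rewrite divr_ge0 ?sqr_ge0.
apply: (@le_trans _ _ ((q `^ (4 - t)) ^+ 2 * ((lam ^+ 2 / x ^+ 2) ^+ 2 * expR 1))).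
  apply: ler_wpM2l; first exact: sqr_ge0.
  apply: (le_trans (coshm1_le_sqr l2)).
  by apply: ler_wpM2l; rewrite ?sqr_ge0// ler_expR.
rewrite lE -powR_sqr ?powR_ge0// -powRrM.
rewrite (_ : (4 - t) * 2 = (4 - 2 * t) + 4); last by ring.
rewrite powRD_gt0// powR_pow4 ?(ltW q0)//.
rewrite le_eqVlt; apply/orP; left; apply/eqP.
by field; rewrite gt_eqF.
Qed.

(** Both classes with x >= lam give equality. *)
Lemma sqr_weight x : 0 < x -> lam <= x -> weight x ^+ 2 * x ^+ 4 <= mass x.
Proof.
move=> x0 lx; have r0 := nratio_gt0 x0.
have q0 : 0 < x * nratio x / lam by rewrite divr_gt0// mulr_gt0.
rewrite /weight /mass /freq /amplitude lx /=; case: ifP => _.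
  rewrite le_eqVlt; apply/orP; left; apply/eqP.
  by field; rewrite gt_eqF.
set q := x * nratio x / lam in q0 *.
have xE : x = lam * q / nratio x by rewrite /q; field; rewrite !gt_eqF.
rewrite (_ : (_ / _) ^+ 2 * _ = (q `^ (4 - t)) ^+ 2 * lam ^+ 4 / x ^+ 4); last first.
  by field; rewrite gt_eqF.
rewrite -powR_sqr ?powR_ge0// -powRrM.
rewrite (_ : (4 - t) * 2 = (4 - 2 * t) + 4); last by ring.
rewrite powRD_gt0// powR_pow4 ?(ltW q0)// [x in _ / x ^+ 4]xE.
rewrite le_eqVlt; apply/orP; left; apply/eqP.
by field; rewrite !gt_eqF.
Qed.

(** Since t <= 2, a power is dominated by a quadratic at any scale g; the additive 1 covers |th| <=
    g. *)
Lemma powR_le_sqr th g : 0 < g -> `|th| `^ t <= g `^ t * (th ^+ 2 / g ^+ 2 + 1).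
Proof.
move=> g0; have [h|h] := leP `|th| g.
  apply: (@le_trans _ _ (g `^ t)).
    exact: ler_powR2.
  by rewrite ler_peMr ?powR_ge0// lerDr divr_ge0 ?sqr_ge0.
have r1 : 1 <= `|th| / g by rewrite ler_pdivlMr// mul1r ltW.
rewrite -{1}[`|th|](divfK (lt0r_neq0 g0)) powRM ?divr_ge0 ?(ltW g0)// mulrC.
rewrite ler_pM2l ?powR_gt0//; apply: (@le_trans _ _ ((`|th| / g) `^ 2)).
  by rewrite ler_powR.
by rewrite powR_sqr ?divr_ge0 ?(ltW g0)// expr_div_n real_normK ?num_real// lerDl.
Qed.

(** Values |th| <= lam are charged to the last term. Beyond lam, the leading class uses
    [powR_le_sqr] at the scale of its amplitude, whose t-th power is mass times v^t; the
    intermediate class uses (|th|/lam)^t <= (|th|/lam)^2. *)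
Lemma powR_le_weight x th : 0 < x -> lam <= x ->
  `|th| `^ t / v `^ t
    <= weight x * th ^+ 2 + mass x + lam `^ t / v `^ t * (th != 0)%:R.
Proof.
move=> x0 lx; have r0 := nratio_gt0 x0.
have q0 : 0 < x * nratio x / lam by rewrite divr_gt0// mulr_gt0.
have vt0 : 0 < v `^ t by rewrite powR_gt0.
have tn0 : t != 0 by rewrite gt_eqF// (lt_le_trans ltr01).
have nn : 0 <= weight x * th ^+ 2 + mass x.
  by rewrite addr_ge0 ?mass_ge0// mulr_ge0 ?weight_ge0 ?sqr_ge0.
have [->|th0] := eqVneq th 0.
  rewrite normr0 powR0// mul0r mulr0 addr0 expr0n/= mulr0 add0r; exact: mass_ge0.
rewrite mulr1; have [hl|hl] := leP `|th| lam.
  apply: (@le_trans _ _ (lam `^ t / v `^ t)); last by rewrite lerDr.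
  by rewrite ler_pM2r ?invr_gt0// ler_powR2.
suff : `|th| `^ t / v `^ t <= weight x * th ^+ 2 + mass x.
  by move=> /le_trans; apply; rewrite lerDl divr_ge0 ?powR_ge0.
rewrite ler_pdivrMr//.
rewrite /weight /mass /freq /amplitude lx /=; case: ifP => _.
  have xr0 : 0 < x * nratio x by rewrite mulr_gt0.
  apply: (le_trans (powR_le_sqr th xr0)); rewrite -nratio_pow4//.
  rewrite le_eqVlt; apply/orP; left; apply/eqP.
  by field; rewrite !gt_eqF.
set q := x * nratio x / lam in q0 *.
have -> : `|th| `^ t = (`|th| / lam) `^ t * lam `^ t.
  by rewrite -powRM ?divr_ge0 ?divfK ?gt_eqF// ltW.
have r1 : 1 <= `|th| / lam by rewrite ler_pdivlMr// mul1r ltW.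
have h1 : (`|th| / lam) `^ t <= th ^+ 2 / lam ^+ 2.
  rewrite -[th ^+ 2]real_normK ?num_real// -expr_div_n -powR_sqr ?ler_powR//.
  by rewrite divr_ge0// ltW.
rewrite mulrDl; apply: (@le_trans _ _ (q `^ (4 - t) * lam ^+ 2 / x ^+ 4 * th ^+ 2 * v `^ t));
  last by rewrite lerDl mulr_ge0 ?powR_ge0// mulr_ge0 ?powR_ge0// exprn_ge0// ltW.
have vE : v `^ t = (lam * q) `^ t / nratio x ^+ 4.
  have -> : lam * q = x * nratio x by rewrite /q mulrCA divff ?mulr1 ?gt_eqF.
  by rewrite -nratio_pow4// mulrAC divff ?mul1r// gt_eqF// exprn_gt0.
rewrite vE powRM ?(ltW lam0) ?(ltW q0)// powRB_gt0// powR_pow4 ?(ltW q0)//.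
apply: (le_trans (ler_wpM2r (powR_ge0 _ _) h1)).
have xE : x = lam * q / nratio x by rewrite /q; field; rewrite !gt_eqF.
rewrite [x in _ / x ^+ 4]xE.
have qt0 : 0 < q `^ t by rewrite powR_gt0.
rewrite le_eqVlt; apply/orP; left; apply/eqP.
by field; rewrite !gt_eqF.
Qed.

Lemma tail_le_mass x : 0 < x -> x < lam ->
  (x `^ t / v `^ t) ^+ 2 * expR (- lam ^+ 2 / x ^+ 2) <= mass x.
Proof.
move=> x0 xl; rewrite /mass [lam <= x]leNgt xl/= -powR_div ?(ltW x0)//.
rewrite [2 * t]mulrC powRrM powR_sqr ?powR_ge0//.
rewrite ler_pM2l ?exprn_gt0 ?powR_gt0 ?divr_gt0// ler_expR mulNr.
by rewrite lerDr.
Qed.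

(** For x < lam the exponential factor is at most 1, so freq^2 <= mass. *)
Lemma freq_le1 x : 0 < x -> mass x <= 1 -> freq x <= 1.
Proof.
move=> x0; have r0 := nratio_gt0 x0.
have q0 : 0 < x * nratio x / lam by rewrite divr_gt0// mulr_gt0.
rewrite /mass /freq; case: (leP lam x) => lx.
  case: (leP lam (x * nratio x)) => // h _.
  by apply: powR_le1 (ltW t4) (ltW q0) _; rewrite ler_pdivrMr// mul1r ltW.
rewrite [2 * t]mulrC powRrM powR_sqr ?powR_ge0//.
have E0 := expR_gt0 (1 - lam ^+ 2 / x ^+ 2).
have E1 : expR (1 - lam ^+ 2 / x ^+ 2) <= 1.
  rewrite expR_le1 subr_le0 ler_pdivlMr ?exprn_gt0// mul1r.
  by rewrite ler_pXn2r ?nnegrE ?(ltW x0) ?(ltW lam0)// ltW.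
have := powR_ge0 (x / v) t; move: (_ `^ t) (expR _) E0 E1 => u E E0 E1 u0 h.
by rewrite leNgt; apply/negP => h1; have : 1 < (u * E) ^+ 2; nra.
Qed.

(** The second argument is nratio^4 times (x * nratio x / lam)^(4 - 2t), and the base of this power
    is at least 1 exactly on the leading class. *)
Lemma mass_min x : 0 < x -> lam <= x ->
  mass x = Num.min ((x / v) `^ exp_a t) ((x / v) `^ (2 * t) * (x / lam) `^ (4 - 2 * t)).
Proof.
move=> x0 lx; have r0 := nratio_gt0 x0.
have q0 : 0 <= nratio x * (x / lam) by rewrite ltW// mulr_gt0// divr_gt0.
have e0 : 0 <= 4 - 2 * t by have := t2; lra.
have -> : (x / v) `^ (2 * t) = nratio x `^ (4 - 2 * t) * nratio x ^+ 4.
  rewrite -powR_pow4 ?(ltW r0)// -powRD_gt0// [2 * t in LHS]mulrC powRrM nratio_powR -powRrM.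
  by congr (_ `^ _); ring.
rewrite mulrAC -powRM ?(ltW r0) ?divr_ge0 ?(ltW x0) ?(ltW lam0)//.
rewrite /mass lx nratio_exp_a (_ : x * nratio x / lam = nratio x * (x / lam)); last first.
  by rewrite mulrAC mulrC.
have r40 : 0 < nratio x ^+ 4 by rewrite exprn_gt0.
case: (leP lam (x * nratio x)) => h.
  apply/esym/min_idPl; rewrite ler_peMl ?(ltW r40)//.
  by apply: powR_ge1 => //; rewrite mulrCA mulrA ler_pdivlMr// mul1r.
apply/esym/min_idPr; rewrite ler_piMl ?(ltW r40)//.
by apply: powR_le1 e0 q0 _; rewrite mulrCA mulrA ler_pdivrMr// mul1r ltW.
Qed.

Lemma freq_min x : 0 < x -> lam <= x ->
  freq x = Num.min 1 ((x / v) `^ t * (x / lam) `^ (4 - t)).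
Proof.
move=> x0 lx; have r0 := nratio_gt0 x0.
have q0 : 0 < x * nratio x / lam by rewrite divr_gt0// mulr_gt0.
rewrite /freq lx nratio_powR -powRM ?(ltW r0) ?divr_ge0 ?(ltW x0) ?(ltW lam0)//.
rewrite [nratio x * (x / lam)]mulrCA mulrA.
case: (leP lam (x * nratio x)) => h.
  apply/esym/min_idPl.
  by apply: powR_ge1 (ltW t4) _; rewrite ler_pdivlMr// mul1r.
apply/esym/min_idPr.
by apply: powR_le1 (ltW t4) (ltW q0) _; rewrite ler_pdivrMr// mul1r ltW.
Qed.

End coordinate_classes.

(** * Existence and continuity of nu and lambda *)

Section rate_parameters.
Context {R : realType} (t c : R) (d : nat) (sigma : d.+1.-tuple R).
Local Notation sg := (tnth sigma).
Context (t12 : 1 <= t <= 2) (c0 : 0 < c) (c16 : c <= 1 / 16).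
Context (sg0 : forall j, 0 < sg j).
Context (mono : forall i j : 'I_d.+1, (i <= j)%N -> sg j <= sg i).
Implicit Types x v : R.

Local Notation a := (exp_a t).

Let t1 : 1 <= t. Proof. by case/andP: t12. Qed.
Let t2 : t <= 2. Proof. by case/andP: t12. Qed.

Lemma exp_a_ge1 : 1 <= a.
Proof.
have h1 := t1; have h2 := t2.
by rewrite /exp_a ler_pdivlMr; lra.
Qed.

Lemma exp_a_le : a <= 2 * t.
Proof.
have h1 := t1; have h2 := t2.
by rewrite /exp_a ler_pdivrMr; nra.
Qed.

(* [nu_reg] and [f_reg] are continuous versions of the two sums: the formulas of
   the cases x <= sigma_j and sigma_j < x are interpolated by [profile], and the
   resulting terms truncated.  They agree with the original sums as soon as the
   nu-sum is less than 1, hence at v = nu_bar x. *)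
Definition decay j x : R := expR (1 - (Num.max x (sg j) / sg j) ^+ 2).

Definition profile (r : R) j x : R := (sg j / Num.min x (sg j)) `^ r * decay j x.

Definition nu_reg x v : R :=
  \sum_j Num.min ((sg j / v) `^ a) ((sg j / v) `^ (2 * t) * profile (4 - 2 * t) j x).

Let min_gt0 j x : 0 < x -> 0 < Num.min x (sg j).
Proof. by move=> x0; rewrite lt_min x0 sg0. Qed.

Lemma decay_gt0 j x : 0 < decay j x. Proof. exact: expR_gt0. Qed.

Lemma decay_le1 j x : decay j x <= 1.
Proof.
rewrite expR_le1 subr_le0 expr_ge1 ?divr_ge0//; last 2 first.
- by rewrite le_max (ltW (sg0 j)) orbT.
- exact: ltW.
by rewrite ler_pdivlMr// mul1r le_max lexx orbT.
Qed.

Lemma profile_gt0 r j x : 0 < x -> 0 < profile r j x.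
Proof.
by move=> x0; rewrite mulr_gt0 ?decay_gt0// powR_gt0 ?divr_gt0 ?min_gt0.
Qed.

Lemma profile_small r j x : 0 < x -> x <= sg j -> profile r j x = sg j `^ r / x `^ r.
Proof.
move=> x0 xs; rewrite /profile /decay (min_idPl xs) (max_idPr xs).
by rewrite divff ?gt_eqF// expr1n subrr expR0 mulr1 powR_div// ltW.
Qed.

Lemma profile_large r j x : sg j < x ->
  profile r j x = expR (- (x ^+ 2 / sg j ^+ 2) + 1).
Proof.
move=> /ltW sx; rewrite /profile /decay (min_idPr sx) (max_idPl sx).
by rewrite divff ?gt_eqF// powR1 mul1r expr_div_n addrC.
Qed.

Lemma continuous_profile r j x : 0 < x -> {for x, continuous (profile r j)}.
Proof.
move=> x0; apply: continuousM.
  have cmin : {for x, continuous (fun y => sg j / Num.min y (sg j))}.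
    apply: continuousM; first exact: cst_continuous.
    apply: continuousV; first by rewrite gt_eqF// min_gt0.
    by apply: continuous_min; [exact: cvg_id|exact: cst_continuous].
  apply: (@continuous_comp _ _ _ (fun y => sg j / Num.min y (sg j))
    (fun z : R => z `^ r)); first exact: cmin.
  apply: continuous_powR_gt0.
  by rewrite divr_gt0// min_gt0.
apply: (@continuous_comp _ _ _ (fun y => 1 - (Num.max y (sg j) / sg j) ^+ 2)
  (@expR R)); last exact: continuous_expR.
apply: continuousB; first exact: cst_continuous.
apply: (@continuous_comp _ _ _ (fun y => Num.max y (sg j) / sg j) (fun y => y ^+ 2)).
  apply: continuousM; last exact: cst_continuous.
  by apply: continuous_max; [exact: cvg_id|exact: cst_continuous].
exact: exprn_continuous.
Qed.

Definition nu_term j x v : R :=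
  if x <= sg j then
    min_frac (sg j `^ a / v `^ a) (sg j ^+ 4) (x `^ (4 - 2 * t) * v `^ (2 * t))
  else sg j `^ (2 * t) / v `^ (2 * t) * expR (- (x ^+ 2 / sg j ^+ 2) + 1).

Definition f_term j x v : R :=
  if x <= sg j then min_frac 1 (sg j ^+ 4) (x `^ (4 - t) * v `^ t)
  else sg j `^ t / v `^ t * expR (- (x ^+ 2 / sg j ^+ 2) + 1).

Definition nu_reg_term j x v : R :=
  Num.min ((sg j / v) `^ a) ((sg j / v) `^ (2 * t) * profile (4 - 2 * t) j x).

Lemma nu_sum_terms x v : nu_sum t sigma x v = \sum_j nu_term j x v.
Proof.
rewrite /nu_sum [RHS](bigID (fun j => x <= sg j))/=; congr (_ + _).
  apply: eq_big => [j|j]; first by rewrite (ltn_j_star mono).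
  by rewrite (ltn_j_star mono) /nu_term => ->.
apply: eq_big => [j|j]; first by rewrite (j_star_leq mono).
by rewrite (j_star_leq mono) /nu_term => /negbTE ->.
Qed.

Lemma nu_term_mass j x v : 0 < x -> 0 < v -> nu_term j x v = mass t x v (sg j).
Proof.
move=> x0 v0; rewrite /nu_term; have [xs|sx] := leP x (sg j); last first.
  by rewrite /mass [x <= sg j]leNgt sx/= powR_div ?(ltW (sg0 j))// [1 - _]addrC.
rewrite mass_min// /min_frac mulf_eq0 !gt_eqF ?powR_gt0//=.
rewrite !powR_div ?(ltW (sg0 j))//.
congr (Num.min _ _); rewrite mulf_div -powRD_gt0//.
by rewrite [2 * t + _]addrC subrK powR_pow4 ?(ltW (sg0 j))// [v `^ _ * _]mulrC.
Qed.

Lemma f_term_freq j x v : 0 < x -> 0 < v -> f_term j x v = freq t x v (sg j).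
Proof.
move=> x0 v0; rewrite /f_term; have [xs|sx] := leP x (sg j); last first.
  by rewrite /freq [x <= sg j]leNgt sx/= powR_div ?(ltW (sg0 j))// [1 - _]addrC.
rewrite freq_min// /min_frac mulf_eq0 !gt_eqF ?powR_gt0//=.
rewrite !powR_div ?(ltW (sg0 j))//.
congr (Num.min _ _); rewrite mulf_div -powRD_gt0//.
by rewrite [t + _]addrC subrK powR_pow4 ?(ltW (sg0 j))// [v `^ _ * _]mulrC.
Qed.

Lemma nu_term_small j x v : 0 < x -> 0 < v -> x <= sg j ->
  nu_term j x v = nu_reg_term j x v.
Proof.
move=> x0 v0 xs; rewrite nu_term_mass// mass_min// /nu_reg_term profile_small//.
by rewrite -(powR_div _ (ltW (sg0 j)))// [_ / v]mulrC.
Qed.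

(** Put u = sigma_j / v. If u > 1, the truncation level u^a exceeds 1 and cannot be the value of a
    term below 1. If u <= 1, the term is at most u^(2t) <= u^a because a <= 2t, so it is not
    truncated. *)
Lemma nu_term_large j x v : 0 < x -> 0 < v -> sg j < x ->
  nu_term j x v < 1 \/ nu_reg_term j x v < 1 -> nu_term j x v = nu_reg_term j x v.
Proof.
move=> x0 v0 sx; rewrite /nu_term leNgt sx/= /nu_reg_term.
rewrite -(profile_large (4 - 2 * t) sx) -powR_div ?(ltW (sg0 j))//; set u := sg j / v.
have u0 : 0 < u by rewrite divr_gt0.
have [u1|u1] := ltP 1 u.
  have ua : 1 < u `^ a.
    by apply: (lt_le_trans u1); apply: le1r_powR exp_a_ge1; exact: ltW.
  move=> h; rewrite (_ : Num.min _ _ = u `^ (2 * t) * profile (4 - 2 * t) j x)//.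
  apply/min_idPr; case: h => [h|]; first exact: ltW (lt_trans h ua).
  rewrite gt_min => /orP[|h]; last exact: ltW (lt_trans h ua).
  by move=> /(lt_trans ua); rewrite ltxx.
move=> _; apply/esym/min_idPr.
apply: (@le_trans _ _ (u `^ (2 * t))).
  rewrite ler_piMr ?powR_ge0// profile_large// -(profile_large 0 sx).
  by rewrite /profile powRr0 mul1r decay_le1.
by apply: ger_powR exp_a_le; rewrite u0 u1.
Qed.

Lemma nu_term_ge0 j x v : 0 <= nu_term j x v.
Proof.
rewrite /nu_term; case: ifP => _; last first.
  by rewrite mulr_ge0 ?expR_ge0// divr_ge0 ?powR_ge0.
rewrite /min_frac; case: ifP => _; first by rewrite divr_ge0 ?powR_ge0.
by rewrite le_min !divr_ge0 ?powR_ge0 ?exprn_even_ge0// mulr_ge0 ?powR_ge0.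
Qed.

Lemma nu_reg_term_ge0 j x v : 0 < x -> 0 <= nu_reg_term j x v.
Proof.
move=> x0; rewrite le_min powR_ge0/= mulr_ge0 ?powR_ge0//.
exact/ltW/profile_gt0.
Qed.

Let c1 : c < 1. Proof. have := c16; lra. Qed.

Let sum_term_lt1 (F : 'I_d.+1 -> R) j : (forall i, 0 <= F i) ->
  \sum_i F i = c -> F j < 1.
Proof.
move=> F0 Fc; apply: le_lt_trans c1; rewrite -Fc (bigD1 j)//= lerDl.
exact: sumr_ge0.
Qed.

(** In either equation the summands are nonnegative with sum c < 1, so each is below 1. *)
Lemma nu_sum_reg x v : 0 < x -> 0 < v ->
  (nu_sum t sigma x v = c) <-> (nu_reg x v = c).
Proof.
move=> x0 v0; rewrite nu_sum_terms /nu_reg.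
have eqt j : nu_term j x v < 1 \/ nu_reg_term j x v < 1 ->
    nu_term j x v = nu_reg_term j x v.
  by have [xs _|sx] := leP x (sg j); [exact: nu_term_small|exact: nu_term_large].
split=> h; rewrite -[RHS]h; apply: eq_bigr => j _.
  apply/esym/eqt; left; apply: sum_term_lt1 h => i; exact: nu_term_ge0.
by apply: eqt; right; apply: sum_term_lt1 h => i; exact: nu_reg_term_ge0.
Qed.

Lemma nu_reg_decr x v v' : 0 < x -> 0 < v -> v < v' -> nu_reg x v' < nu_reg x v.
Proof.
move=> x0 v0 vv'; apply: ltr_sum; first by apply/hasP; exists ord0; rewrite ?mem_index_enum.
move=> j _; have v'0 := lt_trans v0 vv'.
have h : sg j / v' < sg j / v by rewrite ltr_pM2l// ltf_pV2 ?posrE.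
have h0 : 0 <= sg j / v' by rewrite divr_ge0// ltW.
have a0 : 0 < a by apply: lt_le_trans exp_a_ge1.
have t20 : 0 < 2 * t by rewrite mulr_gt0// (lt_le_trans _ t1).
rewrite lt_min !gt_min ltr_powR2//=; apply/orP; right.
by rewrite ltr_pM2r ?profile_gt0// ltr_powR2.
Qed.

Lemma continuous_nu_reg_x x v : 0 < x -> {for x, continuous (nu_reg ^~ v)}.
Proof.
move=> x0; apply: continuous_sumr => j.
apply: continuous_min; first exact: cst_continuous.
apply: continuousM; first exact: cst_continuous.
exact: continuous_profile.
Qed.

Lemma continuous_nu_reg_v x v : 0 < v -> {for v, continuous (nu_reg x)}.
Proof.
move=> v0; apply: continuous_sumr => j.
have cdiv : {for v, continuous (fun w : R => sg j / w)}.
  apply: continuousM; first exact: cst_continuous.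
  by apply: continuousV; [rewrite gt_eqF|exact: cvg_id].
have cpow r : {for v, continuous (fun w : R => (sg j / w) `^ r)}.
  apply: (@continuous_comp R R R (fun w : R => sg j / w) (fun z : R => z `^ r)); first exact: cdiv.
  by apply: continuous_powR_gt0; rewrite divr_gt0.
apply: continuous_min; first exact: cpow.
by apply: continuousM; [exact: cpow|exact: cst_continuous].
Qed.

(** At this v every ratio sigma_j / v is at most c / (d+1) <= 1, and a >= 1, so the d+1 terms sum to
    at most c, whatever x is. *)
Definition nu_ub : R := sg ord0 * (d.+1%:R / c).

Let nu_ub0 : 0 < nu_ub. Proof. by rewrite mulr_gt0// divr_gt0. Qed.

Lemma nu_reg_ub x : nu_reg x nu_ub <= c.
Proof.
apply: (@le_trans _ _ (\sum_(j < d.+1) (c / d.+1%:R))); last first.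
  by rewrite sumr_const card_ord -[_ / _ *+ _]mulr_natr divfK ?pnatr_eq0.
apply: ler_sum => j _; rewrite ge_min; apply/orP; left.
have h : sg j / nu_ub <= c / d.+1%:R.
  rewrite /nu_ub invfM mulrA invf_div ler_piMl//.
    exact/ltW/divr_gt0.
  by rewrite ler_pdivrMr// mul1r; exact: mono.
apply: le_trans (ler_powR2 _ _ h) _.
- exact: le_trans exp_a_ge1.
- by rewrite divr_ge0 ?ltW.
- apply: ge1r_powR exp_a_ge1; rewrite divr_gt0//= ler_pdivrMr// mul1r.
  by apply: le_trans (ltW c1) _; rewrite ler1n.
Qed.

Lemma nu_reg_solution x : 0 < x -> exists2 v, 0 < v & nu_reg x v = c.
Proof.
move=> x0; pose h := profile (4 - 2 * t) ord0 x.
have h0 : 0 < h by exact: profile_gt0.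
(* At v1 the first term alone is at least 1 > c: its ratio u = 1 / min(1, h) satisfies u >= 1 and u
   * h >= 1. *)
pose v1 := sg ord0 * Num.min 1 h.
have m0 : 0 < Num.min 1 h by rewrite lt_min ltr01 h0.
have v10 : 0 < v1 by rewrite mulr_gt0.
have N1 : c <= nu_reg x v1.
  apply: (le_trans (ltW c1)); rewrite /nu_reg (bigD1 ord0)//=.
  apply: (@le_trans _ _ (nu_reg_term ord0 x v1)); last first.
    by rewrite lerDl sumr_ge0// => j _; exact: nu_reg_term_ge0.
  have -> : nu_reg_term ord0 x v1 = Num.min ((Num.min 1 h)^-1 `^ a)
      ((Num.min 1 h)^-1 `^ (2 * t) * h).
    by rewrite /nu_reg_term /v1 invfM mulrA divff ?mul1r// gt_eqF.
  have u1 : 1 <= (Num.min 1 h)^-1 by rewrite invf_ge1// ge_min lexx.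
  have t21 : 1 <= 2 * t by have := t1; lra.
  rewrite le_min; apply/andP; split.
    exact: le_trans u1 (le1r_powR u1 exp_a_ge1).
  have [h1|h1] := leP 1 h.
    by rewrite invr1 powR1 mul1r.
  rewrite (min_idPr (ltW h1)) in u1.
  apply: (@le_trans _ _ (h^-1 * h)); first by rewrite mulVf// gt_eqF.
  by rewrite ler_pM2r//; exact: le1r_powR u1 t21.
have v12 : v1 <= nu_ub.
  rewrite leNgt; apply/negP => lt21.
  have := nu_reg_decr x0 nu_ub0 lt21; rewrite ltNge => /negP; apply.
  exact: le_trans (nu_reg_ub x) N1.
have cont : {within `[v1, nu_ub], continuous (nu_reg x)}.
  apply: continuous_in_subspaceT => v /set_mem /=; rewrite in_itv/= => /andP[hv _].
  by apply: continuous_nu_reg_v; exact: lt_le_trans hv.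
have [|v] := @IVT R (nu_reg x) v1 nu_ub c v12 cont.
  by rewrite ge_min nu_reg_ub orbT/= le_max N1.
rewrite in_itv/= => /andP[hv _] vc; exists v => //; exact: lt_le_trans hv.
Qed.

Lemma nu_barP x : 0 < x ->
  0 < nu_bar t c sigma x /\ nu_reg x (nu_bar t c sigma x) = c.
Proof.
move=> x0; have [v v0 vc] := nu_reg_solution x0.
have [h1 h2] : 0 < nu_bar t c sigma x /\ nu_sum t sigma x (nu_bar t c sigma x) = c.
  apply: (@xgetPex _ 0 [set v | 0 < v /\ nu_sum t sigma x v = c]).
  by exists v; split=> //; apply/(nu_sum_reg x0 v0).
by split=> //; apply/(nu_sum_reg x0 h1).
Qed.

Lemma nu_bar_le_ub x : 0 < x -> nu_bar t c sigma x <= nu_ub.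
Proof.
move=> /[dup] x0 /nu_barP[v0 vc]; rewrite leNgt; apply/negP => h.
have := nu_reg_decr x0 nu_ub0 h; rewrite vc ltNge => /negP; apply.
exact: nu_reg_ub.
Qed.

(** An implicit function argument by monotonicity: the strict inequalities at v - e' and v + e'
    persist for y near x, and strict decrease in v traps the solution between them. The bound e' <=
    v/2 keeps v - e' positive. *)
Lemma continuous_nu_bar x : 0 < x -> {for x, continuous (nu_bar t c sigma)}.
Proof.
move=> x0; have [v0 vc] := nu_barP x0; set v := nu_bar t c sigma x in v0 vc.
apply/cvgrPdist_lt => /= e e0.
pose e' := Num.min e (v / 2).
have e'0 : 0 < e' by rewrite lt_min e0 divr_gt0.
have e'e : e' <= e by rewrite ge_min lexx.
have e'v : e' <= v / 2 by rewrite ge_min lexx orbT.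
have ve0 : 0 < v - e' by lra.
have lo : c < nu_reg x (v - e') by rewrite -vc; apply: nu_reg_decr => //; lra.
have hi : nu_reg x (v + e') < c by rewrite -vc; apply: nu_reg_decr => //; lra.
have near1 : \forall y \near x, c < nu_reg y (v - e').
  exact: (@continuous_nu_reg_x x (v - e') x0 _ (lt_nbhsr lo)).
have near2 : \forall y \near x, nu_reg y (v + e') < c.
  exact: (@continuous_nu_reg_x x (v + e') x0 _ (lt_nbhsl hi)).
near=> y.
have y0 : 0 < y by near: y; exact: lt_nbhsr.
have ylo : c < nu_reg y (v - e') by near: y.
have yhi : nu_reg y (v + e') < c by near: y.
have [w0 wc] := nu_barP y0; set w := nu_bar t c sigma y in w0 wc *.
have w1 : v - e' < w.
  rewrite ltNge; apply/negP; rewrite le_eqVlt => /orP[/eqP wE|wl].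
    by move: ylo; rewrite -wE wc ltxx.
  by have := lt_trans ylo (nu_reg_decr y0 w0 wl); rewrite wc ltxx.
have w2 : w < v + e'.
  rewrite ltNge; apply/negP; rewrite le_eqVlt => /orP[/eqP wE|wl].
    by move: yhi; rewrite wE wc ltxx.
  have vp : 0 < v + e' by lra.
  by have := lt_trans (nu_reg_decr y0 vp wl) yhi; rewrite wc ltxx.
by rewrite -/v ltr_norml; apply/andP; split; lra.
Unshelve. all: by end_near. Qed.

Definition f_reg x : R :=
  \sum_j Num.min 1 ((sg j / nu_bar t c sigma x) `^ t * profile (4 - t) j x).

Lemma f_sum_terms x : f_sum t c sigma x = \sum_j f_term j x (nu_bar t c sigma x).
Proof.
rewrite /f_sum [RHS](bigID (fun j => x <= sg j))/=; congr (_ + _).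
  apply: eq_big => [j|j]; first by rewrite (ltn_j_star mono).
  by rewrite (ltn_j_star mono) /f_term => ->.
apply: eq_big => [j|j]; first by rewrite (j_star_leq mono).
by rewrite (j_star_leq mono) /f_term => /negbTE ->.
Qed.

Lemma nu_bar_terms x : 0 < x -> \sum_j nu_term j x (nu_bar t c sigma x) = c.
Proof.
by move=> x0; have [v0 vc] := nu_barP x0; rewrite -nu_sum_terms; apply/nu_sum_reg.
Qed.

(** The truncation at 1 added for x < lam is harmless by [freq_le1], since the masses at nu_bar x
    are below 1. *)
Lemma f_sum_reg x : 0 < x -> f_sum t c sigma x = f_reg x.
Proof.
move=> x0; have [v0 _] := nu_barP x0; rewrite f_sum_terms.
apply: eq_bigr => j _; rewrite f_term_freq//; have [xs|sx] := leP x (sg j).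
  by rewrite freq_min// profile_small// !powR_div ?(ltW (sg0 j)).
have m1 : mass t x (nu_bar t c sigma x) (sg j) <= 1.
  rewrite -nu_term_mass//; apply: ltW; apply: sum_term_lt1 (nu_bar_terms x0) => i.
  exact: nu_term_ge0.
have := freq_le1 t12 x0 v0 (sg0 j) m1.
rewrite /freq [x <= sg j]leNgt sx/= (profile_large _ sx) [1 - _]addrC => h.
exact/esym/min_idPr.
Qed.

(** The point x = 0 escapes [nu_barP], but there the denominator is 0 and the convention 1/0 = +oo
    makes every term equal to 1, whatever [nu_bar] returns. *)
Lemma f_sum0 : f_sum t c sigma 0 = d.+1%:R.
Proof.
rewrite f_sum_terms -[RHS]mulr1 -[d.+1 in RHS]card_ord -sum1_card natr_sum mulr_suml.
apply: eq_bigr => j _; rewrite /f_term (ltW (sg0 j)) /min_frac.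
have h : 4 - t != 0 by have := t2; move=> ?; apply/eqP; lra.
by rewrite powR0// mul0r eqxx mulr1.
Qed.

Lemma continuous_f_reg x : 0 < x -> {for x, continuous f_reg}.
Proof.
move=> x0; have [v0 _] := nu_barP x0; apply: continuous_sumr => j.
apply: continuous_min; first exact: cst_continuous.
apply: continuousM; last exact: continuous_profile.
have cdiv : {for x, continuous (fun y : R => sg j / nu_bar t c sigma y)}.
  apply: continuousM; first exact: cst_continuous.
  by apply: continuousV; [rewrite gt_eqF|exact: continuous_nu_bar].
apply: (@continuous_comp R R R (fun y : R => sg j / nu_bar t c sigma y)
  (fun z : R => z `^ t)); first exact: cdiv.
by apply: continuous_powR_gt0; rewrite divr_gt0.
Qed.

Lemma sg_max_le j : sg ord_max <= sg j.
Proof. by apply: mono; rewrite -ltnS ltn_ord. Qed.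

(** With r = nu_ub / sigma_min >= 1 and x at most this value, sigma_j / nu_bar x >= 1/r and sigma_j
    / x >= r, so each untruncated term of [f_reg] is at least r^(4 - 2t) >= 1. *)
Definition lambda_lb : R := sg ord_max * (sg ord_max / nu_ub).

Let lambda_lb0 : 0 < lambda_lb. Proof. by rewrite mulr_gt0// divr_gt0. Qed.

Lemma sg_max_le_nu_ub : sg ord_max <= nu_ub.
Proof.
apply: (le_trans (sg_max_le ord0)); rewrite /nu_ub ler_peMr ?(ltW (sg0 _))//.
by rewrite ler_pdivlMr// mul1r (le_trans (ltW c1))// ler1n.
Qed.

Lemma lambda_lb_le : lambda_lb <= sg ord_max.
Proof. by rewrite /lambda_lb ler_piMr ?(ltW (sg0 _))// ler_pdivrMr// mul1r sg_max_le_nu_ub. Qed.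

Lemma f_reg_small x : 0 < x -> x <= lambda_lb -> f_reg x = d.+1%:R.
Proof.
move=> x0 xl; rewrite -[RHS]mulr1 -[d.+1 in RHS]card_ord -sum1_card natr_sum mulr_suml.
apply: eq_bigr => j _; rewrite mulr1; apply/min_idPl.
have [v0 _] := nu_barP x0; have vV := nu_bar_le_ub x0.
have sj := sg_max_le j.
have xs : x <= sg j by rewrite (le_trans xl)// (le_trans lambda_lb_le).
pose r := nu_ub / sg ord_max.
have r1 : 1 <= r by rewrite ler_pdivlMr// mul1r sg_max_le_nu_ub.
have r0 : 0 < r by rewrite divr_gt0.
have h1 : r^-1 <= sg j / nu_bar t c sigma x.
  rewrite /r invf_div ler_pdivrMr// mulrAC ler_pdivlMr//.
  by apply: ler_pM => //; exact: ltW.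
have h2 : r <= sg j / x.
  rewrite ler_pdivlMr//; apply: (le_trans (ler_wpM2l (ltW r0) xl)).
  by rewrite (_ : r * lambda_lb = sg ord_max)// /r /lambda_lb; field; rewrite !gt_eqF.
rewrite profile_small// -powR_div ?(ltW (sg0 j))//.
have r10 : 0 <= r^-1 by rewrite invr_ge0 ltW.
have h3 := ler_powR2 (le_trans ler01 t1) r10 h1.
have h4 : 0 <= 4 - t by have := t2; lra.
have h5 := ler_powR2 h4 (ltW r0) h2.
apply: le_trans (ler_pM (powR_ge0 _ _) (powR_ge0 _ _) h3 h5).
rewrite powR_inv// mulrC -powRB_gt0// -[leLHS](powRr0 r) ler_powR//.
by have := t2; lra.
Qed.

(** From u <= 2 u^2 + 1/8, each frequency is at most twice the mass plus E/8, where the exponential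
    E is at most 1/(d+1) at this x. The total is at most 2 c + 1/8 <= 1/4. *)
Lemma f_reg_large : f_reg (sg ord0 * d.+2%:R) < 1 / 2.
Proof.
set x := _ * _; have x0 : 0 < x by rewrite mulr_gt0.
have sx j : sg j < x.
  apply: (le_lt_trans (mono (leq0n j : (ord0 <= j)%N))).
  by rewrite /x ltr_pMr// ltr1n.
rewrite -f_sum_reg// f_sum_terms.
apply: (@le_lt_trans _ _ (\sum_j (2 * nu_term j x (nu_bar t c sigma x) + 8^-1 * d.+1%:R^-1))).
  apply: ler_sum => j _; rewrite /f_term /nu_term [x <= sg j]leNgt sx/=.
  have [v0 _] := nu_barP x0.
  rewrite -!powR_div ?(ltW (sg0 j))// [2 * t]mulrC powRrM powR_sqr ?powR_ge0//.
  set u := _ `^ t; set E := expR _.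
  have E0 : 0 <= E by exact: expR_ge0.
  have E1 : E <= d.+1%:R^-1.
    rewrite -[E]invrK lef_pV2 ?posrE ?invr_gt0 ?expR_gt0// -expRN opprD opprK.
    apply: le_trans (expR_ge1Dx _); rewrite [_ - 1]addrC addrA subrr add0r.
    have sj0 : 0 < sg j ^+ 2 by rewrite exprn_gt0.
    rewrite ler_pdivlMr// /x exprMn mulrC; apply: ler_pM.
    + exact: ltW.
    + exact: ler0n.
    + by rewrite ler_pXn2r ?nnegrE ?(ltW (sg0 _))//; exact: mono.
    + by rewrite -natrX ler_nat; apply: (@leq_trans d.+2 _ _ (leqnSn _)); rewrite leq_pmulr.
  apply: (@le_trans _ _ (2 * (u ^+ 2 * E) + 8^-1 * E)); last by rewrite lerD2l ler_pM2l.
  rewrite mulrA -mulrDl; apply: ler_wpM2r => //.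
  by have := sqr_ge0 (4 * u - 1); nra.
rewrite big_split/= -mulr_sumr nu_bar_terms// sumr_const card_ord.
rewrite -[_ *+ d.+1]mulr_natr mulfVK ?pnatr_eq0//.
by have := c16; lra.
Qed.

(** Below [lambda_lb] the sum is d+1 > s/2, which keeps the infimum positive; the intermediate value
    theorem makes the solution set nonempty, and continuity makes the infimum a solution. *)
Lemma lambdaP s : (1 <= s <= d.+1)%N ->
  0 < lambda t c sigma s /\ f_sum t c sigma (lambda t c sigma s) = s%:R / 2.
Proof.
move=> /andP[s1 sd]; set S := [set x | 0 <= x /\ f_sum t c sigma x = s%:R / 2].
have sd' : s%:R / 2 < d.+1%:R :> R.
  rewrite ltr_pdivrMr// (@le_lt_trans _ _ (d.+1%:R))//; first by rewrite ler_nat.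
  by rewrite ltr_pMr ?ltr0n// ltr1n.
have lbS : lbound S lambda_lb.
  move=> x /= [x0 fx]; rewrite leNgt; apply/negP => xl.
  suff : f_sum t c sigma x = d.+1%:R by rewrite fx => h; rewrite h ltxx in sd'.
  move: x0; rewrite le_eqVlt => /orP[/eqP <-|x0]; first exact: f_sum0.
  by rewrite f_sum_reg// f_reg_small// ltW.
have S0 : S !=set0.
  set x2 := sg ord0 * d.+2%:R.
  have x12 : lambda_lb <= x2.
    rewrite (le_trans lambda_lb_le)// (le_trans (sg_max_le ord0))//.
    by rewrite /x2 ler_peMr// ?(ltW (sg0 _))// ler1n.
  have cont : {within `[lambda_lb, x2], continuous f_reg}.
    apply: continuous_in_subspaceT => x /set_mem /=; rewrite in_itv/= => /andP[hx _].
    by apply: continuous_f_reg; exact: lt_le_trans hx.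
  have [|x] := @IVT R f_reg lambda_lb x2 (s%:R / 2) x12 cont.
    rewrite ge_min le_max f_reg_small// (ltW sd') /= (le_trans (ltW f_reg_large)) ?orbT//.
    by rewrite ler_pM2r// ler1n.
  rewrite in_itv/= => /andP[hx _] fx; have x0 := lt_le_trans lambda_lb0 hx.
  by exists x; split; [exact: ltW|rewrite f_sum_reg].
have iS : has_inf S by split=> //; exists lambda_lb.
have L0 : 0 < lambda t c sigma s.
  by apply: (lt_le_trans lambda_lb0); exact: lb_le_inf.
split => //; set L := lambda t c sigma s in L0 *.
apply/eqP; apply: contraT => fL.
have e0 : 0 < `|f_reg L - s%:R / 2| by rewrite normr_gt0 subr_eq0 -f_sum_reg.
have /cvgrPdist_lt /(_ _ e0) := continuous_f_reg L0.
move=> /nbhs_ballP[r /= r0 hr].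
(* A solution close to the infimum contradicts the gap that continuity gives around it. *)
have [x [x0 fx] xr] := inf_adherent r0 iS.
have xL : L <= x by apply: ge_inf => //; exists lambda_lb.
have : ball L r x.
  rewrite /ball/= /ball_/= distrC ger0_norm ?subr_ge0//.
  by rewrite ltrBlDl.
by move=> /hr; rewrite -fx f_sum_reg ?ltxx//; exact: lt_le_trans xL.
Qed.

Lemma lambda_gt0 s : (1 <= s <= d.+1)%N -> 0 < lambda t c sigma s.
Proof. by move=> /lambdaP[]. Qed.

Lemma nu_gt0 s : (1 <= s <= d.+1)%N -> 0 < nu t c sigma s.
Proof. by move=> /lambda_gt0 /nu_barP[]. Qed.

Lemma sum_mass s : (1 <= s <= d.+1)%N ->
  \sum_j mass t (lambda t c sigma s) (nu t c sigma s) (sg j) = c.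
Proof.
move=> hs; rewrite -[RHS](nu_bar_terms (lambda_gt0 hs)); apply: eq_bigr => j _.
by rewrite nu_term_mass// ?lambda_gt0//; exact: nu_gt0.
Qed.

Lemma sum_freq s : (1 <= s <= d.+1)%N ->
  \sum_j freq t (lambda t c sigma s) (nu t c sigma s) (sg j) = s%:R / 2.
Proof.
move=> hs; have [_ <-] := lambdaP hs; rewrite f_sum_terms; apply: eq_bigr => j _.
by rewrite f_term_freq// ?lambda_gt0//; exact: nu_gt0.
Qed.

Lemma ltn_i_star s (j : 'I_d.+1) : (1 <= s <= d.+1)%N ->
  let lam := lambda t c sigma s in
  (j < i_star t c sigma s)%N
    = (lam <= sg j) && (lam <= sg j * nratio t (nu t c sigma s) (sg j)).
Proof.
move=> hs lam; rewrite -(class_iff t12 (lambda_gt0 hs) (nu_gt0 hs) (sg0 j)).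
rewrite -(ltn_j_star mono) ltn_bigmax_prefix// => i k ik /andP[kj kl].
rewrite (leq_ltn_trans ik kj)/=; apply: le_trans kl _.
by rewrite ler_pXn2r ?nnegrE ?(ltW (sg0 _))//; exact: mono.
Qed.

End rate_parameters.
Lemma sum_take (R : realType) (d n : nat) (u : d.-tuple R) (F : R -> R) : (n <= d)%N ->
  \sum_(x <- take n u) F x = \sum_(j < d | (j < n)%N) F (tnth u j).
Proof.
move=> nd; rewrite (big_nth 0) size_take size_tuple.
have -> : (if (n < d)%N then n else d) = n.
  by case: ltnP => // h; apply/eqP; rewrite eqn_leq h nd.
rewrite (big_nat_widen _ _ d)// big_mkord.
by apply: eq_bigr => j /andP[_ jn]; rewrite nth_take// (tnth_nth 0).
Qed.

(** * The separation rate *)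

Section risk_bounds.
Context {R : realType} (t eta c lam v : R) (d s : nat) (sigma : d.-tuple R).
Local Notation sg := (tnth sigma).
Local Notation m j := (mass t lam v (sg j)).
Local Notation p j := (freq t lam v (sg j)).
Local Notation g j := (amplitude t lam v (sg j)).
Definition leading (j : 'I_d) : bool :=
  (lam <= sg j) && (lam <= sg j * nratio t v (sg j)).
Context (t12 : 1 <= t <= 2) (eta01 : 0 < eta < 1).
Context (lam0 : 0 < lam) (v0 : 0 < v) (sg0 : forall j, 0 < sg j) (s0 : (0 < s)%N).
Context (c0 : 0 < c) (c1 : c <= 1 / 16).
Context (sum_m : \sum_j m j = c) (sum_p : \sum_j p j = s%:R / 2).

Let t1 : 1 <= t. Proof. by case/andP: t12. Qed.
Let t2 : t <= 2. Proof. by case/andP: t12. Qed.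
Let t0 : 0 < t. Proof. exact: lt_le_trans ltr01 t1. Qed.
Let eta0 : 0 < eta. Proof. by case/andP: eta01. Qed.
Let eta1 : eta < 1. Proof. by case/andP: eta01. Qed.

Let m_le1 j : m j <= 1.
Proof.
apply: (@le_trans _ _ c); last by have := c1; lra.
rewrite -sum_m (bigD1 j)//= lerDl; apply: sumr_ge0 => i _; exact: mass_ge0.
Qed.

Let p_le1 j : p j <= 1. Proof. exact: freq_le1. Qed.

Local Notation rate := (lam `^ t * s%:R + v `^ t).

Let rate0 : 0 < rate.
Proof. by rewrite addr_gt0 ?mulr_gt0 ?powR_gt0// ltr0n. Qed.

(** This is 4 (M + 1) for K = 8/e, tau = 1040/e and beta = e/2. M is the sum of the two lower bounds
    asked of it: one absorbs the losses in the mean, the other gives 16 * 584/M <= e/4, which with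
    16 K^-2 = e^2/4 stays within beta. *)
Definition upper_cst (e : R) : R :=
  4 * (4 * (261 + 9 * (8 / e) ^+ 2 + 1040 / e) + 584 * 64 / e + 1).

Lemma minimax_risk_le eps : 0 < eps -> upper_cst eta * rate <= eps `^ t ->
  (minimax_risk eps s t sigma <= eta%:E)%E.
Proof.
move=> eps0 he; have e0 := eta0; have e1 := eta1.
have -> : eta = 2 * (eta / 2) by field.
have K2 : 2 <= 8 / eta by rewrite ler_pdivlMr//; lra.
have sqK : 0 <= (8 / eta) ^+ 2 by exact: sqr_ge0.
have h1 : 1 <= 584 * 64 / eta.
  rewrite -mulrA; apply: mulr_ege1; first by rewrite ler1n.
  by rewrite ler_pdivlMr ?mul1r; [rewrite (le_trans (ltW e1)) ?ler1n|].
have h2 : 0 < 1040 / eta by apply: divr_gt0; rewrite ?ltr0n.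
set M := 4 * (261 + 9 * (8 / eta) ^+ 2 + 1040 / eta) + 584 * 64 / eta.
have M1 : 4 * (261 + 9 * (8 / eta) ^+ 2 + 1040 / eta) <= M.
  by rewrite lerDl; apply: le_trans ler01 h1.
have M2 : 584 * 64 / eta <= M.
  by rewrite lerDr; lra.
apply: (@minimax_risk_le_rate _ t lam v (8 / eta) d sigma
  (fun j => weight t lam v (sg j)) (fun j => m j) t12 lam0 v0 K2 sg0 _ _ _ _ _ _
  eps (1040 / eta) (eta / 2) M s).
- by move=> j; exact: weight_ge0.
- by move=> j ?; exact: sqr_weight.
- exact: m_le1.
- by move=> j; exact: mass_ge0.
- by move=> j x ?; exact: powR_le_weight.
- by move=> j ?; exact: tail_le_mass.
- by rewrite sum_m; have := c1; lra.
- exact: h2.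
- exact: eps0.
- exact: le_trans h1 M2.
- rewrite (_ : eta / 2 * (1040 / eta) ^+ 2 = 520 * (1040 / eta)); last by field; rewrite gt_eqF.
  rewrite ler_peMr; [by []|by rewrite ler0n|].
  by rewrite ler_pdivlMr ?mul1r; [rewrite (le_trans (ltW e1)) ?ler1n|].
- exact: M1.
- rewrite (_ : 64 / M + 520 / M = 584 / M); last by ring.
  have M0 : 0 < M by apply: lt_le_trans M2; exact: lt_le_trans h1.
  have : 584 / M <= eta / 64.
    rewrite ler_pdivrMr// mulrAC ler_pdivlMr ?ltr0n// -ler_pdivrMl//.
    by rewrite mulrC.
  have -> : (8 / eta) ^- 2 = eta ^+ 2 / 64 by field; rewrite gt_eqF.
  by move=> ?; nra.
- exact: he.
Qed.

Let sg_neq0 j : sg j != 0. Proof. by rewrite gt_eqF. Qed.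

Let sum_m_leading : \sum_(j | leading j) m j <= c.
Proof.
rewrite -sum_m [leRHS](bigID leading)/= lerDl; apply: sumr_ge0 => j _; exact: mass_ge0.
Qed.

Let amplitude_leading : \sum_j p j * g j `^ t =
  \sum_(j | leading j) g j `^ t + lam `^ t * \sum_(j | ~~ leading j) p j.
Proof.
rewrite (bigID leading)/=; congr (_ + _).
  by apply: eq_bigr => j /andP[h1 h2]; rewrite /freq h1 h2 mul1r.
rewrite mulr_sumr; apply: eq_bigr => j nj.
by rewrite /amplitude -/(leading j) (negbTE nj) mulrC.
Qed.

Let rate_le : c / 4 * rate <=
  (\sum_(j | leading j) g j `^ t + lam `^ t * \sum_(j | ~~ leading j) p j) / 2.
Proof.
have c0' := c0; have c1' := c1.
rewrite -amplitude_leading.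
have h1 : lam `^ t * (s%:R / 2) <= \sum_j p j * g j `^ t.
  rewrite -sum_p mulr_sumr; apply: ler_sum => j _; rewrite mulrC.
  apply: ler_wpM2l; first exact: freq_ge0.
  by apply: ler_powR2 (ltW t0) (ltW lam0) _; exact: amplitude_ge.
have h2 : c * v `^ t <= \sum_j p j * g j `^ t.
  by rewrite -sum_m mulr_suml; apply: ler_sum => j _; exact: mass_le_freq.
have h3 : 0 <= lam `^ t * s%:R by rewrite mulr_ge0 ?powR_ge0.
by nra.
Qed.

(** A quarter of the available risk 1 - e: the chi-square distance and the two Chernoff tails of the
    sparse prior each cost at most one share, and the fourth keeps the inequality strict. *)
Definition prior_cst (e : R) : R := (1 - e) / 4.
(** The thinning factor exp(- rho) with rho = 1/2 + 1/kappa: then exp rho times the thinned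
    frequencies sums to at most s/2, and exp(1/2 - rho) = exp(- 1/kappa) <= kappa. *)
Definition rare (e : R) : R := expR (- (1 / 2 + (prior_cst e)^-1)).
Definition lower_cst (e c : R) : R := c * rare e * prior_cst e / 64.

Let kappa := prior_cst eta.
Let delta := rare eta.

Context (ck : 8 * expR 1 * c <= kappa ^+ 2).

Let kappa0 : 0 < kappa. Proof. by have := eta1; rewrite /kappa /prior_cst; lra. Qed.
Let kappa4 : kappa <= 1 / 4. Proof. by have := eta0; rewrite /kappa /prior_cst; lra. Qed.
Let kappa_eta : 4 * kappa = 1 - eta. Proof. by rewrite /kappa /prior_cst; lra. Qed.

(** With u = e c <= 1/128, the bound exp u <= 1 / (1 - u) gives exp u <= 1 + 2 u. *)
Let expR_c : expR (expR 1 * c) <= 1 + kappa ^+ 2.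
Proof.
have h0 : 0 <= expR 1 * c by rewrite mulr_ge0 ?expR_ge0 ?(ltW c0).
have h1 := ck; have h2 := kappa0; have h3 := kappa4; rewrite -mulrA in h1.
move: (expR 1 * c) h0 h1 => u u0 h.
have := expR_ge1Dx (- u); have := expR_gt0 u; have := expRxMexpNx_1 u.
move: (expR u) (expR (- u)) => E E' EE E0 hE'.
have h4 : E * (1 - u) <= 1 by rewrite -EE; apply: ler_wpM2l; [exact: ltW|lra].
have u1 : u <= 1 / 128 by nra.
have E2 : E <= 2 by nra.
have : E * u <= 2 * u by apply: ler_wpM2r.
by lra.
Qed.

Lemma minimax_risk_gt_rate eps : 0 <= eps -> eps `^ t <= lower_cst eta c * rate ->
  (eta%:E < minimax_risk eps s t sigma)%E.
Proof.
move=> eps0 he.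
have eta0' := ltW eta0; have k0 := kappa0; have k4 := kappa4; have ke := kappa_eta.
have keta : kappa < 1 - eta by lra.
have d0 : 0 < delta by exact: expR_gt0.
have d1 : delta <= 1.
  rewrite /delta /rare expR_le1 oppr_le0 addr_ge0// invr_ge0; exact: ltW.
have hrate := rate_le; have r0 := rate0; have c0' := c0.
have lE : lower_cst eta c = c / 4 * (delta * kappa / 16) 
  by rewrite /lower_cst -/kappa -/delta; field.
set A := \sum_(j | leading j) _ in hrate.
set G := lam `^ t * (\sum_(j | ~~ leading j) _) in hrate.
have dk : delta * kappa <= 1 by nra.
have dk0 : 0 < delta * kappa by rewrite mulr_gt0.
have he2 : eps `^ t <= delta * kappa / 16 * ((A + G) / 2).
  apply: (le_trans he); rewrite lE mulrAC mulrC ler_pM2l//; exact: divr_gt0.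
have A0 : 0 <= A by apply: sumr_ge0 => j _; exact: powR_ge0.
have G0 : 0 <= G by rewrite mulr_ge0 ?powR_ge0// sumr_ge0// => j _; exact: freq_ge0.
(* The bound [he2] involves the average of A and G, so the larger of the two alone dominates it. *)
have [GA|AG] := leP G A.
  apply: (@minimax_risk_gt_dense _ d sigma sg_neq0 kappa eta eps t s leading (fun j => g j)) => //.
  - by move=> j; apply/ltW/amplitude_gt0.
  (* Leading coordinates have frequency 1 and the frequencies sum to s/2. *)
  - rewrite -(ler_nat R) -sum1_card natr_sum.
    apply: (@le_trans _ _ (\sum_j p j)); last by rewrite sum_p ler_pdivrMr// ler_peMr// ler1n.
    rewrite [leRHS](bigID leading)/= -[leLHS]addr0 lerD//.
      by apply: ler_sum => j /andP[h1 h2]; rewrite /freq h1 h2.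
    by apply: sumr_ge0 => j _; exact: freq_ge0.
  - by apply: (le_trans he2); rewrite -/A; nra.
  - apply: le_trans expR_c; rewrite ler_expR.
    apply: (@le_trans _ _ (\sum_(j | leading j) expR 1 * m j)); last first.
      by rewrite -mulr_sumr ler_pM2l ?expR_gt0.
    apply: ler_sum => j /andP[h1 h2].
    have := sqr_freq_coshm1 lam0 v0 (sg0 j) (m_le1 j).
    by rewrite {1}/freq h1 h2 expr1n mul1r.
pose n := delta * \sum_(j | ~~ leading j) p j.
have GE : G = lam `^ t * n / delta by rewrite /G /n; field; rewrite gt_eqF.
have lt0 : 0 < lam `^ t by rewrite powR_gt0.
have coshm1_lam j : coshm1 (lam ^+ 2 / sg j ^+ 2) <= coshm1 (g j ^+ 2 / sg j ^+ 2).
  apply: coshm1_le; first by rewrite divr_ge0 ?sqr_ge0.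
  rewrite ler_pM2r ?invr_gt0 ?exprn_gt0// ler_pXn2r ?nnegrE ?(ltW lam0)//.
    exact: amplitude_ge.
  exact/ltW/amplitude_gt0.
have chi_le j : p j ^+ 2 * coshm1 (lam ^+ 2 / sg j ^+ 2) <= expR 1 * m j.
  apply: le_trans (sqr_freq_coshm1 lam0 v0 (sg0 j) (m_le1 j)).
  by apply: ler_wpM2l => //; exact: sqr_ge0.
(* The expected number n of nonzero entries after thinning must be at least 4/kappa for the lower
   Chernoff tail exp(- n/4) to be at most kappa. Otherwise G is at most a constant times lam^t, and
   one spike of size lam is enough. *)
have [nk|nk] := leP (4 / kappa) n.
  pose q j : R := if leading j then 0 else delta * p j.
  have sum_q : \sum_j q j = n.
    rewrite /n mulr_sumr [RHS]big_mkcond/=; apply: eq_bigr => j _.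
    by rewrite /q; case: (leading j).
  apply: (@minimax_risk_gt_sparse _ d sigma sg_neq0 kappa eta eps t s q lam (n / 4)
    (1 / 2 + kappa^-1)) => //.
  - move=> j; rewrite /q; case: ifP => _; first by rewrite lexx ler01.
    rewrite mulr_ge0 ?freq_ge0 ?(ltW d0)//= -[leRHS]mul1r.
    by apply: ler_pM; rewrite ?freq_ge0// ltW.
  - apply: le_trans expR_c; rewrite ler_expR -sum_m mulr_sumr.
    apply: ler_sum => j _; apply: le_trans (chi_le j).
    apply: ler_wpM2r; first exact: coshm1_ge0.
    rewrite /q; case: ifP => _; first by rewrite expr0n sqr_ge0.
    by rewrite exprMn ler_piMl ?sqr_ge0// expr_le1 ?(ltW d0).
  - by rewrite lerDl invr_ge0 ltW.
  - rewrite sum_q /n mulrA /delta /rare -/kappa expRN divff ?gt_eqF ?expR_gt0// mul1r.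
    rewrite -sum_p [leRHS](bigID leading)/= lerDr sumr_ge0// => j _; exact: freq_ge0.
  - by rewrite sum_q.
  - apply: (le_trans he2).
    have : G = lam `^ t * n / delta by [].
    move=> GE2; have Gd : delta * G = lam `^ t * n by rewrite GE2; field; rewrite gt_eqF.
    have hk : kappa * (A + G) <= 2 * G by nra.
    have hh : delta * (kappa * (A + G)) <= delta * (2 * G) by rewrite ler_pM2l.
    have dG : 0 <= delta * G by apply: mulr_ge0 => //; exact: ltW.
    rewrite (_ : lam `^ t * (n / 4) = delta * G / 4); last by rewrite Gd mulrA.
    by lra.
  - rewrite (_ : 1 / 2 - (1 / 2 + kappa^-1) = - kappa^-1); last by ring.
    have ki0 : 0 < kappa^-1 by rewrite invr_gt0.
    have h1 : expR (- kappa^-1) <= kappa.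
      rewrite expRN -[leRHS]invrK lef_pV2 ?posrE ?expR_gt0//.
      by apply: le_trans (expR_ge1Dx _); rewrite lerDr.
    have h2 : expR (- (n / 4)) <= kappa.
      by apply: le_trans h1; rewrite ler_expR lerN2 ler_pdivlMr// mulrC.
    lra.
have s2 : 1 / 2 <= s%:R / 2 :> R by rewrite ler_pM2r// ler1n.
have s20 : 0 < s%:R / 2 :> R by lra.
(* Normalised frequencies are used on all coordinates, leading ones included: lowering their
   amplitude to lam only decreases the chi-square distance. As s/2 >= 1/2, squaring the
   normalisation costs a factor at most 4. *)
apply: (@minimax_risk_gt_single _ d sigma sg_neq0 kappa eta eps t s
  (fun j => p j / (s%:R / 2)) lam) => //.
- have hl : eps `^ t <= lam `^ t.
    apply: (le_trans he2); have Gd : delta * G = lam `^ t * n.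
      by rewrite GE; field; rewrite gt_eqF.
    have kn : kappa * n <= 4 by move: nk; rewrite ltr_pdivlMr// mulrC => /ltW.
    have : delta * kappa * G <= lam `^ t * 4.
      by rewrite mulrAC Gd -mulrA [n * _]mulrC ler_pM2l.
    by nra.
  rewrite leNgt; apply/negP => h; move: hl; rewrite leNgt => /negP; apply.
  exact: ltr_powR2 (ltW lam0) h.
- by move=> j; rewrite divr_ge0 ?freq_ge0// ltW.
- by rewrite -mulr_suml sum_p divff// gt_eqF.
- apply: (@le_trans _ _ (\sum_j 4 * (expR 1 * m j))); last first.
    by rewrite -!mulr_sumr sum_m; have := ck; have := expR_gt0 (1 : R); nra.
  apply: ler_sum => j _; rewrite expr_div_n mulrAC.
  have h0 : 0 <= p j ^+ 2 * coshm1 (lam ^+ 2 / sg j ^+ 2).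
    by rewrite mulr_ge0 ?sqr_ge0 ?coshm1_ge0.
  have s4 : 1 / 4 <= (s%:R / 2) ^+ 2 :> R by nra.
  rewrite ler_pdivrMr; last by rewrite exprn_gt0.
  by have := chi_le j; nra.
Qed.

Lemma upper_cst_gt0 : 0 < upper_cst eta.
Proof.
have e0 := eta0.
have h1 : 0 < eta^-1 by rewrite invr_gt0.
have h2 : 0 <= (8 / eta) ^+ 2 by exact: sqr_ge0.
by rewrite /upper_cst; lra.
Qed.

Let powR_rootK x : 0 <= x -> (x `^ t^-1) `^ t = x.
Proof. by move=> x0; rewrite -powRrM mulVf ?gt_eqF// powRr1. Qed.

Lemma lower_cst_gt0 : 0 < lower_cst eta c.
Proof.
apply: divr_gt0; last by rewrite ltr0n.
apply: mulr_gt0 => //; apply: mulr_gt0 => //; exact: expR_gt0.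
Qed.

Local Notation critical := [set eps | 0 < eps /\ (minimax_risk eps s t sigma <= eta%:E)%E].

Let critical_upper : critical ((upper_cst eta * rate) `^ t^-1).
Proof.
have h : 0 < upper_cst eta * rate by rewrite mulr_gt0// upper_cst_gt0.
split; first exact: powR_gt0.
apply: minimax_risk_le; first exact: powR_gt0.
by rewrite powR_rootK// ltW.
Qed.

Lemma eps_star_le : eps_star eta s t sigma `^ t <= upper_cst eta * rate.
Proof.
have h : 0 < upper_cst eta * rate by rewrite mulr_gt0// upper_cst_gt0.
rewrite -[leRHS](powR_rootK (ltW h)).
apply: ler_powR2 (ltW t0) _ _.
  apply: lb_le_inf; first by exists ((upper_cst eta * rate) `^ t^-1).
  by move=> eps [] /ltW.
by apply: ge_inf => //; exists 0 => eps [] /ltW.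
Qed.

Lemma eps_star_ge : lower_cst eta c * rate <= eps_star eta s t sigma `^ t.
Proof.
have h : 0 < lower_cst eta c * rate.
  by rewrite mulr_gt0// lower_cst_gt0.
rewrite -[leLHS](powR_rootK (ltW h)).
apply: ler_powR2 (ltW t0) (powR_ge0 _ _) _.
(* The upper bound supplies an element of the critical set; a lower bound of an empty set would say
   nothing about its infimum. *)
apply: lb_le_inf; first by exists ((upper_cst eta * rate) `^ t^-1).
move=> eps [eps0]; apply: contraTT; rewrite -ltNge -ltNge => hlt.
apply: minimax_risk_gt_rate; first exact: ltW.
rewrite -[leRHS](powR_rootK (ltW h)).
exact: ler_powR2 (ltW t0) (ltW eps0) (ltW hlt).
Qed.

Section leading_norm.
Context (u : seq R).
Context (sum_u : \sum_(x <- u) `|x| `^ exp_a t = \sum_(j | leading j) sg j `^ exp_a t).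
Local Notation a := (exp_a t).

Let a1 : 1 <= a. Proof. exact: exp_a_ge1. Qed.
Let a0 : 0 < a. Proof. exact: lt_le_trans ltr01 a1. Qed.

(** On leading coordinates the mass is nratio^4 = (sigma_j / v)^a, which is why the exponent a
    appears in the norm. *)
Let sum_mass_leading :
  \sum_(x <- u) `|x| `^ a = v `^ a * \sum_(j | leading j) m j.
Proof.
rewrite sum_u mulr_sumr; apply: eq_bigr => j /andP[h1 h2].
rewrite /mass h1 h2 -(nratio_exp_a v t12) powR_div ?(ltW (sg0 j))//.
by rewrite mulrC divfK// gt_eqF// powR_gt0.
Qed.

Let powR_root x : 0 <= x -> (x `^ a) `^ a^-1 = x.
Proof. by move=> x0; rewrite -powRrM mulfV ?gt_eqF// powRr1. Qed.

Lemma leading_norm_le : lpnorm a u `^ t <= v `^ t.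
Proof.
apply: ler_powR2 (ltW t0) (powR_ge0 _ _) _.
rewrite -[leRHS](powR_root (ltW v0)) /lpnorm sum_mass_leading.
apply: ler_powR2; first by rewrite invr_ge0 ltW.
  by rewrite mulr_ge0 ?powR_ge0// sumr_ge0// => j _; exact: mass_ge0.
rewrite ler_piMr ?powR_ge0//; apply: (le_trans sum_m_leading).
by have := c1; lra.
Qed.

(** If the leading masses reach c/2, the norm is at least (c/2)^(1/a) v >= (c/2) v, and t <= 2
    bounds v^t by 4/c^2 times its t-th power. Otherwise the other masses reach c/2; those
    coordinates have amplitude lam, so [mass_le_freq] bounds c v^t by lam^t s. *)
Lemma rate_le_leading :
  rate <= (1 + 4 / c ^+ 2) * (lam `^ t * s%:R + lpnorm a u `^ t).
Proof.
have c0' := c0; have c1' := c1.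
have X0 : 0 <= lam `^ t * s%:R by rewrite mulr_ge0 ?powR_ge0.
have N0 : 0 <= lpnorm a u `^ t by exact: powR_ge0.
have C0 : 1 / c <= 4 / c ^+ 2.
  by rewrite ler_pdivrMr// expr2 invfM mulrA mulfVK ?gt_eqF// ler_pdivlMr//; lra.
have C1 : 0 <= 4 / c ^+ 2 by rewrite divr_ge0 ?sqr_ge0.
suff : v `^ t <= (1 / c) * (lam `^ t * s%:R) \/ v `^ t <= 4 / c ^+ 2 * lpnorm a u `^ t.
  by case=> h; nra.
have [h|h] := leP (\sum_(j | leading j) m j) (c / 2).
  left; rewrite mulrC mulrA mulr1 ler_pdivlMr// mulrC.
  have h2 : c / 2 <= \sum_(j | ~~ leading j) m j.
    by have := sum_m; rewrite (bigID leading)/=; lra.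
  have h3 : (\sum_(j | ~~ leading j) m j) * v `^ t <= lam `^ t * (s%:R / 2).
    rewrite -sum_p mulr_suml [in leRHS](bigID leading)/= mulrDr.
    apply: (@le_trans _ _ (lam `^ t * \sum_(j | ~~ leading j) p j)); last first.
      by rewrite lerDr mulr_ge0 ?powR_ge0// sumr_ge0// => j _; exact: freq_ge0.
    rewrite mulr_sumr; apply: ler_sum => j nj.
    apply: (le_trans (mass_le_freq t12 lam0 v0 (sg0 j))).
    by rewrite /amplitude -/(leading j) (negbTE nj) mulrC.
  have h4 : c / 2 * v `^ t <= (\sum_(j | ~~ leading j) m j) * v `^ t.
    by apply: ler_wpM2r => //; exact: powR_ge0.
  by lra.
right; have c20 : 0 < c / 2 by lra.
have c21 : 0 < c / 2 <= 1 by apply/andP; split; lra.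
have hN : c / 2 * v <= lpnorm a u.
  rewrite -[v](powR_root (ltW v0)) /lpnorm sum_mass_leading.
  apply: (@le_trans _ _ ((c / 2) `^ a^-1 * (v `^ a) `^ a^-1)).
    apply: ler_wpM2r; first exact: powR_ge0.
    by rewrite -[leLHS](powRr1 (ltW c20)) ger_powR// invf_le1.
  rewrite -powRM ?powR_ge0 ?(ltW c20)//; apply: ler_powR2.
  - by rewrite invr_ge0 ltW.
  - by rewrite mulr_ge0 ?powR_ge0// ltW.
  - by rewrite mulrC ler_wpM2l ?powR_ge0// ltW.
have h5 : (c / 2) ^+ 2 * v `^ t <= lpnorm a u `^ t.
  apply: (@le_trans _ _ ((c / 2 * v) `^ t)); last first.
    by apply: ler_powR2 (ltW t0) _ hN; rewrite mulr_ge0// ltW.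
  rewrite powRM ?(ltW c20) ?(ltW v0)//; apply: ler_wpM2r; first exact: powR_ge0.
  by rewrite -powR_sqr ?(ltW c20)// ger_powR.
rewrite (_ : v `^ t = 4 / c ^+ 2 * ((c / 2) ^+ 2 * v `^ t)); last first.
  by field; rewrite gt_eqF.
exact: ler_wpM2l.
Qed.

End leading_norm.

End risk_bounds.

Theorem corollary3 (R : realType) (eta t : R) :
  0 < eta < 1 -> 1 <= t <= 2 ->
  exists c_nu c C : R,
    [/\ 0 < c_nu, 0 < c, 0 < C &
      forall (d s : nat) (sigma : d.-tuple R),
        (1 <= d)%N -> (1 <= s <= d)%N ->
        (forall j : 'I_d, 0 < tnth sigma j) ->
        (forall i j : 'I_d, (i <= j)%N -> tnth sigma j <= tnth sigma i) ->
        let lam := lambda t c_nu sigma s in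
        let nu := nu t c_nu sigma s in
        let i_star := i_star t c_nu sigma s in
        asymp c C (eps_star eta s t sigma `^ t) (lam `^ t * s%:R + nu `^ t) /\
        asymp c C (lam `^ t * s%:R + nu `^ t)
                  (lam `^ t * s%:R + lpnorm (exp_a t) (take i_star sigma) `^ t)].
Proof.
move=> eta01 t12; have /andP[eta0 eta1] := eta01.
have k0 : 0 < prior_cst eta by rewrite /prior_cst; lra.
have k4 : prior_cst eta <= 1 / 4 by rewrite /prior_cst; lra.
have e1 : 1 <= expR 1 :> R by rewrite -[leLHS]expR0 ler_expR.
(* This choice gives equality in the chi-square condition [ck]; the bound 1/16 needed for the
   existence of lambda follows from kappa <= 1/4. *)
pose c_nu := prior_cst eta ^+ 2 / (8 * expR 1).
have e0 : 0 < 8 * expR 1 :> R by rewrite mulr_gt0 ?expR_gt0.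
have cn0 : 0 < c_nu by rewrite divr_gt0// exprn_gt0.
have ck : 8 * expR 1 * c_nu <= prior_cst eta ^+ 2.
  by rewrite /c_nu mulrC divfK// gt_eqF.
have c16 : c_nu <= 1 / 16 by rewrite /c_nu ler_pdivrMr//; nra.
have l0 := lower_cst_gt0 eta01 cn0.
exists c_nu, (Num.min (lower_cst eta c_nu) 1),
  (Num.max (upper_cst eta) (1 + 4 / c_nu ^+ 2)); split => //.
- by rewrite lt_min l0 ltr01.
- by rewrite lt_max upper_cst_gt0.
move=> [//|d] s sigma _ hs sg0 mono lam nu' i_s.
have lam0 : 0 < lam := lambda_gt0 t12 cn0 c16 sg0 mono hs.
have v0 : 0 < nu' := nu_gt0 t12 cn0 c16 sg0 mono hs.
have sm := sum_mass t12 cn0 c16 sg0 mono hs.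
have sp := sum_freq t12 cn0 c16 sg0 mono hs.
have s0 : (0 < s)%N by case/andP: hs.
set rate := lam `^ t * s%:R + nu' `^ t.
have r0 : 0 <= rate by rewrite addr_ge0 ?mulr_ge0 ?powR_ge0.
have su : \sum_(x <- take i_s sigma) `|x| `^ exp_a t
    = \sum_(j | leading t lam nu' sigma j) tnth sigma j `^ exp_a t.
  rewrite sum_take; last by apply/bigmax_leqP => j _; exact: ltn_ord.
  apply: eq_big => j.
    by rewrite (ltn_i_star t12 cn0 c16 sg0 mono).
  by move=> _; rewrite ger0_norm ?(ltW (sg0 j)).
have r'0 : 0 <= lam `^ t * s%:R + lpnorm (exp_a t) (take i_s sigma) `^ t.
  by rewrite addr_ge0 ?mulr_ge0 ?powR_ge0.
split; apply/andP; split.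
- apply: le_trans (eps_star_ge t12 eta01 lam0 v0 sg0 s0 cn0 c16 sm sp ck).
  by apply: ler_wpM2r => //; rewrite ge_min lexx.
- apply: (le_trans (eps_star_le t12 eta01 lam0 v0 sg0 s0 c16 sm)).
  by apply: ler_wpM2r => //; rewrite le_max lexx.
- apply: (@le_trans _ _ (lam `^ t * s%:R + lpnorm (exp_a t) (take i_s sigma) `^ t)).
    by rewrite ler_piMl// ge_min lexx orbT.
  by rewrite lerD2l; exact: (leading_norm_le t12 v0 sg0 c16 sm su).
- apply: (le_trans (rate_le_leading t12 lam0 v0 sg0 cn0 c16 sm sp su)).
  by apply: ler_wpM2r => //; rewrite le_max lexx orbT.
Qed.
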